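(* Let $f_k:[0,m_kL]\times S^1\to\mathbb R^n$ and $\mathfrak a_k',\mathfrak b_k'$ be as described in the context (conformal Willmore immersions satisfying A1)–A3), neck data (N1)–(N3), and refined neck data (R1)–(R2)). For any sequence $i_k$ with $i_k-\mathfrak a_k'\to\infty$ and $\mathfrak b_k'-i_k\to\infty$, with $\hat f_k,\hat H_k,\hat\epsilon_k$ and $e_1,e_2,v_1,v_2$ as in the context (along the corresponding subsequence): 1) $\dfrac{\hat f_k-\mathcal G_1(\hat f_k)}{\hat\epsilon_k}$ converges in $C^\infty_{loc}(\mathbb R\times S^1)$, up to the addition of a constant (vector, possibly depending on $k$), to $$\phi=\Big(-\frac1{2m}\big(t-\tfrac L2\big)-\frac1{4m^2}\Big)e^{-mt}(v_1\cos m\theta+v_2\sin m\theta).$$ 2) $\dfrac{\hat H_k-\mathcal F_1(\hat H_k)}{\hat\epsilon_k^2}$ converges in $C^\infty_{loc}(\mathbb R\times S^1)$ to a function with image in $\mathrm{span}\{e_1,e_2\}$.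
   Context: $S^1=\mathbb R/2\pi\mathbb Z$, coordinates $(t,\theta)$, $Q_i=[(i-1)L,iL]\times S^1$. For a conformal immersion $f$ with $g=f^*g_{\mathbb R^n}=e^{2u}(dt^2+d\theta^2)$: $A_{ij}=(\partial_i\partial_jf)^\perp$, $|A|$ its norm with respect to $g$, $H=g^{ij}A_{ij}$ the mean curvature vector, $W(f,\Omega)=\int_\Omega|H|^2dV_g$. $f$ is Willmore if it is a critical point of $W$, equivalently $\Delta H=-2\partial_q(e^{-2u}(H\cdot A_{pq})\partial_pf)+\frac12\partial_q(|H|^2\partial_qf)$, $\Delta=\partial_t^2+\partial_\theta^2$. $\|A_k\|_{L^2(Q_i)}^2=\int_{Q_i}|A_k|^2dV_{g_k}$. Assumptions, with $T_k=m_kL$ and $m\ge1$ a fixed integer: A1) $u_k=-mt+v_k$, $\|v_k(0,\cdot)\|_{L^\infty(S^1)}\le1$, $\|\nabla v_k\|_{L^\infty([0,T_k]\times S^1)}\to0$; A2) $\Theta_k=\sup_{t\in[0,T_k-1]}\int_{[t,t+1]\times S^1}|A_k|^2dV_{g_k}\to0$; A3) $\int_0^{2\pi}f_k(T_k-1,\theta)d\theta=0$. Notation: for a (vector-valued) function $u(t,\theta)$, $\varphi(t)=\frac1\pi(\int_0^{2\pi}u\cos m\theta d\theta,\int_0^{2\pi}u\sin m\theta d\theta)$, $g^+(u)=\varphi'+m\varphi$, $g^-(u)=m\varphi-\varphi'$, $$\mathcal F_i(u)=\frac{g^+(u)((2i-1)L/2)}{2m}e^{mt-m(2i-1)L/2}\cdot(\cos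 m\theta,\sin m\theta),\quad \mathcal G_i(u)=\frac{g^-(u)((2i-1)L/2)}{2m}e^{-mt+m(2i-1)L/2}\cdot(\cos m\theta,\sin m\theta);$$ $\lambda_i=\Big(\int_{Q_i}e^{-2mt}|\mathcal F_i(H_k)|^2/\int_{Q_i}e^{-2mt}|H_k|^2\Big)^{1/2}$, $\mu_i=W(f_k,Q_i)/\int_{Q_i}|A_k|^2dV_{g_k}$, $\nu_i=\int_{Q_i}e^{-2mt}|H_k-\mathcal F_i(H_k)|^2/\int_{Q_i}e^{-2mt}|\mathcal F_i(H_k)|^2$ (integrals in $dtd\theta$). Neck data: $q\in(0,2)$, $L$ is a sufficiently large constant depending on $q$ and $m$, and $\mathfrak a_k,\mathfrak b_k$ are integers with (N1) $0<\mathfrak a_k<\mathfrak b_k<m_k$, $\mathfrak b_k-\mathfrak a_k\to\infty$; (N2) for every $p>0$, $\lim_{k}\big(\sum_{i=1}^{\mathfrak a_k}+\sum_{i=\mathfrak b_k}^{m_k}\big)\|A_k\|^p_{L^2(Q_i)}=0$; (N3) $\lim_{l\to\infty}\lim_{k\to\infty}\max_{\mathfrak a_k+l<i<\mathfrak b_k-l}(\nu_i+|\lambda_i-1|+|1-\mu_i|)=0$. Refined neck data: integers $\mathfrak a_k<\mathfrak a_k'<\mathfrak b_k'<\mathfrak b_k$ such that (R1) for any $p>0$, $\lim_{k}\big(\sum_{i=1}^{\mathfrak a_k'}+\sum_{i=\mathfrak b_k'}^{m_k}\big)\|A_k\|^p_{L^2(Q_i)}=0$; (R2) there is $C$ independent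 of $k,i$ with $\int_{Q_i}e^{-2u_k}|f_k-\mathcal G_i(f_k)|^2dtd\theta\le CW(f_k,Q_i)$ and $\int_{Q_i}e^{2u_k}|H_k-\mathcal F_i(H_k)|^2dtd\theta\le C(W(f_k,Q_i))^2$ for $\mathfrak a_k'<i<\mathfrak b_k'$. Rescaled maps: with $c_k^i=u_k((i-1)L,0)$, $f_k^i(t,\theta)=e^{-c_k^i}\big(f_k((i-1)L+t,\theta)-\frac1{2\pi}\int_0^{2\pi}f_k((i-1)L,\theta')d\theta'\big)$; $\hat f_k=f_k^{i_k}$, $\hat H_k$ is its mean curvature vector, $\hat\epsilon_k=\sqrt{W(\hat f_k,Q_1)/(\pi L)}$. After passing to a subsequence there are an orthonormal basis $(e_i)$ of $\mathbb R^n$ and $v_1,v_2\in\mathrm{span}\{e_3,\dots,e_n\}$ with $|v_1|^2+|v_2|^2=1$ such that, in $C^\infty_{loc}(\mathbb R\times S^1)$, $\hat f_k\to\frac1me^{-mt}(\cos m\theta\,e_1+\sin m\theta\,e_2)$ and $\hat H_k/\hat\epsilon_k\to e^{mt}(v_1\cos m\theta+v_2\sin m\theta)$; these are the $e_1,e_2,v_1,v_2$ and the subsequence in the claim. *)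

(* Defs.v *)
From Stdlib Require Export Reals.
From Coquelicot Require Export Coquelicot.
From mathcomp Require Export ssreflect ssrfun ssrbool eqtype ssrnat seq fintype bigop.

Set Implicit Arguments.
Unset Strict Implicit.
Unset Printing Implicit Defensive.

Local Open Scope R_scope.

(** Conventions.  A map on the cylinder [I x S^1], [S^1 = R / 2 pi Z], is a function
    [R -> R -> _] of [(t, theta)] that is [2 pi]-periodic in [theta] for [t] in [I];
    its values for [t] outside a neighbourhood of [I] carry
    no meaning.  All derivatives and integrals of
    vector-valued maps are taken component by component. *)

Definition vec (n : nat) : Type := 'I_n -> R.

Definition dot n (x y : vec n) : R := \big[Rplus/0]_(j < n) (x j * y j).

Definition normsq n (x : vec n) : R := dot x x.

(** ** Partial derivatives and smoothness *)

(** The coordinate index: [false] is [t], [true] is [theta]. *)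
Definition partial (d : bool) (F : R -> R -> R) (t th : R) : R :=
  if d then Derive (fun z => F t z) th else Derive (fun s => F s th) t.

Definition partial_multi (p q : nat) (F : R -> R -> R) : R -> R -> R :=
  iter p (partial false) (iter q (partial true) F).

Definition sum2 (F : bool -> R) : R := F false + F true.

(** Class [C^k] on the open set of all [(t, theta)] with [D t], for [D] open. *)
Fixpoint Ck (D : R -> Prop) (k : nat) (F : R -> R -> R) {struct k} : Prop :=
  match k with
  | O => forall t th, D t -> continuity_2d_pt F t th
  | S k' =>
      (forall t th, D t ->
         ex_derive (fun s => F s th) t /\ ex_derive (fun z => F t z) th) /\
      Ck D k' (partial false F) /\ Ck D k' (partial true F)
  end.

Definition smooth n (D : R -> Prop) (f : R -> R -> vec n) : Prop :=
  forall (k : nat) (j : 'I_n), Ck D k (fun t th => f t th j).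

(** Convergence in [C^infty_loc(R x S^1)].  The [F k] may be defined only on
    cylinders that exhaust [R x S^1]. *)
Definition Cinf_loc_lim n (F : nat -> R -> R -> vec n) (G : R -> R -> vec n) : Prop :=
  smooth (fun _ => True) G /\
  (forall t th j, G t (th + 2 * PI) j = G t th j) /\
  forall a : R, 0 < a ->
    eventually (fun k => smooth (fun t => Rabs t < a) (F k)) /\
    forall (p q : nat) (eps : R), 0 < eps ->
      eventually (fun k => forall t th (j : 'I_n), Rabs t <= a ->
        Rabs (partial_multi p q (fun s z => F k s z j) t th
              - partial_multi p q (fun s z => G s z j) t th) < eps).

(** ** Geometry of a conformal immersion *)

Definition dvec n (d : bool) (f : R -> R -> vec n) (t th : R) : vec n :=
  fun j => partial d (fun s z => f s z j) t th.

(** [u], where [f^* g_{R^n} = e^{2u} (dt^2 + dtheta^2)]. *)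
Definition conf_factor n (f : R -> R -> vec n) (t th : R) : R :=
  ln (normsq (dvec false f t th)) / 2.

Definition conformal_immersion_at n (f : R -> R -> vec n) (t th : R) : Prop :=
  0 < normsq (dvec false f t th) /\
  normsq (dvec true f t th) = normsq (dvec false f t th) /\
  dot (dvec false f t th) (dvec true f t th) = 0.

(** Normal component of [w] at a point where [f] is a conformal immersion: there the
    [e^{-u} d_r f] form an orthonormal basis of the tangent plane. *)
Definition normal_part n (f : R -> R -> vec n) (t th : R) (w : vec n) : vec n :=
  fun j => w j - sum2 (fun r =>
    exp (- 2 * conf_factor f t th) * dot w (dvec r f t th) * dvec r f t th j).

Definition sff n (f : R -> R -> vec n) (p q : bool) (t th : R) : vec n :=
  normal_part f t th (dvec p (dvec q f) t th).

(** [|A|^2 = g^{ip} g^{jq} A_ij . A_pq]. *)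
Definition sff_normsq n (f : R -> R -> vec n) (t th : R) : R :=
  exp (- 4 * conf_factor f t th) *
  sum2 (fun p => sum2 (fun q => normsq (sff f p q t th))).

(** [H = g^{ij} A_ij] (no factor 1/2). *)
Definition mean_curv n (f : R -> R -> vec n) (t th : R) : vec n :=
  fun j => exp (- 2 * conf_factor f t th) * sum2 (fun p => sff f p p t th j).

(** [Delta H = -2 d_q(e^{-2u} (H . A_pq) d_p f) + 1/2 d_q(|H|^2 d_q f)], the
    Euler-Lagrange equation of [W] in conformal coordinates. *)
Definition willmore_at n (f : R -> R -> vec n) (t th : R) : Prop :=
  forall j : 'I_n,
    sum2 (fun q => partial q (partial q (fun s z => mean_curv f s z j)) t th) =
    - 2 * sum2 (fun q => sum2 (fun p => partial q (fun s z =>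
            exp (- 2 * conf_factor f s z)
            * dot (mean_curv f s z) (sff f p q s z) * dvec p f s z j) t th))
    + / 2 * sum2 (fun q => partial q (fun s z =>
            normsq (mean_curv f s z) * dvec q f s z j) t th).

(** Smoothness on the closed cylinder means that [f] is smooth on a slightly larger
    open one; conformality and the Willmore equation are imposed on the closed one. *)
Definition conformal_willmore_immersion n (T : R) (f : R -> R -> vec n) : Prop :=
  (exists delta : R, 0 < delta /\
     smooth (fun t => - delta < t < T + delta) f /\
     forall t th, - delta < t < T + delta ->
       forall j, f t (th + 2 * PI) j = f t th j) /\
  (forall t th, 0 <= t <= T -> conformal_immersion_at f t th) /\
  (forall t th, 0 <= t <= T -> willmore_at f t th).

(** ** Integrals over [ [a, b] x S^1 ] and [Q_i] *)

Definition int_cyl (a b : R) (F : R -> R -> R) : R :=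
  RInt (fun t => RInt (fun th => F t th) 0 (2 * PI)) a b.

Definition int_Q (L : R) (i : nat) (F : R -> R -> R) : R :=
  int_cyl ((INR i - 1) * L) (INR i * L) F.

Definition sff_energy n (f : R -> R -> vec n) (a b : R) : R :=
  int_cyl a b (fun t th => sff_normsq f t th * exp (2 * conf_factor f t th)).

Definition sff_energy_Q n (L : R) (f : R -> R -> vec n) (i : nat) : R :=
  sff_energy f ((INR i - 1) * L) (INR i * L).

Definition willmore_Q n (L : R) (f : R -> R -> vec n) (i : nat) : R :=
  int_Q L i (fun t th => normsq (mean_curv f t th) * exp (2 * conf_factor f t th)).

(** ** The projections [F_i] and [G_i] *)

Definition fourier_cos (m : nat) (F : R -> R -> R) (t : R) : R :=
  / PI * RInt (fun th => F t th * cos (INR m * th)) 0 (2 * PI).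

Definition fourier_sin (m : nat) (F : R -> R -> R) (t : R) : R :=
  / PI * RInt (fun th => F t th * sin (INR m * th)) 0 (2 * PI).

Definition gplus (m : nat) (phi : R -> R) (t : R) : R := Derive phi t + INR m * phi t.

Definition gminus (m : nat) (phi : R -> R) (t : R) : R := INR m * phi t - Derive phi t.

Definition midQ (L : R) (i : nat) : R := (2 * INR i - 1) * L / 2.

Definition projF n (m : nat) (L : R) (i : nat) (f : R -> R -> vec n) (t th : R) : vec n :=
  fun j =>
    let F := fun s z => f s z j in
    / (2 * INR m) * exp (INR m * t - INR m * midQ L i) *
    (gplus m (fourier_cos m F) (midQ L i) * cos (INR m * th)
     + gplus m (fourier_sin m F) (midQ L i) * sin (INR m * th)).

Definition projG n (m : nat) (L : R) (i : nat) (f : R -> R -> vec n) (t th : R) : vec n :=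
  fun j =>
    let F := fun s z => f s z j in
    / (2 * INR m) * exp (- INR m * t + INR m * midQ L i) *
    (gminus m (fourier_cos m F) (midQ L i) * cos (INR m * th)
     + gminus m (fourier_sin m F) (midQ L i) * sin (INR m * th)).

Definition vsub n (x y : vec n) : vec n := fun j => x j - y j.

(** ** The quantities [lambda_i], [mu_i], [nu_i] *)

Definition lambda_Q n (m : nat) (L : R) (f : R -> R -> vec n) (i : nat) : R :=
  let H := mean_curv f in
  sqrt (int_Q L i (fun t th => exp (- 2 * INR m * t) * normsq (projF m L i H t th))
        / int_Q L i (fun t th => exp (- 2 * INR m * t) * normsq (H t th))).

Definition mu_Q n (L : R) (f : R -> R -> vec n) (i : nat) : R :=
  willmore_Q L f i / sff_energy_Q L f i.

Definition nu_Q n (m : nat) (L : R) (f : R -> R -> vec n) (i : nat) : R :=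
  let H := mean_curv f in
  int_Q L i (fun t th =>
    exp (- 2 * INR m * t) * normsq (vsub (H t th) (projF m L i H t th)))
  / int_Q L i (fun t th => exp (- 2 * INR m * t) * normsq (projF m L i H t th)).

(** ** Standing assumptions on the sequence *)

(** A supremum over [D k] of [|F k|] that tends to [0]. *)
Definition sup_to_0 (X : Type) (D : nat -> X -> Prop) (F : nat -> X -> R) : Prop :=
  forall eps : R, 0 < eps ->
    eventually (fun k => forall x, D k x -> Rabs (F k x) <= eps).

Definition conf_remainder n (m : nat) (f : R -> R -> vec n) (t th : R) : R :=
  conf_factor f t th + INR m * t.

Definition grad_norm (F : R -> R -> R) (t th : R) : R :=
  sqrt (partial false F t th ^ 2 + partial true F t th ^ 2).

Definition conf_factor_assumption n (m : nat) (T : nat -> R)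
    (f : nat -> R -> R -> vec n) : Prop :=
  (forall k th, Rabs (conf_remainder m (f k) 0 th) <= 1) /\
  sup_to_0 (fun k (x : R * R) => 0 <= x.1 <= T k)
           (fun k x => grad_norm (conf_remainder m (f k)) x.1 x.2).

Definition small_energy_assumption n (T : nat -> R)
    (f : nat -> R -> R -> vec n) : Prop :=
  sup_to_0 (fun k t => 0 <= t <= T k - 1) (fun k t => sff_energy (f k) t (t + 1)).

Definition mean_assumption n (T : nat -> R) (f : nat -> R -> R -> vec n) : Prop :=
  forall k (j : 'I_n), RInt (fun th => f k (T k - 1) th j) 0 (2 * PI) = 0.

(** [x^p] for [x >= 0], [p > 0]; [Rpower 0 p] is [1] in the standard library. *)
Definition rpow (x p : R) : R := if Req_EM_T x 0 then 0 else Rpower x p.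

(** For every [p > 0], [sum_{i=1}^{a_k} + sum_{i=b_k}^{m_k}] of
    [ ||A_k||_{L^2(Q_i)}^p ] tends to [0]. *)
Definition end_energy_vanishes n (L : R) (M : nat -> nat) (f : nat -> R -> R -> vec n)
    (a b : nat -> nat) : Prop :=
  forall p : R, 0 < p ->
    is_lim_seq (fun k =>
      \big[Rplus/0]_(1 <= i < (a k).+1) rpow (sqrt (sff_energy_Q L (f k) i)) p
      + \big[Rplus/0]_(b k <= i < (M k).+1) rpow (sqrt (sff_energy_Q L (f k) i)) p) 0.

(** The maximum over [a_k + l < i < b_k - l]; the quantities are nonnegative. *)
Definition neck_defect n (m : nat) (L : R) (f : nat -> R -> R -> vec n)
    (a b : nat -> nat) (l k : nat) : R :=
  \big[Rmax/0]_((a k + l).+1 <= i < b k - l)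
     (nu_Q m L (f k) i + Rabs (lambda_Q m L (f k) i - 1) + Rabs (1 - mu_Q L (f k) i)).

Definition neck_data n (m : nat) (L : R) (M : nat -> nat) (f : nat -> R -> R -> vec n)
    (a b : nat -> nat) : Prop :=
  (forall k, (0 < a k)%N /\ (a k < b k)%N /\ (b k < M k)%N) /\
  is_lim_seq (fun k => INR (b k) - INR (a k)) p_infty /\
  end_energy_vanishes L M f a b /\
  exists N : nat -> R,
    eventually (fun l => is_lim_seq (neck_defect m L f a b l) (N l)) /\
    is_lim_seq N 0.

Definition refined_neck_data n (m : nat) (L : R) (M : nat -> nat)
    (f : nat -> R -> R -> vec n) (a b a' b' : nat -> nat) : Prop :=
  (forall k, (a k < a' k)%N /\ (a' k < b' k)%N /\ (b' k < b k)%N) /\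
  end_energy_vanishes L M f a' b' /\
  exists C : R, forall k i : nat, (a' k < i)%N -> (i < b' k)%N ->
    let fk := f k in
    let u := conf_factor fk in
    let H := mean_curv fk in
    int_Q L i (fun t th =>
      exp (- 2 * u t th) * normsq (vsub (fk t th) (projG m L i fk t th)))
      <= C * willmore_Q L fk i /\
    int_Q L i (fun t th =>
      exp (2 * u t th) * normsq (vsub (H t th) (projF m L i H t th)))
      <= C * (willmore_Q L fk i) ^ 2.

(** ** Rescaled maps *)

Definition rescaled n (L : R) (f : R -> R -> vec n) (i : nat) (t th : R) : vec n :=
  let s := (INR i - 1) * L in
  fun j => exp (- conf_factor f s 0) *
           (f (s + t) th j - / (2 * PI) * RInt (fun z => f s z j) 0 (2 * PI)).

(** [epsilon = sqrt (W(f, Q_1) / (pi L))]. *)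
Definition eps_Q1 n (L : R) (f : R -> R -> vec n) : R :=
  sqrt (willmore_Q L f 1 / (PI * L)).

(** ** Linear algebra *)

(** Bases are numbered from [1] to [n]. *)
Definition orthonormal_basis n (e : nat -> vec n) : Prop :=
  forall i j : nat, (1 <= i <= n)%N -> (1 <= j <= n)%N ->
    dot (e i) (e j) = if i == j then 1 else 0.

(** [v] is in the span of [e_a, ..., e_b]. *)
Definition in_span n (e : nat -> vec n) (a b : nat) (v : vec n) : Prop :=
  exists c : nat -> R, forall j : 'I_n,
    v j = \big[Rplus/0]_(a <= i < b.+1) (c i * e i j).

(* Main.v *)
Require Import Defs.
From Stdlib Require Import Reals Lra Lia ZArith FunctionalExtensionality Classical.
From Coquelicot Require Import Coquelicot.
From mathcomp Require Import ssreflect ssrfun ssrbool eqtype ssrnat seq fintype bigop.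
Set Implicit Arguments.
Unset Strict Implicit.
Unset Printing Implicit Defensive.
Local Open Scope R_scope.

(** Both claims are instances of one statement about functions on a long cylinder. Let [X] be a
    component of [fhat / eps], with its mean put back, and [mu = - m] for 1); or a component of
    [Hhat / eps^2], and [mu = m] for 2). The projections [G_i] and [F_i] single out the part
    [exp (mu t) (c_1 cos (m th) + c_2 sin (m th))] of [X] seen from the midpoint of the cell [Q_i],
    and the refined estimates say that on every cell [X] differs from its own projection by
    something bounded in [L^2] with the weight [exp (-2 mu t)], with one constant for all cells.

    - The Laplacian of [X] converges in [C^infty_loc]. In 1) this is [lap f = e^(2u) H]
      ([conformal_lap]). In 2) it is the Willmore equation, whose right side is quadratic in [H]
      and the second fundamental form [A]. Here 1) is needed: [A] is linear in the second
      derivatives of [f], those of the large mode [exp (- m t)] are tangential ([mode_second]), and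
      so [A / eps] converges ([sff_limit]). The limit of the Laplacian is [exp (mu t)] times a
      trigonometric polynomial of frequencies [m] and [3m] ([bending_identity]), with
      coefficients in the span of [e_1] and [e_2] in case 2).

    - For such a right side there is an explicit solution [response] that has no mode
      [exp (mu t)] at the midpoint of [Q_1]; it is the limit. Indeed, after subtracting it and the
      mode from [X] there remains a sequence [D] with Laplacian tending to [0], growing at
      most like [exp (mu t)] from cell to cell, and without the mode [exp (mu t)]
      ([response_limit]). The shift of the midpoint between cells is what the resonant term
      [t exp (mu t)] of [response] accounts for.

    - Such a [D] tends to [0] ([liouville]). Its Fourier coefficients satisfy [a'' = l^2 a + o(1)],
      which splits into equations of first order whose only solution of growth [exp (mu t)]
      is the excluded mode ([mode_vanish]). Caccioppoli's and Sobolev's inequalities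
      ([caccioppoli], [sup_le_cyl]) bound all derivatives of [D] on compact sets; equi-Lipschitz
      functions with small Fourier coefficients are small ([small_modes]); and the same
      inequalities carry the smallness over to all derivatives.

    The limits are explicit, so the whole sequence converges and no compactness is used. Every
    [L >= 1] is admissible. *)

(** * Smooth functions on strips *)

Definition smooth_on (D : R -> Prop) (F : R -> R -> R) : Prop := forall k, Ck D k F.

Definition open_dom (D : R -> Prop) : Prop := forall t, D t -> locally t D.

Definition strip (a : R) : R -> Prop := fun t => Rabs t < a.

Definition all_t : R -> Prop := fun _ => True.

Definition ex_partial (d : bool) (F : R -> R -> R) (t th : R) : Prop :=
  if d then ex_derive (fun z => F t z) th else ex_derive (fun s => F s th) t.

Definition lap (F : R -> R -> R) (t th : R) : R :=
  partial false (partial false F) t th + partial true (partial true F) t th.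

(** [Ck] gives no access to the orders below [k]. Carrying them along makes the notion
    monotone in the order by construction, which inductions over products and inverses need. *)
Fixpoint Ck_upto (D : R -> Prop) (N : nat) (F : R -> R -> R) : Prop :=
  (forall t th, D t -> continuity_2d_pt F t th) /\
  match N with
  | O => True
  | S N' => (forall d t th, D t -> ex_partial d F t th) /\
            forall d, Ck_upto D N' (partial d F)
  end.

Lemma open_strip a : open_dom (strip a).
Proof.
move=> t Ht.
have Hd : 0 < a - Rabs t by rewrite /strip in Ht; lra.
exists (mkposreal _ Hd) => s Hs.
rewrite /ball /= /AbsRing_ball /= /abs /minus /plus /opp /= in Hs.
rewrite /strip.
have := Rabs_triang (s + - t) t.
have -> : s + - t + t = s by ring.
lra.
Qed.

Lemma open_all : open_dom all_t.
Proof. by move=> t _; exists (mkposreal _ Rlt_0_1). Qed.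

Lemma smooth_onP D F : smooth_on D F <-> forall N, Ck_upto D N F.
Proof.
split.
- move=> H N; elim: N F H => [|N IH] F H /=; split=> //.
  + exact: (H 0%N).
  + exact: (H 0%N).
  + split.
    * move=> d t th Dt; have [/(_ t th Dt) [H1 H2] _] := H 1%N.
      by case: d.
    * by move=> d; apply: IH => k; have [_ [H1 H2]] := H k.+1; case: d.
- move=> H k; elim: k F H => [|k IH] F H /=.
  + by have [] := H 0%N.
  + split; last first.
      by split; apply: IH => N; have [_ [_ /(_ _)]] := H N.+1; apply.
    move=> t th Dt; have [_ [H1 _]] := H 1%N.
    by split; [apply: (H1 false)|apply: (H1 true)].
Qed.

Lemma Ck_upto_mono D N F : Ck_upto D N.+1 F -> Ck_upto D N F.
Proof.
elim: N F => [|N IH] F /=; first by case.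
move=> [H0 [H1 H2]]; split=> //; split=> // d.
exact: IH (H2 d).
Qed.

Lemma smooth_on_cont D F t th : smooth_on D F -> D t -> continuity_2d_pt F t th.
Proof. by move=> H; apply: (H 0%N). Qed.

Lemma smooth_on_ex D F d t th : smooth_on D F -> D t -> ex_partial d F t th.
Proof. by move=> /smooth_onP /(_ 1%N) [_ [H _]]; apply: H. Qed.

Lemma smooth_on_partial D F d : smooth_on D F -> smooth_on D (partial d F).
Proof. by move=> /smooth_onP H; apply/smooth_onP => N; have [_ [_ ]] := H N.+1; apply. Qed.

Lemma smooth_on_sub (D D' : R -> Prop) F : (forall t, D' t -> D t) -> smooth_on D F -> smooth_on D' F.
Proof.
move=> HD /smooth_onP H; apply/smooth_onP => N; elim: N F H => [|N IH] F H /=.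
  by split=> // t th Dt; have [/(_ t th (HD _ Dt))] := H 0%N.
have [H0 [H1 _]] := H 1%N.
split; first by move=> t th /HD; exact: H0.
split; first by move=> d t th /HD; exact: H1.
by move=> d; apply: IH => k; have [_ [_ ]] := H k.+1; apply.
Qed.

Lemma partial_ext_loc D F G d t th : open_dom D -> D t ->
  (forall t th, D t -> F t th = G t th) -> partial d F t th = partial d G t th.
Proof.
move=> oD Dt E; case: d => /=.
  by apply: Derive_ext => z; apply: E.
by apply: Derive_ext_loc; apply: filter_imp (oD t Dt) => s Ds; apply: E.
Qed.

Lemma partial_ext F G d t th :
  (forall t th, F t th = G t th) -> partial d F t th = partial d G t th.
Proof. by move=> E; apply: (@partial_ext_loc all_t) => //; exact: open_all. Qed.

Lemma ex_partial_ext_loc D F G d t th : open_dom D -> D t ->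
  (forall t th, D t -> F t th = G t th) -> ex_partial d F t th -> ex_partial d G t th.
Proof.
move=> oD Dt E; case: d => /=.
  by apply: ex_derive_ext => z; apply: E.
by apply: ex_derive_ext_loc; apply: filter_imp (oD t Dt) => s Ds; apply: E.
Qed.

Lemma locally_2d_strip (D : R -> Prop) t th : open_dom D -> D t ->
  locally_2d (fun u v => D u) t th.
Proof.
move=> oD Dt; have [d Hd] := oD t Dt.
by exists d => u v Hu _; apply: Hd.
Qed.

Lemma Ck_upto_ext D N F G : open_dom D -> (forall t th, D t -> F t th = G t th) -> Ck_upto D N F -> Ck_upto D N G.
Proof.
move=> oD; elim: N F G => [|N IH] F G E /= [H0 H1].
all: have HC : forall t th, D t -> continuity_2d_pt G t th
  by move=> t th Dt; apply: continuity_2d_pt_ext_loc (H0 _ th Dt);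
  have [d Hd] := locally_2d_strip th oD Dt;
  exists d => u v Hu Hv; apply: E; apply: (Hd u v Hu Hv).
all: split=> //.
case: H1 => H1 H2; split.
  by move=> d t th Dt; apply: ex_partial_ext_loc oD Dt E (H1 d t th Dt).
by move=> d; apply: IH (H2 d) => t th Dt; apply: partial_ext_loc oD Dt E.
Qed.

Lemma smooth_on_ext D F G : open_dom D -> (forall t th, D t -> F t th = G t th) -> smooth_on D F -> smooth_on D G.
Proof. by move=> oD E /smooth_onP H; apply/smooth_onP => N; apply: Ck_upto_ext oD E _. Qed.

Lemma fun2_ext (F G : R -> R -> R) : (forall t th, F t th = G t th) -> F = G.
Proof.
by move=> E; apply: functional_extensionality => t; apply: functional_extensionality => th.
Qed.

Lemma partial_plus F G d t th : ex_partial d F t th -> ex_partial d G t th ->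
  partial d (fun s z => F s z + G s z) t th = partial d F t th + partial d G t th.
Proof. by case: d => /= *; apply: Derive_plus. Qed.

Lemma partial_mult F G d t th : ex_partial d F t th -> ex_partial d G t th ->
  partial d (fun s z => F s z * G s z) t th
  = partial d F t th * G t th + F t th * partial d G t th.
Proof. by case: d => /= HF HG; rewrite Derive_mult. Qed.

Lemma partial_inv F d t th : ex_partial d F t th -> F t th <> 0 ->
  partial d (fun s z => / F s z) t th = - partial d F t th * (/ F t th * / F t th).
Proof. by case: d => /= HF HG; rewrite Derive_inv //; [move: (Derive _ _) => x|move: (Derive _ _) => x]; move: (F t th) HG => y Hy; field. Qed.

Lemma partial_const c d t th : partial d (fun _ _ => c) t th = 0.
Proof. by case: d => /=; apply: Derive_const. Qed.

Lemma partial_scal c F d t th :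
  partial d (fun s z => c * F s z) t th = c * partial d F t th.
Proof. by case: d => /=; apply: Derive_scal. Qed.

Lemma ex_partial_plus F G d t th : ex_partial d F t th -> ex_partial d G t th ->
  ex_partial d (fun s z => F s z + G s z) t th.
Proof. by case: d => /= HF HG; apply: (ex_derive_plus (V := R_NormedModule)). Qed.

Lemma ex_partial_mult F G d t th : ex_partial d F t th -> ex_partial d G t th ->
  ex_partial d (fun s z => F s z * G s z) t th.
Proof. by case: d => /= HF HG; apply: ex_derive_mult. Qed.

Lemma ex_partial_inv F d t th : ex_partial d F t th -> F t th <> 0 ->
  ex_partial d (fun s z => / F s z) t th.
Proof. by case: d => /= HF HG; apply: ex_derive_inv. Qed.

Lemma ex_partial_const c d t th : ex_partial d (fun _ _ => c) t th.
Proof. by case: d => /=; apply: ex_derive_const. Qed.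

Lemma smooth_on_const D c : smooth_on D (fun _ _ => c).
Proof.
apply/smooth_onP => N; elim: N c => [|N IH] c /=; split=> //.
- by move=> *; apply: continuity_2d_pt_const.
- by move=> *; apply: continuity_2d_pt_const.
split; first by move=> *; apply: ex_partial_const.
move=> d; have -> : partial d (fun _ _ => c) = (fun _ _ => 0); last exact: IH.
by apply: fun2_ext => t th; rewrite partial_const.
Qed.

Lemma Ck_upto_plus D N F G : open_dom D -> Ck_upto D N F -> Ck_upto D N G -> Ck_upto D N (fun t th => F t th + G t th).
Proof.
move=> oD; elim: N F G => [|N IH] F G /= [F0 F1] [G0 G1].
all: split; first by move=> t th Dt; apply: continuity_2d_pt_plus; [exact: F0|exact: G0].
  by [].
case: F1 => F1 F2; case: G1 => G1 G2; split.
  by move=> d t th Dt; apply: ex_partial_plus; [exact: F1|exact: G1].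
move=> d; apply: Ck_upto_ext (IH _ _ (F2 d) (G2 d)) => // t th Dt.
by rewrite partial_plus //; [exact: F1|exact: G1].
Qed.

Lemma Ck_upto_mult D N F G : open_dom D -> Ck_upto D N F -> Ck_upto D N G -> Ck_upto D N (fun t th => F t th * G t th).
Proof.
move=> oD; elim: N F G => [|N IH] F G HF HG.
  by split=> // t th Dt; apply: continuity_2d_pt_mult; [exact: HF.1|exact: HG.1].
move: (HF) (HG) => /= [F0 [F1 F2]] [G0 [G1 G2]].
split; first by move=> t th Dt; apply: continuity_2d_pt_mult; [exact: F0|exact: G0].
split; first by move=> d t th Dt; apply: ex_partial_mult; [exact: F1|exact: G1].
have [HF' HG'] := (Ck_upto_mono HF, Ck_upto_mono HG).
move=> d; apply: Ck_upto_ext (Ck_upto_plus oD (IH _ _ (F2 d) HG') (IH _ _ HF' (G2 d))) => // t th Dt.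
by rewrite partial_mult //; [exact: F1|exact: G1].
Qed.

Lemma smooth_on_plus D F G : open_dom D -> smooth_on D F -> smooth_on D G -> smooth_on D (fun t th => F t th + G t th).
Proof. by move=> oD /smooth_onP HF /smooth_onP HG; apply/smooth_onP => N; exact: Ck_upto_plus. Qed.

Lemma smooth_on_mult D F G : open_dom D -> smooth_on D F -> smooth_on D G -> smooth_on D (fun t th => F t th * G t th).
Proof. by move=> oD /smooth_onP HF /smooth_onP HG; apply/smooth_onP => N; exact: Ck_upto_mult. Qed.

Lemma smooth_on_scal D c F : open_dom D -> smooth_on D F -> smooth_on D (fun t th => c * F t th).
Proof. by move=> oD; apply: smooth_on_mult => //; exact: smooth_on_const. Qed.

Lemma smooth_on_inv D F : open_dom D -> smooth_on D F -> (forall t th, D t -> F t th <> 0) ->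
  smooth_on D (fun t th => / F t th).
Proof.
move=> oD HF HF0; apply/smooth_onP; elim=> [|N IH].
  by split=> // t th Dt; apply: continuity_2d_pt_inv (HF0 _ _ Dt); exact: smooth_on_cont HF Dt.
split; first by move=> t th Dt; apply: continuity_2d_pt_inv (HF0 _ _ Dt); exact: smooth_on_cont HF Dt.
split; first by move=> d t th Dt; apply: ex_partial_inv (HF0 _ _ Dt); exact: smooth_on_ex HF Dt.
move=> d; have /smooth_onP H1 : smooth_on D (fun t th => -1 * partial d F t th)
  by apply: smooth_on_scal => //; exact: smooth_on_partial.
apply: Ck_upto_ext (Ck_upto_mult oD (H1 N) (Ck_upto_mult oD IH IH)) => // t th Dt.
by rewrite (partial_inv (smooth_on_ex d th HF Dt) (HF0 _ _ Dt)); ring.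
Qed.

Lemma smooth_on_comm D F t th : open_dom D -> smooth_on D F -> D t ->
  partial false (partial true F) t th = partial true (partial false F) t th.
Proof.
move=> oD HF Dt; apply: Schwarz.
- have [d Hd] := locally_2d_strip th oD Dt.
  exists d => u v Hu Hv; have Du := Hd u v Hu Hv.
  split; first exact: (smooth_on_ex false v HF Du).
  split; first exact: (smooth_on_ex true v HF Du).
  split; first exact: (smooth_on_ex false v (smooth_on_partial true HF) Du).
  exact: (smooth_on_ex true v (smooth_on_partial false HF) Du).
- exact: (smooth_on_cont th (smooth_on_partial false (smooth_on_partial true HF)) Dt).
- exact: (smooth_on_cont th (smooth_on_partial true (smooth_on_partial false HF)) Dt).
Qed.

Lemma smooth_on_comm2 D F d e t th : open_dom D -> smooth_on D F -> D t ->
  partial d (partial e F) t th = partial e (partial d F) t th.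
Proof.
by move=> oD HF Dt; case: d; case: e => //; [symmetry|]; apply: smooth_on_comm HF Dt.
Qed.

Lemma smooth_on_t D (g : R -> R) (c : R) : (forall t, is_derive g t (c * g t)) ->
  open_dom D -> smooth_on D (fun t _ => g t).
Proof.
move=> Hg oD.
have cont t th : continuity_2d_pt (fun t _ => g t) t th.
  apply: (@continuity_1d_2d_pt_comp g (fun t _ => t)); last exact: continuity_2d_pt_id1.
  apply/continuity_pt_filterlim; apply: ex_derive_continuous; eexists; exact: Hg.
apply/smooth_onP; elim=> [|N IH]; split=> //; split.
  move=> [] t th _ /=; first exact: ex_derive_const.
  by eexists; exact: Hg.
case.
  apply: Ck_upto_ext (proj1 (smooth_onP _ _) (smooth_on_const D 0) N) => // t th _ /=.
  by rewrite Derive_const.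
apply: Ck_upto_ext (Ck_upto_mult oD (proj1 (smooth_onP _ _) (smooth_on_const D c) N) IH) => // t th _ /=.
by rewrite (is_derive_unique _ _ _ (Hg t)).
Qed.

Lemma smooth_on_id D : open_dom D -> smooth_on D (fun t _ => t).
Proof.
move=> oD; apply/smooth_onP; case=> [|N]; split=> //; try by move=> *; exact: continuity_2d_pt_id1.
split; first by case=> t th _ /=; [exact: ex_derive_const|exact: ex_derive_id].
case.
  apply: Ck_upto_ext (proj1 (smooth_onP _ _) (smooth_on_const D 0) N) => // t th _ /=.
  by rewrite Derive_const.
apply: Ck_upto_ext (proj1 (smooth_onP _ _) (smooth_on_const D 1) N) => // t th _ /=.
by rewrite Derive_id.
Qed.

Lemma smooth_on_th D (g h : R -> R) (c : R) :
  (forall t, is_derive g t (h t)) -> (forall t, is_derive h t (c * g t)) ->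
  open_dom D -> smooth_on D (fun _ th => g th).
Proof.
move=> Hg Hh oD.
have cont f t th : ex_derive f th -> continuity_2d_pt (fun _ th => f th) t th.
  move=> Hf; apply: (@continuity_1d_2d_pt_comp f (fun _ th => th)); last exact: continuity_2d_pt_id2.
  by apply/continuity_pt_filterlim; apply: ex_derive_continuous.
have Eg t : ex_derive g t by eexists; exact: Hg.
have Eh t : ex_derive h t by eexists; exact: Hh.
suff H N : Ck_upto D N (fun _ th => g th) /\ Ck_upto D N (fun _ th => h th).
  by apply/smooth_onP => N; have [] := H N.
elim: N => [|N [IHg IHh]]; first by split; split=> // *; exact: cont.
have H0 f : Ck_upto D N (partial false (fun _ th => f th)).
  apply: Ck_upto_ext (proj1 (smooth_onP _ _) (smooth_on_const D 0) N) => // t th _ /=.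
  by rewrite Derive_const.
split; (split; first by move=> *; apply: cont); split.
- by case=> t th _ /=; [exact: Eg|exact: ex_derive_const].
- case=> //; apply: Ck_upto_ext IHh => // t th _ /=.
  by rewrite (is_derive_unique _ _ _ (Hg th)).
- by case=> t th _ /=; [exact: Eh|exact: ex_derive_const].
- case=> //; apply: Ck_upto_ext (Ck_upto_mult oD (proj1 (smooth_onP _ _) (smooth_on_const D c) N) IHg) => // t th _ /=.
  by rewrite (is_derive_unique _ _ _ (Hh th)).
Qed.

Lemma smooth_on_exp D c : open_dom D -> smooth_on D (fun t _ => exp (c * t)).
Proof. by move=> oD; apply: (@smooth_on_t _ (fun t => exp (c * t)) c) => // t; auto_derive => //; ring. Qed.

Lemma smooth_on_cos D c : open_dom D -> smooth_on D (fun _ th => cos (c * th)).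
Proof.
move=> oD; apply: (@smooth_on_th _ (fun th => cos (c * th)) (fun th => - c * sin (c * th)) (- c ^ 2)) => //.
all: by move=> t; auto_derive => //; ring.
Qed.

Lemma smooth_on_sin D c : open_dom D -> smooth_on D (fun _ th => sin (c * th)).
Proof.
move=> oD; apply: (@smooth_on_th _ (fun th => sin (c * th)) (fun th => c * cos (c * th)) (- c ^ 2)) => //.
all: by move=> t; auto_derive => //; ring.
Qed.

(** * Smooth convergence *)

Definition funseq : Type := nat -> R -> R -> R.

Definition partial_seq (d : bool) (F : funseq) : funseq := fun k => partial d (F k).

Definition ev_smooth (F : funseq) : Prop :=
  forall a, 0 < a -> eventually (fun k => smooth_on (strip a) (F k)).

Definition unif_conv (F : funseq) (G : R -> R -> R) : Prop :=
  forall a, 0 < a -> forall eps, 0 < eps ->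
  eventually (fun k => forall t th, Rabs t <= a -> Rabs (F k t th - G t th) < eps).

Definition bounded (G : R -> R -> R) : Prop :=
  forall a, 0 < a -> exists B, 0 < B /\ forall t th, Rabs t <= a -> Rabs (G t th) <= B.

(** The bound on the limit is part of the notion because a product of uniformly convergent
    sequences converges uniformly only if the limits are bounded. *)
Fixpoint converges_upto (N : nat) (F : funseq) (G : R -> R -> R) : Prop :=
  bounded G /\ unif_conv F G /\
  match N with
  | O => True
  | S N' => forall d, converges_upto N' (partial_seq d F) (partial d G)
  end.

(** Smoothness is required of the sequence for all orders at once, from an index on that
    depends on the strip only; the convergence of each derivative has its own index. *)
Definition converges (F : funseq) (G : R -> R -> R) : Prop :=
  ev_smooth F /\ smooth_on all_t G /\ forall N, converges_upto N F G.

Definition ev_eq (F F' : funseq) : Prop :=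
  forall a, 0 < a -> eventually (fun k => forall t th, strip a t -> F k t th = F' k t th).

Lemma ev_eq_partial_seq d F F' : ev_eq F F' -> ev_eq (partial_seq d F) (partial_seq d F').
Proof.
move=> E a Ha; apply: filter_imp (E a Ha) => k Hk t th Ht.
exact: (partial_ext_loc d th (@open_strip a) Ht Hk).
Qed.

Lemma ev_eq_refl F F' : (forall k t th, F k t th = F' k t th) -> ev_eq F F'.
Proof. by move=> E a Ha; exists 0%N => *; apply: E. Qed.

Lemma strip_lt a t : Rabs t <= a -> strip (a + 1) t.
Proof. by rewrite /strip; lra. Qed.

Lemma unif_conv_ext F F' G : ev_eq F F' -> unif_conv F G -> unif_conv F' G.
Proof.
move=> E H a Ha eps Heps.
have Ha1 : 0 < a + 1 by lra.
apply: filter_imp (filter_and _ _ (E _ Ha1) (H a Ha eps Heps)) => k [E1 H1] t th Ht.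
by rewrite -E1; [apply: H1|apply: strip_lt].
Qed.

Lemma converges_upto_ext N F F' G : ev_eq F F' -> converges_upto N F G -> converges_upto N F' G.
Proof.
elim: N F F' G => [|N IH] F F' G E /= [H0 [H1 H2]].
  by split=> //; split=> //; apply: unif_conv_ext E H1.
split=> //; split; first exact: unif_conv_ext E H1.
by move=> d; apply: IH (H2 d); apply: ev_eq_partial_seq.
Qed.

Lemma ev_smooth_ext F F' : ev_eq F F' -> ev_smooth F -> ev_smooth F'.
Proof.
move=> E H a Ha; apply: filter_imp (filter_and _ _ (E a Ha) (H a Ha)) => k [E1 H1].
exact: smooth_on_ext (@open_strip a) E1 H1.
Qed.

Lemma converges_ext F F' G G' : ev_eq F F' -> (forall t th, G t th = G' t th) ->
  converges F G -> converges F' G'.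
Proof.
move=> E /fun2_ext <- [H0 [H1 H2]]; split; first exact: ev_smooth_ext E H0.
by split=> // N; apply: converges_upto_ext E (H2 N).
Qed.

Lemma converges_upto_mono N F G : converges_upto N.+1 F G -> converges_upto N F G.
Proof.
elim: N F G => [|N IH] F G [H0 [H1 H2]]; split=> //; split=> // d.
exact: IH (H2 d).
Qed.

Lemma bounded_plus G G' : bounded G -> bounded G' -> bounded (fun t th => G t th + G' t th).
Proof.
move=> H H' a Ha; have [B [HB0 HB]] := H a Ha; have [B' [HB0' HB']] := H' a Ha.
exists (B + B'); split; first lra.
move=> t th Ht; have := Rabs_triang (G t th) (G' t th).
by have := HB t th Ht; have := HB' t th Ht; lra.
Qed.

Lemma bounded_mult G G' : bounded G -> bounded G' -> bounded (fun t th => G t th * G' t th).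
Proof.
move=> H H' a Ha; have [B [HB0 HB]] := H a Ha; have [B' [HB0' HB']] := H' a Ha.
exists (B * B'); split; first by apply: Rmult_lt_0_compat.
move=> t th Ht; rewrite Rabs_mult; apply: Rmult_le_compat; try exact: Rabs_pos.
- exact: HB.
- exact: HB'.
Qed.

Lemma unif_conv_plus F F' G G' : unif_conv F G -> unif_conv F' G' ->
  unif_conv (fun k t th => F k t th + F' k t th) (fun t th => G t th + G' t th).
Proof.
move=> H H' a Ha eps Heps; have He : 0 < eps / 2 by lra.
apply: filter_imp (filter_and _ _ (H a Ha _ He) (H' a Ha _ He)) => k [H1 H2] t th Ht.
have -> : F k t th + F' k t th - (G t th + G' t th)
        = (F k t th - G t th) + (F' k t th - G' t th) by ring.
have := Rabs_triang (F k t th - G t th) (F' k t th - G' t th).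
by have := H1 t th Ht; have := H2 t th Ht; lra.
Qed.

Lemma unif_conv_mult F F' G G' : bounded G -> bounded G' -> unif_conv F G -> unif_conv F' G' ->
  unif_conv (fun k t th => F k t th * F' k t th) (fun t th => G t th * G' t th).
Proof.
move=> HB HB' H H' a Ha eps Heps.
have [B [B0 {}HB]] := HB a Ha; have [B' [B0' {}HB']] := HB' a Ha.
have Hd1 : 0 < eps / (2 * (B' + 1)) by apply: Rdiv_lt_0_compat; lra.
have Hd2 : 0 < Rmin 1 (eps / (2 * B)).
  by apply: Rmin_glb_lt; [lra|apply: Rdiv_lt_0_compat; lra].
apply: filter_imp (filter_and _ _ (H a Ha _ Hd1) (H' a Ha _ Hd2)) => k [H1 H2] t th Ht.
have {}H1 := H1 t th Ht; have {}H2 := H2 t th Ht.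
have {}HB := HB t th Ht; have {}HB' := HB' t th Ht.
have -> : F k t th * F' k t th - G t th * G' t th
        = (F k t th - G t th) * F' k t th + G t th * (F' k t th - G' t th) by ring.
apply: Rle_lt_trans (Rabs_triang _ _) _; rewrite !Rabs_mult.
have HF' : Rabs (F' k t th) <= B' + 1.
  have := Rabs_triang (F' k t th - G' t th) (G' t th).
  have -> : F' k t th - G' t th + G' t th = F' k t th by ring.
  by have := Rmin_l 1 (eps / (2 * B)); lra.
have h1 : Rabs (F k t th - G t th) * Rabs (F' k t th) < eps / 2.
  apply: (Rle_lt_trans _ (Rabs (F k t th - G t th) * (B' + 1))).
    by apply: Rmult_le_compat_l => //; apply: Rabs_pos.
  apply: (Rlt_le_trans _ (eps / (2 * (B' + 1)) * (B' + 1))).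
    by apply: Rmult_lt_compat_r => //; lra.
  by right; field; lra.
have h2 : Rabs (G t th) * Rabs (F' k t th - G' t th) <= eps / 2.
  apply: (Rle_trans _ (B * (eps / (2 * B)))); last by right; field; lra.
  apply: Rmult_le_compat; try exact: Rabs_pos; first exact: HB.
  by have := Rmin_r 1 (eps / (2 * B)); lra.
lra.
Qed.

Lemma converges_upto_plus N F F' G G' : ev_smooth F -> ev_smooth F' -> smooth_on all_t G -> smooth_on all_t G' ->
  converges_upto N F G -> converges_upto N F' G' ->
  converges_upto N (fun k t th => F k t th + F' k t th) (fun t th => G t th + G' t th).
Proof.
elim: N F F' G G' => [|N IH] F F' G G' EF EF' SG SG' [H0 [H1 H2]] [H0' [H1' H2']].
all: split; first exact: bounded_plus.
all: split; first exact: unif_conv_plus.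
  by [].
move=> d.
have -> : partial d (fun t th => G t th + G' t th)
        = (fun t th => partial d G t th + partial d G' t th).
  apply: fun2_ext => t th; apply: partial_plus; exact: (@smooth_on_ex all_t).
apply: converges_upto_ext (IH _ _ _ _ _ _ _ _ (H2 d) (H2' d)).
- move=> a Ha; apply: filter_imp (filter_and _ _ (EF a Ha) (EF' a Ha)) => k [S S'] t th Ht.
  by rewrite /partial_seq partial_plus //; apply: (@smooth_on_ex (strip a)).
- by move=> a Ha; apply: filter_imp (EF a Ha) => k; apply: smooth_on_partial.
- by move=> a Ha; apply: filter_imp (EF' a Ha) => k; apply: smooth_on_partial.
- exact: smooth_on_partial.
- exact: smooth_on_partial.
Qed.

Lemma ev_smooth_partial_seq d F : ev_smooth F -> ev_smooth (partial_seq d F).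
Proof. by move=> E a Ha; apply: filter_imp (E a Ha) => k; apply: smooth_on_partial. Qed.

Lemma ev_smooth_plus F F' : ev_smooth F -> ev_smooth F' -> ev_smooth (fun k t th => F k t th + F' k t th).
Proof.
move=> E E' a Ha; apply: filter_imp (filter_and _ _ (E a Ha) (E' a Ha)) => k [S S'].
exact: smooth_on_plus (@open_strip a) S S'.
Qed.

Lemma ev_smooth_mult F F' : ev_smooth F -> ev_smooth F' -> ev_smooth (fun k t th => F k t th * F' k t th).
Proof.
move=> E E' a Ha; apply: filter_imp (filter_and _ _ (E a Ha) (E' a Ha)) => k [S S'].
exact: smooth_on_mult (@open_strip a) S S'.
Qed.

Lemma ev_smooth_const (c : nat -> R) : ev_smooth (fun k _ _ => c k).
Proof. by move=> a Ha; exists 0%N => k _; apply: smooth_on_const. Qed.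

Lemma ev_smooth_smooth_on G : smooth_on all_t G -> ev_smooth (fun _ => G).
Proof. by move=> H a Ha; exists 0%N => k _; apply: smooth_on_sub H. Qed.

Lemma converges_partial d F G : converges F G -> converges (partial_seq d F) (partial d G).
Proof.
move=> [H0 [H1 H2]]; split; first exact: ev_smooth_partial_seq.
by split; [exact: smooth_on_partial|move=> N; have [_ [_]] := H2 N.+1; apply].
Qed.

Lemma converges_plus F F' G G' : converges F G -> converges F' G' ->
  converges (fun k t th => F k t th + F' k t th) (fun t th => G t th + G' t th).
Proof.
move=> [H0 [H1 H2]] [H0' [H1' H2']]; split; first exact: ev_smooth_plus.
split; first by apply: smooth_on_plus => //; exact: open_all.
by move=> N; apply: converges_upto_plus.
Qed.

Lemma converges_upto_mult N F F' G G' : ev_smooth F -> ev_smooth F' -> smooth_on all_t G -> smooth_on all_t G' ->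
  converges_upto N F G -> converges_upto N F' G' ->
  converges_upto N (fun k t th => F k t th * F' k t th) (fun t th => G t th * G' t th).
Proof.
elim: N F F' G G' => [|N IH] F F' G G' EF EF' SG SG' C C'.
all: move: (C) (C') => [H0 [H1 H2]] [H0' [H1' H2']].
all: split; first exact: bounded_mult.
all: split; first exact: unif_conv_mult.
  by [].
move=> d.
have -> : partial d (fun t th => G t th * G' t th)
        = (fun t th => partial d G t th * G' t th + G t th * partial d G' t th).
  apply: fun2_ext => t th; apply: partial_mult; exact: (@smooth_on_ex all_t).
have [EFd EFd'] := (ev_smooth_partial_seq d EF, ev_smooth_partial_seq d EF').
have [SGd SGd'] := (smooth_on_partial d SG, smooth_on_partial d SG').
have X1 := IH _ _ _ _ EFd EF' SGd SG' (H2 d) (converges_upto_mono C').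
have X2 := IH _ _ _ _ EF EFd' SG SGd' (converges_upto_mono C) (H2' d).
apply: converges_upto_ext (converges_upto_plus (ev_smooth_mult EFd EF') (ev_smooth_mult EF EFd') _ _ X1 X2).
- move=> a Ha; apply: filter_imp (filter_and _ _ (EF a Ha) (EF' a Ha)) => k [S S'] t th Ht.
  by rewrite /partial_seq partial_mult //; apply: (@smooth_on_ex (strip a)).
- by apply: smooth_on_mult => //; exact: open_all.
- by apply: smooth_on_mult => //; exact: open_all.
Qed.

Lemma converges_mult F F' G G' : converges F G -> converges F' G' ->
  converges (fun k t th => F k t th * F' k t th) (fun t th => G t th * G' t th).
Proof.
move=> [H0 [H1 H2]] [H0' [H1' H2']]; split; first exact: ev_smooth_mult.
split; first by apply: smooth_on_mult => //; exact: open_all.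
by move=> N; apply: converges_upto_mult.
Qed.

Definition away0 (G : R -> R -> R) : Prop :=
  forall a, 0 < a -> exists c, 0 < c /\ forall t th, Rabs t <= a -> c <= Rabs (G t th).

Lemma unif_conv_away0 F G : away0 G -> unif_conv F G -> forall a, 0 < a ->
  exists c, 0 < c /\ eventually (fun k => forall t th, Rabs t <= a -> c <= Rabs (F k t th)).
Proof.
move=> A H a Ha; have [c [c0 Hc]] := A a Ha.
exists (c / 2); split; first lra.
have c2 : 0 < c / 2 by lra.
apply: filter_imp (H a Ha _ c2) => k Hk t th Ht.
have := Hk t th Ht; have := Hc t th Ht.
have := Rabs_triang_inv (G t th) (G t th - F k t th).
rewrite -(Rabs_Ropp (F k t th - _)).
have -> : G t th - (G t th - F k t th) = F k t th by ring.
have -> : - (F k t th - G t th) = G t th - F k t th by ring.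
lra.
Qed.

Lemma away0_neq G t th : away0 G -> G t th <> 0.
Proof.
move=> A E; have Ha : 0 < Rabs t + 1 by have := Rabs_pos t; lra.
have [c [c0 /(_ t th)]] := A _ Ha.
by rewrite E Rabs_R0; lra.
Qed.

Lemma ev_smooth_inv F G : away0 G -> unif_conv F G -> ev_smooth F -> ev_smooth (fun k t th => / F k t th).
Proof.
move=> A U E a Ha; have [c [c0 Hc]] := unif_conv_away0 A U Ha.
apply: filter_imp (filter_and _ _ (E a Ha) Hc) => k [S H].
apply: smooth_on_inv => //; first exact: open_strip.
move=> t th Ht E0; have := H t th (Rlt_le _ _ Ht).
by rewrite E0 Rabs_R0; lra.
Qed.

Lemma bounded_inv G : away0 G -> bounded (fun t th => / G t th).
Proof.
move=> A a Ha; have [c [c0 Hc]] := A a Ha.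
exists (/ c); split; first exact: Rinv_0_lt_compat.
move=> t th Ht; rewrite Rabs_inv.
by apply: Rinv_le_contravar => //; apply: Hc.
Qed.

Lemma unif_conv_inv F G : away0 G -> unif_conv F G -> unif_conv (fun k t th => / F k t th) (fun t th => / G t th).
Proof.
move=> A U a Ha eps Heps.
have [c [c0 Hc]] := A a Ha; have [c' [c0' Hc']] := unif_conv_away0 A U Ha.
have He : 0 < eps * (c * c') by apply: Rmult_lt_0_compat => //; apply: Rmult_lt_0_compat.
apply: filter_imp (filter_and _ _ (U a Ha _ He) Hc') => k [H1 H2] t th Ht.
have {}H1 := H1 t th Ht; have {}H2 := H2 t th Ht; have {}Hc := Hc t th Ht.
have n1 : F k t th <> 0 by move=> E; rewrite E Rabs_R0 in H2; lra.
have n2 : G t th <> 0 by move=> E; rewrite E Rabs_R0 in Hc; lra.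
have -> : / F k t th - / G t th = - (F k t th - G t th) / (G t th * F k t th) by field.
rewrite Rabs_div; last by apply: Rmult_integral_contrapositive.
rewrite Rabs_Ropp Rabs_mult.
apply/Rlt_div_l; first by apply: Rmult_lt_0_compat; apply: Rabs_pos_lt.
apply: Rlt_le_trans H1 _; apply: Rmult_le_compat_l; first lra.
by apply: Rmult_le_compat; lra.
Qed.

Lemma converges_const c : converges (fun _ _ _ => c) (fun _ _ => c).
Proof.
split; first exact: ev_smooth_const.
split; first exact: smooth_on_const.
move=> N; elim: N c => [|N IH] c /=; split; try (move=> a Ha; exists (Rabs c + 1); split;
  [by have := Rabs_pos c; lra|by move=> *; lra]).
- split=> // a Ha eps He; exists 0%N => k _ t th _.
  by rewrite Rminus_eq_0 Rabs_R0.
- split; first by move=> a Ha eps He; exists 0%N => k _ t th _; rewrite Rminus_eq_0 Rabs_R0.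
  move=> d; apply: converges_upto_ext (ev_eq_refl (fun k t th => esym (partial_const c d t th))) _.
  have -> : partial d (fun _ _ => c) = (fun _ _ => 0); last exact: IH.
  by apply: fun2_ext => t th; rewrite partial_const.
Qed.

Lemma converges_scal c F G : converges F G -> converges (fun k t th => c * F k t th) (fun t th => c * G t th).
Proof. exact: converges_mult (converges_const c). Qed.

Lemma converges_inv F G : away0 G -> converges F G -> converges (fun k t th => / F k t th) (fun t th => / G t th).
Proof.
move=> A [E [S C]].
have [_ [U _]] := C 0%N.
have EI := ev_smooth_inv A U E.
have SI : smooth_on all_t (fun t th => / G t th).
  by apply: smooth_on_inv => //; [exact: open_all|move=> *; exact: away0_neq].
split=> //; split=> //.
elim=> [|N IH]; (split; first exact: bounded_inv); (split; first exact: unif_conv_inv); first by [].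
move=> d.
have -> : partial d (fun t th => / G t th)
        = (fun t th => (-1 * partial d G t th) * (/ G t th * / G t th)).
  apply: fun2_ext => t th; rewrite partial_inv; last exact: away0_neq.
    ring.
  exact: (@smooth_on_ex all_t).
have [E1 [S1 C1]] := converges_scal (-1) (converges_partial d (conj E (conj S C))).
apply: converges_upto_ext (converges_upto_mult E1 (ev_smooth_mult EI EI) S1 (smooth_on_mult open_all SI SI) (C1 N)
  (converges_upto_mult EI EI SI SI IH IH)).
move=> a Ha; have [c [c0 Hc]] := unif_conv_away0 A U Ha.
apply: filter_imp (filter_and _ _ (E a Ha) Hc) => k [S' H] t th Ht.
rewrite /partial_seq partial_inv; last first.
  move=> E0; have := H t th (Rlt_le _ _ Ht).
  by rewrite E0 Rabs_R0; lra.
  exact: (@smooth_on_ex (strip a)).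
ring.
Qed.

Lemma converges_minus F F' G G' : converges F G -> converges F' G' ->
  converges (fun k t th => F k t th - F' k t th) (fun t th => G t th - G' t th).
Proof.
move=> H H'; apply: converges_ext (converges_plus H (converges_scal (-1) H')).
- by apply: ev_eq_refl => k t th; ring.
- by move=> t th; ring.
Qed.

(** The limits that occur are functions all of whose derivatives are bounded on strips. That is
    convergence of the constant sequence, so the closure rules for convergent sequences apply. *)
Definition tame (G : R -> R -> R) : Prop := converges (fun _ => G) G.

Lemma tame_converges (F : funseq) G : tame G -> ev_smooth F -> (forall N, converges_upto N F G) -> converges F G.
Proof. by move=> [_ [S _]] E C. Qed.

Lemma unif_conv_refl G : unif_conv (fun _ => G) G.
Proof. by move=> a Ha eps He; exists 0%N => k _ t th _; rewrite Rminus_eq_0 Rabs_R0. Qed.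

Lemma tame_id : tame (fun t _ => t).
Proof.
have S : smooth_on all_t (fun t _ => t) by apply: smooth_on_id; exact: open_all.
split; first exact: ev_smooth_smooth_on.
split=> // N.
have B : bounded (fun t _ => t) by move=> a Ha; exists a.
case: N => [|N]; (split; first by []); (split; first exact: unif_conv_refl); first by [].
case.
- have [_ [_ /(_ N)]] := converges_const 0.
  have -> : partial true (fun t _ => t) = (fun _ _ => 0).
    by apply: fun2_ext => t th /=; rewrite Derive_const.
  apply: converges_upto_ext; apply: ev_eq_refl => k t th /=; by rewrite /partial_seq /= Derive_const.
- have [_ [_ /(_ N)]] := converges_const 1.
  have -> : partial false (fun t _ => t) = (fun _ _ => 1).
    by apply: fun2_ext => t th /=; rewrite Derive_id.
  apply: converges_upto_ext; apply: ev_eq_refl => k t th /=; by rewrite /partial_seq /= Derive_id.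
Qed.

Lemma tame_fam (I : Type) (G : I -> R -> R -> R) (c : bool -> I -> R) (s : bool -> I -> I) :
  (forall i, smooth_on all_t (G i)) -> (forall i, bounded (G i)) ->
  (forall d i t th, partial d (G i) t th = c d i * G (s d i) t th) ->
  forall i, tame (G i).
Proof.
move=> S B E i; split; first exact: ev_smooth_smooth_on.
split=> // N; elim: N i => [|N IH] i; (split; first by []); (split; first exact: unif_conv_refl); first by [].
move=> d; have -> : partial d (G i) = (fun t th => c d i * G (s d i) t th).
  by apply: fun2_ext => t th; apply: E.
have E' : ev_eq (fun _ t th => c d i * G (s d i) t th) (partial_seq d (fun _ => G i)).
  by apply: ev_eq_refl => k t th; rewrite /partial_seq E.
apply: converges_upto_ext E' _.
have [E1 [S1 C1]] := converges_const (c d i).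
exact: converges_upto_mult E1 (ev_smooth_smooth_on (S _)) S1 (S _) (C1 N) (IH _).
Qed.

Lemma tame_exp c : tame (fun t _ => exp (c * t)).
Proof.
apply: (@tame_fam unit (fun _ t _ => exp (c * t)) (fun d _ => if d then 0 else c) (fun _ i => i)) => // [i|i|d i t th].
- by apply: smooth_on_exp; exact: open_all.
- move=> a Ha; exists (exp (Rabs c * a)); split; first exact: exp_pos.
  move=> t th Ht; rewrite Rabs_pos_eq; last exact: Rlt_le (exp_pos _).
  have : c * t <= Rabs c * a.
    apply: Rle_trans (Rle_abs _) _; rewrite Rabs_mult; apply: Rmult_le_compat_l => //; exact: Rabs_pos.
  case=> [H|->]; last by lra.
  by apply: Rlt_le; apply: exp_increasing.
- case: d => /=; first by rewrite Derive_const; ring.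
  by apply: is_derive_unique; auto_derive => //; ring.
Qed.

Lemma tame_trig c (i : bool) : tame (fun _ th => if i then cos (c * th) else sin (c * th)).
Proof.
apply: (@tame_fam bool (fun i _ th => if i then cos (c * th) else sin (c * th))
   (fun d (i : bool) => if d then (if i then - c else c) else 0) (fun _ i => ~~ i)) => [[]|[]|d [] t th].
- by apply: smooth_on_cos; exact: open_all.
- by apply: smooth_on_sin; exact: open_all.
- by move=> a Ha; exists 1; split=> [|t th _]; [lra|apply: Rabs_le; apply: COS_bound].
- by move=> a Ha; exists 1; split=> [|t th _]; [lra|apply: Rabs_le; apply: SIN_bound].
- case: d => /=; last by rewrite Derive_const; ring.
  by apply: is_derive_unique; auto_derive => //; ring.
- case: d => /=; last by rewrite Derive_const; ring.
  by apply: is_derive_unique; auto_derive => //; ring.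
Qed.

Lemma tame_cos c : tame (fun _ th => cos (c * th)).
Proof. exact: (tame_trig c true). Qed.

Lemma tame_sin c : tame (fun _ th => sin (c * th)).
Proof. exact: (tame_trig c false). Qed.

Lemma tame_const c : tame (fun _ _ => c).
Proof. exact: converges_const. Qed.

Lemma tame_plus G G' : tame G -> tame G' -> tame (fun t th => G t th + G' t th).
Proof. exact: converges_plus. Qed.

Lemma tame_minus G G' : tame G -> tame G' -> tame (fun t th => G t th - G' t th).
Proof. exact: converges_minus. Qed.

Lemma tame_mult G G' : tame G -> tame G' -> tame (fun t th => G t th * G' t th).
Proof. exact: converges_mult. Qed.

Lemma tame_scal c G : tame G -> tame (fun t th => c * G t th).
Proof. exact: converges_scal. Qed.

Lemma converges_unif_conv F G : converges F G -> unif_conv F G.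
Proof. by case=> _ [_ /(_ 0%N) [_ []]]. Qed.

Lemma converges_bounded F G : converges F G -> bounded G.
Proof. by case=> _ [_ /(_ 0%N) [] ]. Qed.

Lemma converges_lap F G : converges F G -> converges (fun k => lap (F k)) (lap G).
Proof.
move=> H.
exact: converges_plus (converges_partial false (converges_partial false H)) (converges_partial true (converges_partial true H)).
Qed.

(** ** Comparison with convergence in [C^infty_loc] as defined for maps *)

Fixpoint dword (w : seq bool) (F : R -> R -> R) : R -> R -> R :=
  if w is d :: w' then dword w' (partial d F) else F.

Lemma dword_ext D w F G : open_dom D -> (forall t th, D t -> F t th = G t th) ->
  forall t th, D t -> dword w F t th = dword w G t th.
Proof.
move=> oD; elim: w F G => //= d w IH F G E; apply: IH => t th Dt.
exact: partial_ext_loc oD Dt E.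
Qed.

Lemma dword_partial D w d F : open_dom D -> smooth_on D F -> forall t th, D t ->
  dword w (partial d F) t th = partial d (dword w F) t th.
Proof.
move=> oD; elim: w F => //= e w IH F H t th Dt.
rewrite -IH //; last exact: smooth_on_partial.
by apply: dword_ext Dt => // s z Ds; apply: smooth_on_comm2 oD H Ds.
Qed.

Lemma multi_dword p q F : partial_multi p q F = dword (nseq q true ++ nseq p false) F.
Proof.
rewrite /partial_multi.
have E d m G : iter m (partial d) G = dword (nseq m d) G.
  by elim: m G => // m IHm G; rewrite iterSr IHm.
by rewrite !E; elim: (nseq q true) F => //= e s IHs F; rewrite IHs.
Qed.

(** Mixed partial derivatives commute, so that a word of derivatives may be sorted. The index
    pair does not depend on the function: it can be used for a sequence and its limit. *)
Lemma dword_multi D w : open_dom D -> exists p q, forall F, smooth_on D F -> forall t th, D t ->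
  dword w F t th = partial_multi p q F t th.
Proof.
move=> oD; elim: w => [|d w [p [q IH]]]; first by exists 0%N, 0%N.
have Hd e F G : (forall t th, D t -> F t th = G t th) -> forall t th, D t ->
    partial e F t th = partial e G t th.
  by move=> E t th Dt; apply: partial_ext_loc oD Dt E.
case: d.
- exists p, q.+1 => F H t th Dt /=.
  by rewrite IH //; [rewrite /partial_multi -iterSr|exact: smooth_on_partial].
- exists p.+1, q => F H t th Dt.
  rewrite /= (dword_partial w false oD H _ Dt) /partial_multi /=.
  by apply: (Hd false) => // s z Ds; rewrite IH.
Qed.

Lemma converges_upto_dword N F G : (forall w, bounded (dword w G)) ->
  (forall w, unif_conv (fun k => dword w (F k)) (dword w G)) -> converges_upto N F G.
Proof.
elim: N F G => [|N IH] F G HB HU; (split; first exact: (HB [::]));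
  (split; first exact: (HU [::])); first by [].
by move=> d; apply: IH => w; [exact: (HB (d :: w))|exact: (HU (d :: w))].
Qed.

Lemma converges_dword F G w : converges F G -> unif_conv (fun k => dword w (F k)) (dword w G).
Proof.
elim: w F G => [|d w IH] F G H; first exact: converges_unif_conv.
exact: IH (converges_partial d H).
Qed.

Lemma tame_bounded_dword w G : tame G -> bounded (dword w G).
Proof.
elim: w G => [|d w IH] G H; first exact: (converges_bounded H).
exact: IH (converges_partial d H).
Qed.

Lemma Cinf_loc_lim_converges n (F : nat -> R -> R -> vec n) (G : R -> R -> vec n) j :
  tame (fun t th => G t th j) -> Cinf_loc_lim F G ->
  converges (fun k t th => F k t th j) (fun t th => G t th j).
Proof.
move=> NG [SG [_ H]].
apply: tame_converges => //.
  by move=> a Ha; have [H1 _] := H a Ha; apply: filter_imp H1 => k Hk m; apply: Hk.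
move=> N; apply: converges_upto_dword => w; first exact: tame_bounded_dword.
move=> a Ha eps He.
have Ha1 : 0 < a + 1 by lra.
have [p [q Hpq]] := dword_multi w (@open_strip (a + 1)).
have [H1 _] := H _ Ha1.
have [_ /(_ p q eps He) H2] := H a Ha.
apply: filter_imp (filter_and _ _ H1 H2) => k [S1 U] t th Ht.
have Ds := strip_lt Ht.
rewrite !Hpq //; first exact: U.
- exact: (@smooth_on_sub all_t _ _ (fun _ _ => I) (fun m => SG m j)).
Qed.

Lemma eventually_ord n (P : 'I_n -> nat -> Prop) :
  (forall j, eventually (P j)) -> eventually (fun k => forall j, P j k).
Proof.
move=> H.
suff : eventually (fun k => forall j, j \in enum 'I_n -> P j k).
  by apply: filter_imp => k Hk j; apply: Hk; rewrite mem_enum.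
elim: (enum 'I_n) => [|i s IH]; first by exists 0%N => k _ j.
apply: filter_imp (filter_and _ _ (H i) IH) => k [H1 H2] j.
by rewrite inE => /orP [/eqP ->|/H2].
Qed.

Lemma converges_Cinf_loc_lim n (F : nat -> R -> R -> vec n) (G : R -> R -> vec n) :
  (forall t th j, G t (th + 2 * PI) j = G t th j) ->
  (forall j, converges (fun k t th => F k t th j) (fun t th => G t th j)) ->
  Cinf_loc_lim F G.
Proof.
move=> Hper H; split; last split=> //.
  by move=> m j; have [_ [S _]] := H j; apply: S.
move=> a Ha; split.
  suff : eventually (fun k => forall j, smooth_on (strip a) (fun t th => F k t th j)).
    by apply: filter_imp => k S m j; apply: S.
  by apply: eventually_ord => j; have [E _] := H j; apply: E.
move=> p q eps He.
suff : eventually (fun k => forall j t th, Rabs t <= a ->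
  Rabs (partial_multi p q (fun s z => F k s z j) t th
              - partial_multi p q (fun s z => G s z j) t th) < eps).
  by apply: filter_imp => k U t th j Ht; apply: U.
apply: eventually_ord => j.
apply: filter_imp (converges_dword (nseq q true ++ nseq p false) (H j) Ha He) => k U t th Ht.
by rewrite !multi_dword; apply: U.
Qed.

(** * Integrals over cylinders *)

Definition circ_int (F : R -> R -> R) (t : R) : R := RInt (fun th => F t th) 0 (2 * PI).

Definition periodic_on (D : R -> Prop) (F : R -> R -> R) : Prop :=
  forall t th, D t -> F t (th + 2 * PI) = F t th.

Lemma twopi_gt0 : 0 < 2 * PI.
Proof. by have := PI_RGT_0; lra. Qed.

Lemma cont2_th F t th : continuity_2d_pt F t th -> continuous (fun z => F t z) th.
Proof.
move=> H; apply/continuity_pt_filterlim; rewrite continuity_pt_locally => eps.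
have [d Hd] := H eps; exists d => z Hz; apply: Hd => //.
by rewrite Rminus_eq_0 Rabs_R0; apply: cond_pos.
Qed.

Lemma smooth_on_cont_th D F t th : smooth_on D F -> D t -> continuous (fun z => F t z) th.
Proof. by move=> H Dt; apply: cont2_th; apply: smooth_on_cont H Dt. Qed.

Lemma ex_RInt_th D F t a b : smooth_on D F -> D t -> ex_RInt (fun th => F t th) a b.
Proof. by move=> H Dt; apply: ex_RInt_continuous => z _; apply: smooth_on_cont_th H Dt. Qed.

Lemma circ_int_derive D F t : open_dom D -> smooth_on D F -> D t ->
  is_derive (circ_int F) t (circ_int (partial false F) t).
Proof.
move=> oD H Dt; apply: is_derive_RInt_param.
- apply: filter_imp (oD t Dt) => s Ds th _; exact: (smooth_on_ex false th H Ds).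
- move=> th _; exact: (smooth_on_cont th (smooth_on_partial false H) Dt).
- by apply: filter_imp (oD t Dt) => s Ds; apply: ex_RInt_th H Ds.
Qed.

Lemma circ_int_cont D F t : open_dom D -> smooth_on D F -> D t -> continuous (circ_int F) t.
Proof. by move=> oD H Dt; apply: ex_derive_continuous; eexists; apply: circ_int_derive oD H Dt. Qed.

Lemma circ_int_plus D F G t : smooth_on D F -> smooth_on D G -> D t ->
  circ_int (fun s z => F s z + G s z) t = circ_int F t + circ_int G t.
Proof.
by move=> HF HG Dt; rewrite /circ_int; apply: RInt_plus; [apply: ex_RInt_th HF Dt|apply: ex_RInt_th HG Dt].
Qed.

Lemma circ_int_scal D c F t : smooth_on D F -> D t -> circ_int (fun s z => c * F s z) t = c * circ_int F t.
Proof.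
by move=> HF Dt; exact: (RInt_scal (V := R_CompleteNormedModule) (fun z => F t z) 0 (2 * PI) c (ex_RInt_th _ _ HF Dt)).
Qed.

Lemma circ_int_ext F G t : (forall th, F t th = G t th) -> circ_int F t = circ_int G t.
Proof. by move=> E; apply: RInt_ext => th _; apply: E. Qed.

Lemma circ_int_le D F G t : smooth_on D F -> smooth_on D G -> D t -> (forall th, F t th <= G t th) -> circ_int F t <= circ_int G t.
Proof.
move=> HF HG Dt E; apply: RInt_le; first exact: Rlt_le twopi_gt0.
- exact: ex_RInt_th HF Dt.
- exact: ex_RInt_th HG Dt.
- by move=> th _; apply: E.
Qed.

Lemma circ_int_const c t : circ_int (fun _ _ => c) t = 2 * PI * c.
Proof. by rewrite /circ_int RInt_const /scal /= /mult /=; ring. Qed.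

Lemma periodic_partial D d F : open_dom D -> smooth_on D F -> periodic_on D F -> periodic_on D (partial d F).
Proof.
move=> oD S H t th Dt; case: d => /=; last first.
  by apply: Derive_ext_loc; apply: filter_imp (oD t Dt) => s Ds; apply: H.
transitivity (Derive (fun z => F t (z + 2 * PI)) th); last first.
  by apply: Derive_ext => z; apply: H.
have X : ex_derive (fun z => F t z) (th + 2 * PI) by exact: (smooth_on_ex true _ S Dt).
rewrite (Derive_comp (fun z => F t z) (fun z => z + 2 * PI)) //; last by auto_derive.
have -> : Derive (fun z => z + 2 * PI) th = 1 by apply: is_derive_unique; auto_derive.
by rewrite Rmult_1_l.
Qed.

Lemma periodic_mult D F G : periodic_on D F -> periodic_on D G -> periodic_on D (fun t th => F t th * G t th).
Proof. by move=> HF HG t th Dt; rewrite HF // HG. Qed.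

Lemma circ_int_partial_th D F t : smooth_on D F -> periodic_on D F -> D t -> circ_int (partial true F) t = 0.
Proof.
move=> S P Dt; rewrite /circ_int /partial RInt_Derive.
- by have := P t 0 Dt; rewrite Rplus_0_l => ->; ring.
- by move=> z _; apply: (smooth_on_ex true z S Dt).
- by move=> z _; exact: smooth_on_cont_th (smooth_on_partial true S) Dt.
Qed.

Lemma circ_int_parts D F G t : open_dom D -> smooth_on D F -> smooth_on D G -> periodic_on D F -> periodic_on D G -> D t ->
  circ_int (fun s z => F s z * partial true G s z) t = - circ_int (fun s z => partial true F s z * G s z) t.
Proof.
move=> oD SF SG PF PG Dt.
have := circ_int_partial_th (smooth_on_mult oD SF SG) (periodic_mult PF PG) Dt.
have -> : circ_int (partial true (fun s z => F s z * G s z)) t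
   = circ_int (fun s z => partial true F s z * G s z + F s z * partial true G s z) t.
  by apply: circ_int_ext => th; rewrite partial_mult //; apply: (@smooth_on_ex D).
rewrite (circ_int_plus (D := D)) //; try lra; apply: smooth_on_mult => //; exact: smooth_on_partial.
Qed.

(** The integrals are oriented, and every estimate below needs [a <= b]. *)
Definition seg_in (D : R -> Prop) (a b : R) : Prop := a <= b /\ forall t, a <= t <= b -> D t.

Lemma ex_RInt_circ_int D F a b : open_dom D -> smooth_on D F -> seg_in D a b -> ex_RInt (circ_int F) a b.
Proof.
move=> oD S [ab H]; apply: ex_RInt_continuous => t; rewrite Rmin_left // Rmax_right // => Ht.
exact: circ_int_cont oD S (H t Ht).
Qed.

Lemma int_cylE a b F : int_cyl a b F = RInt (circ_int F) a b.
Proof. by []. Qed.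

Lemma cyl_plus D F G a b : open_dom D -> seg_in D a b -> smooth_on D F -> smooth_on D G ->
  int_cyl a b (fun s z => F s z + G s z) = int_cyl a b F + int_cyl a b G.
Proof.
move=> oD Sab SF SG; rewrite !int_cylE.
have <- : RInt (fun t => circ_int F t + circ_int G t) a b = RInt (circ_int F) a b + RInt (circ_int G) a b.
  exact: (RInt_plus (V := R_CompleteNormedModule) _ _ a b (ex_RInt_circ_int oD SF Sab) (ex_RInt_circ_int oD SG Sab)).
move: Sab => [ab H].
apply: RInt_ext => t; rewrite Rmin_left // Rmax_right // => Ht.
by apply: (circ_int_plus (D := D)) => //; apply: H; lra.
Qed.

Lemma cyl_scal D c F a b : open_dom D -> seg_in D a b -> smooth_on D F ->
  int_cyl a b (fun s z => c * F s z) = c * int_cyl a b F.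
Proof.
move=> oD Sab SF; rewrite !int_cylE.
have <- : RInt (fun t => c * circ_int F t) a b = c * RInt (circ_int F) a b.
  exact: (RInt_scal (V := R_CompleteNormedModule) (circ_int F) a b c (ex_RInt_circ_int oD SF Sab)).
move: Sab => [ab H].
apply: RInt_ext => t; rewrite Rmin_left // Rmax_right // => Ht.
by apply: (circ_int_scal (D := D)) => //; apply: H; lra.
Qed.

Lemma cyl_le D F G a b : open_dom D -> seg_in D a b -> smooth_on D F -> smooth_on D G ->
  (forall t th, a <= t <= b -> F t th <= G t th) -> int_cyl a b F <= int_cyl a b G.
Proof.
move=> oD Sab SF SG E; rewrite !int_cylE; have [ab H] := Sab.
apply: RInt_le => //; try exact: ex_RInt_circ_int oD _ Sab.
move=> t Ht; apply: (circ_int_le (D := D)) => //; first by apply: H; lra.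
by move=> th; apply: E; lra.
Qed.

Lemma cyl_const c a b : int_cyl a b (fun _ _ => c) = 2 * PI * (b - a) * c.
Proof.
rewrite int_cylE (RInt_ext _ (fun _ => 2 * PI * c)); last by move=> t _; rewrite circ_int_const.
by rewrite RInt_const /scal /= /mult /=; ring.
Qed.

Lemma cyl_ge0 D F a b : open_dom D -> seg_in D a b -> smooth_on D F ->
  (forall t th, a <= t <= b -> 0 <= F t th) -> 0 <= int_cyl a b F.
Proof.
move=> oD Sab SF E; have -> : 0 = int_cyl a b (fun _ _ => 0) by rewrite cyl_const; ring.
by apply: cyl_le oD Sab _ _ _ => //; exact: smooth_on_const.
Qed.

Lemma cyl_chasles D F a b c : open_dom D -> seg_in D a b -> seg_in D b c -> smooth_on D F ->
  int_cyl a b F + int_cyl b c F = int_cyl a c F.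
Proof.
move=> oD Sab Sbc SF; rewrite !int_cylE.
by apply: (RInt_Chasles (V := R_CompleteNormedModule)); [exact: ex_RInt_circ_int oD _ Sab|exact: ex_RInt_circ_int oD _ Sbc].
Qed.

Lemma seg_in_sub D a b a' b' : seg_in D a b -> a <= a' -> a' <= b' -> b' <= b -> seg_in D a' b'.
Proof. by move=> [ab H] h1 h2 h3; split=> // t Ht; apply: H; lra. Qed.

Lemma cyl_sub_le D F a b a' b' : open_dom D -> seg_in D a b -> a <= a' -> a' <= b' -> b' <= b ->
  smooth_on D F -> (forall t th, a <= t <= b -> 0 <= F t th) -> int_cyl a' b' F <= int_cyl a b F.
Proof.
move=> oD Sab h1 h2 h3 SF P.
have S1 : seg_in D a a' by apply: seg_in_sub Sab _ _ _; lra.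
have S2 : seg_in D a' b' by apply: seg_in_sub Sab _ _ _; lra.
have S3 : seg_in D b' b by apply: seg_in_sub Sab _ _ _; lra.
have S4 : seg_in D a b' by apply: seg_in_sub Sab _ _ _; lra.
rewrite -(cyl_chasles oD S4 S3 SF) -(cyl_chasles oD S1 S2 SF).
have : 0 <= int_cyl a a' F by apply: cyl_ge0 oD S1 SF _ => *; apply: P; lra.
have : 0 <= int_cyl b' b F by apply: cyl_ge0 oD S3 SF _ => *; apply: P; lra.
lra.
Qed.

Lemma cyl_partial_t D F a b : open_dom D -> seg_in D a b -> smooth_on D F ->
  int_cyl a b (partial false F) = circ_int F b - circ_int F a.
Proof.
move=> oD Sab SF; have [ab H] := Sab; rewrite int_cylE; apply: is_RInt_unique.
apply: (is_RInt_derive (circ_int F) (circ_int (partial false F))) => t; rewrite Rmin_left // Rmax_right // => Ht.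
- exact: circ_int_derive oD SF (H t Ht).
- exact: circ_int_cont oD (smooth_on_partial false SF) (H t Ht).
Qed.

Lemma cyl_partial_th D F a b : seg_in D a b -> smooth_on D F -> periodic_on D F ->
  int_cyl a b (partial true F) = 0.
Proof.
move=> [ab H] SF PF; rewrite int_cylE (RInt_ext _ (fun _ => 0)).
  by rewrite RInt_const /scal /= /mult /=; ring.
move=> t; rewrite Rmin_left // Rmax_right // => Ht.
by apply: (circ_int_partial_th SF PF); apply: H; lra.
Qed.

Lemma seg_in_strip a r : 0 < r < a -> seg_in (strip a) (- r) r.
Proof. by move=> [h1 h2]; split; [lra|move=> t [h3 h4]; rewrite /strip; apply: Rabs_def1; lra]. Qed.

(** ** Interior estimates *)

Definition sq (F : R -> R -> R) (t th : R) : R := F t th ^ 2.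

Lemma smooth_on_sq D F : open_dom D -> smooth_on D F -> smooth_on D (sq F).
Proof.
move=> oD S; apply: smooth_on_ext oD _ (smooth_on_mult oD S S) => t th _; by rewrite /sq; ring.
Qed.

Lemma smooth_on_lap D F : open_dom D -> smooth_on D F -> smooth_on D (lap F).
Proof. by move=> oD S; apply: smooth_on_plus => //; do 2!apply: smooth_on_partial. Qed.

Lemma sq_ge0 F t th : 0 <= sq F t th.
Proof. exact: pow2_ge_0. Qed.

(** Caccioppoli's inequality. As the circle is closed, a cutoff [eta] in [t] suffices, and the
    pointwise identity
    [2 eta |grad E|^2 = d_t (2 eta E E_t - eta' E^2) + d_th (2 eta E E_th) - 2 eta E lap E + eta'' E^2]
    integrates without boundary terms if [eta] and [eta'] are zero at [r] and [- r]; here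
    [eta = (r^2 - t^2)^2]. *)
Lemma caccioppoli a r r' E : 0 < r' -> r' < r -> r < a -> smooth_on (strip a) E -> periodic_on (strip a) E ->
  2 * (r ^ 2 - r' ^ 2) ^ 2 *
    (int_cyl (- r') r' (sq (partial false E)) + int_cyl (- r') r' (sq (partial true E)))
  <= (r ^ 4 + 8 * r ^ 2) * int_cyl (- r) r (sq E) + r ^ 4 * int_cyl (- r) r (sq (lap E)).
Proof.
move=> r'0 r'r ra S P.
set D := strip a; have oD : open_dom D by exact: open_strip.
have Sr : seg_in D (- r) r by apply: seg_in_strip; lra.
have Sr' : seg_in D (- r') r' by apply: seg_in_strip; lra.
pose eta t := (r ^ 2 - t ^ 2) ^ 2.
pose eta1 t := - 4 * t * (r ^ 2 - t ^ 2).
pose eta2 t := 12 * t ^ 2 - 4 * r ^ 2.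
have De t : is_derive eta t (eta1 t) by rewrite /eta /eta1; auto_derive => //; ring.
have De1 t : is_derive eta1 t (eta2 t) by rewrite /eta1 /eta2; auto_derive => //; ring.
have Sid : smooth_on D (fun t _ => t) by exact: smooth_on_id.
have Sb : smooth_on D (fun t _ => r ^ 2 - t ^ 2).
  apply: smooth_on_ext oD _ (smooth_on_plus oD (smooth_on_const D (r ^ 2)) (smooth_on_scal (-1) oD (smooth_on_mult oD Sid Sid))) => t th _.
  by ring.
have Se : smooth_on D (fun t _ => eta t).
  by apply: smooth_on_ext oD _ (smooth_on_mult oD Sb Sb) => t th _; rewrite /eta; ring.
have Se1 : smooth_on D (fun t _ => eta1 t).
  by apply: smooth_on_ext oD _ (smooth_on_scal (-4) oD (smooth_on_mult oD Sid Sb)) => t th _; rewrite /eta1; ring.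
have St := smooth_on_partial false S; have Sh := smooth_on_partial true S.
have Stt := smooth_on_partial false St; have Shh := smooth_on_partial true Sh.
have SEt := smooth_on_mult oD S St; have SEh := smooth_on_mult oD S Sh.
pose Z t th := 2 * (eta t * (E t th * partial false E t th)) + - 1 * (eta1 t * (E t th * E t th)).
pose W t th := 2 * (eta t * (E t th * partial true E t th)).
have SEE := smooth_on_mult oD S S.
have SZ1 := smooth_on_mult oD Se SEt; have SZ2 := smooth_on_mult oD Se1 SEE.
have SZ : smooth_on D Z by apply: smooth_on_plus => //; apply: smooth_on_scal.
have SW1 := smooth_on_mult oD Se SEh.
have SW : smooth_on D W by apply: smooth_on_scal.
have PW : periodic_on D W.
  have Ph := periodic_partial true oD S P.
  by move=> t th Dt; rewrite /W P // Ph.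
have ident t th : D t ->
  2 * (eta t * (sq (partial false E) t th + sq (partial true E) t th))
  = partial false Z t th + (partial true W t th
    + (-2 * (eta t * (E t th * lap E t th)) + eta2 t * sq E t th)).
  move=> Dt.
  have X d F : smooth_on D F -> ex_partial d F t th by move=> SF; exact: smooth_on_ex SF Dt.
  rewrite /Z partial_plus; try by apply: X; apply: smooth_on_scal.
  rewrite (partial_scal 2 (fun t th => eta t * (E t th * partial false E t th))).
  rewrite (partial_scal (- 1) (fun t th => eta1 t * (E t th * E t th))).
  rewrite (@partial_mult (fun t _ => eta t) (fun t th => E t th * partial false E t th)); try exact: X.
  rewrite (@partial_mult (fun t _ => eta1 t) (fun t th => E t th * E t th)); try exact: X.
  rewrite (@partial_mult E (partial false E)); try exact: X.
  rewrite (@partial_mult E E); try exact: X.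
  rewrite /W (partial_scal 2 (fun t th => eta t * (E t th * partial true E t th))).
  rewrite (@partial_mult (fun t _ => eta t) (fun t th => E t th * partial true E t th)); try exact: X.
  rewrite (@partial_mult E (partial true E)); try exact: X.
  have -> : partial false (fun t _ => eta t) t th = eta1 t by apply: is_derive_unique; exact: De.
  have -> : partial false (fun t _ => eta1 t) t th = eta2 t by apply: is_derive_unique; exact: De1.
  have -> : partial true (fun t _ => eta t) t th = 0 by rewrite /= Derive_const.
  by rewrite /sq /lap; ring.
have Sg : smooth_on D (fun t th => sq (partial false E) t th + sq (partial true E) t th).
  by apply: smooth_on_plus => //; apply: smooth_on_sq.
have SL : smooth_on D (lap E) by exact: smooth_on_lap.
pose Y t th := (r ^ 4 + 8 * r ^ 2) * sq E t th + r ^ 4 * sq (lap E) t th.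
have SY : smooth_on D Y by apply: smooth_on_plus => //; apply: smooth_on_scal => //; apply: smooth_on_sq.
have SZt := smooth_on_partial false SZ; have SWh := smooth_on_partial true SW.
have SWY := smooth_on_plus oD SWh SY.
have step1 : int_cyl (- r) r (fun t th => 2 * (eta t * (sq (partial false E) t th + sq (partial true E) t th)))
   <= int_cyl (- r) r Y.
  apply: Rle_trans (_ : int_cyl (- r) r (fun t th => partial false Z t th + (partial true W t th + Y t th)) <= _); last first.
    rewrite (cyl_plus oD Sr SZt SWY) (cyl_plus oD Sr SWh SY).
    rewrite (cyl_partial_t oD Sr SZ) (cyl_partial_th Sr SW PW).
    have J0 s : s = r \/ s = - r -> circ_int Z s = 0.
      move=> Hs; rewrite (@circ_int_ext Z (fun _ _ => 0)); first by rewrite circ_int_const; ring.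
      by move=> th; rewrite /Z /eta /eta1; case: Hs => ->; ring.
    by rewrite J0; [|by left]; rewrite J0; [lra|by right].
  apply: (cyl_le oD Sr (smooth_on_scal 2 oD (smooth_on_mult oD Se Sg)) (smooth_on_plus oD SZt SWY)).
  move=> t th Ht; have Dt : D t by apply: (proj2 Sr).
  rewrite ident //; apply: Rplus_le_compat_l; apply: Rplus_le_compat_l.
  rewrite /Y /eta2.
  have t2 : 0 <= t ^ 2 <= r ^ 2 by split; [exact: pow2_ge_0|nra].
  have e0 : 0 <= eta t <= r ^ 4.
    by rewrite /eta; split; [exact: pow2_ge_0|nra].
  have q0 : 0 <= sq E t th by exact: sq_ge0.
  have ql : 0 <= sq (lap E) t th by exact: sq_ge0.
  have m1 : -2 * (eta t * (E t th * lap E t th)) <= eta t * (sq E t th + sq (lap E) t th).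
    rewrite /sq; have := pow2_ge_0 (E t th + lap E t th); nra.
  have m2 : eta t * (sq E t th + sq (lap E) t th) <= r ^ 4 * (sq E t th + sq (lap E) t th).
    by apply: Rmult_le_compat_r; lra.
  have m3 : (12 * t ^ 2 - 4 * r ^ 2) * sq E t th <= 8 * r ^ 2 * sq E t th.
    by apply: Rmult_le_compat_r; lra.
  lra.
have SYe : int_cyl (- r) r Y = (r ^ 4 + 8 * r ^ 2) * int_cyl (- r) r (sq E) + r ^ 4 * int_cyl (- r) r (sq (lap E)).
  have S1 : smooth_on D (sq E) by exact: smooth_on_sq.
  have S2 : smooth_on D (sq (lap E)) by exact: smooth_on_sq.
  by rewrite (cyl_plus oD Sr) ?(cyl_scal _ oD Sr) //; apply: smooth_on_scal.
rewrite -SYe; apply: Rle_trans step1.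
rewrite -(cyl_plus oD Sr'); try by apply: smooth_on_sq.
rewrite -(cyl_scal _ oD Sr' Sg).
have h1 : - r <= - r' by lra.
have h2 : - r' <= r' by lra.
apply: Rle_trans (cyl_sub_le oD Sr h1 h2 (Rlt_le _ _ r'r) (smooth_on_scal 2 oD (smooth_on_mult oD Se Sg)) _); last first.
  move=> t th _; have := sq_ge0 (partial false E) t th; have := sq_ge0 (partial true E) t th.
  by have : 0 <= eta t; [exact: pow2_ge_0|nra].
apply: (cyl_le oD Sr' (smooth_on_scal _ oD Sg) (smooth_on_scal 2 oD (smooth_on_mult oD Se Sg))).
move=> t th Ht.
have g0 : 0 <= sq (partial false E) t th + sq (partial true E) t th.
  by have := sq_ge0 (partial false E) t th; have := sq_ge0 (partial true E) t th; lra.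
rewrite Rmult_assoc; apply: Rmult_le_compat_l; first lra.
apply: Rmult_le_compat_r => //; rewrite /eta.
have h : t ^ 2 <= r' ^ 2 by nra.
by apply: pow_incr; nra.
Qed.

(** ** Uniform bounds from bounds in the mean *)

(** [y x] differs from [y s] by at most the integral of [g]; average over [s]. *)
Lemma sobolev_1d (y y1 g : R -> R) (a b x : R) : a < b ->
  (forall s, a <= s <= b -> is_derive y s (y1 s)) ->
  (forall s, a <= s <= b -> continuous y1 s) ->
  (forall s, a <= s <= b -> continuous g s) ->
  (forall s, a <= s <= b -> Rabs (y1 s) <= g s) ->
  a <= x <= b ->
  (b - a) * y x <= RInt y a b + (b - a) * RInt g a b.
Proof.
move=> ab Hd C1 Cg Hg Hx.
have mm : forall s, Rmin a b <= s <= Rmax a b -> a <= s <= b.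
  by move=> s; rewrite Rmin_left ?Rmax_right; lra.
have Iy : ex_RInt y a b.
  apply: ex_RInt_continuous => s /mm Hs; apply: ex_derive_continuous; eexists; exact: Hd.
have Ig : ex_RInt g a b by apply: ex_RInt_continuous => s /mm; apply: Cg.
have g0 s : a <= s <= b -> 0 <= g s.
  by move=> Hs; apply: Rle_trans (Rabs_pos _) (Hg s Hs).
have sub p q : a <= p -> p <= q -> q <= b -> Rabs (y q - y p) <= RInt g a b.
  move=> h1 h2 h3.
  have mm' s : Rmin p q <= s <= Rmax p q -> a <= s <= b.
    by rewrite Rmin_left // Rmax_right //; lra.
  have I1 : is_RInt y1 p q (y q - y p).
    by apply: (is_RInt_derive y y1) => s /mm' Hs; [exact: Hd|exact: C1].
  have I1' : ex_RInt y1 p q by eexists; exact: I1.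
  have Igpq u v : a <= u -> u <= v -> v <= b -> ex_RInt g u v.
    move=> k1 k2 k3; apply: ex_RInt_continuous => s; rewrite Rmin_left // Rmax_right // => Hs.
    by apply: Cg; lra.
  rewrite -(is_RInt_unique _ _ _ _ I1).
  apply: Rle_trans (abs_RInt_le _ _ _ h2 I1') _.
  apply: (Rle_trans _ (RInt g p q)).
    apply: RInt_le => //.
    - apply: ex_RInt_continuous => s /mm' Hs.
      by apply: continuous_comp; [exact: C1|exact: continuous_Rabs].
    - by apply: Igpq; lra.
    - by move=> s Hs; apply: Hg; lra.
  have aq : a <= q by lra.
  have -> : RInt g a b = RInt g a p + RInt g p q + RInt g q b.
    rewrite -(RInt_Chasles g a q b); [|by apply: Igpq; lra|by apply: Igpq; lra].
    by rewrite -(RInt_Chasles g a p q) //; apply: Igpq; lra.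
  have : 0 <= RInt g a p by apply: RInt_ge_0 => //; [apply: Igpq; lra|move=> s Hs; apply: g0; lra].
  have : 0 <= RInt g q b by apply: RInt_ge_0 => //; [apply: Igpq; lra|move=> s Hs; apply: g0; lra].
  lra.
have key s : a <= s <= b -> y x - RInt g a b <= y s.
  move=> Hs; case: (Rle_dec x s) => h.
  - have := sub x s (proj1 Hx) h (proj2 Hs); rewrite -Rabs_Ropp => h1.
    by have := Rle_trans _ _ _ (Rle_abs _) h1; lra.
  - have h' : s <= x by lra.
    by have := Rle_trans _ _ _ (Rle_abs _) (sub s x (proj1 Hs) h' (proj2 Hx)); lra.
have : RInt (fun _ => y x - RInt g a b) a b <= RInt y a b.
  apply: RInt_le => //; [lra|exact: ex_RInt_const|].
  by move=> s Hs; apply: key; lra.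
rewrite RInt_const /scal /= /mult /=; lra.
Qed.

Lemma periodic_reduce (g : R -> R) : (forall th, g (th + 2 * PI) = g th) ->
  forall th, exists th0, 0 <= th0 <= 2 * PI /\ g th0 = g th.
Proof.
move=> P th; have T := twopi_gt0.
have PN x n : g (x + INR n * (2 * PI)) = g x.
  elim: n x => [|n IH] x; first by congr g; rewrite /=; ring.
  rewrite S_INR -(IH x) -(P (x + INR n * (2 * PI))); congr g; ring.
have PZ x (z : Z) : g (x + IZR z * (2 * PI)) = g x.
  case: (Z_le_dec 0 z) => Hz.
    by rewrite -(Z2Nat.id z) // -INR_IZR_INZ PN.
  rewrite -(PN _ (Z.to_nat (- z))) INR_IZR_INZ Z2Nat.id; last lia.
  by rewrite opp_IZR; congr g; ring.
have [h1 h2] := base_Int_part (th / (2 * PI)).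
exists (th + IZR (- Int_part (th / (2 * PI))) * (2 * PI)); split; last exact: PZ.
rewrite opp_IZR; move: (IZR _) h1 h2 => z h1 h2.
have E : th = th / (2 * PI) * (2 * PI) by field; lra.
by split; nra.
Qed.

(** The one-dimensional Sobolev inequality, first in [t] for the integrals over circles of [E^2]
    and [E_th^2], then in [theta]. *)
Lemma sup_le_cyl a r E : 0 < r < a -> smooth_on (strip a) E -> periodic_on (strip a) E ->
  forall t th, Rabs t <= r -> E t th ^ 2 <=
    (1 + / r) * (1 + / PI) *
     (int_cyl (- r) r (sq E) + int_cyl (- r) r (sq (partial false E))
      + (int_cyl (- r) r (sq (partial true E))
         + int_cyl (- r) r (sq (partial false (partial true E))))).
Proof.
move=> Hr S P t th Ht.
set D := strip a; have oD : open_dom D by exact: open_strip.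
have Sr : seg_in D (- r) r by apply: seg_in_strip.
have Ht' : - r <= t <= r by move: Ht; rewrite /Rabs; case: Rcase_abs; lra.
have Dt : D t by apply: (proj2 Sr).
have T := twopi_gt0; have PI0 := PI_RGT_0.
(* In [t], the integral over the circle satisfies [|(int F^2)'| <= int (F^2 + F_t^2)]. *)
have step F : smooth_on D F -> circ_int (sq F) t <= / (2 * r) * int_cyl (- r) r (sq F)
   + (int_cyl (- r) r (sq F) + int_cyl (- r) r (sq (partial false F))).
  move=> SF; have SFt := smooth_on_partial false SF.
  have S1 := smooth_on_sq oD SF; have S2 := smooth_on_sq oD SFt.
  have SG := smooth_on_plus oD S1 S2.
  have H := @sobolev_1d (circ_int (sq F)) (circ_int (partial false (sq F)))
     (circ_int (fun s z => sq F s z + sq (partial false F) s z)) (- r) r t.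
  have {}H : (r - - r) * circ_int (sq F) t <= RInt (circ_int (sq F)) (- r) r
     + (r - - r) * RInt (circ_int (fun s z => sq F s z + sq (partial false F) s z)) (- r) r.
    apply: H => //; first by lra.
    - by move=> s Hs; apply: circ_int_derive oD S1 _; apply: (proj2 Sr).
    - by move=> s Hs; apply: circ_int_cont oD (smooth_on_partial false S1) _; apply: (proj2 Sr).
    - by move=> s Hs; apply: circ_int_cont oD SG _; apply: (proj2 Sr).
    - move=> s Hs; have Ds : D s by apply: (proj2 Sr).
      have E1 z : partial false (sq F) s z = 2 * (F s z * partial false F s z).
        have -> : sq F = (fun t th => F t th * F t th) by apply: fun2_ext => u v; rewrite /sq; ring.
        have exF : ex_partial false F s z by exact: smooth_on_ex SF Ds.
        by rewrite partial_mult //; ring.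
      have up : circ_int (partial false (sq F)) s <= circ_int (fun s z => sq F s z + sq (partial false F) s z) s.
        apply: (circ_int_le (smooth_on_partial false S1) SG Ds) => z; rewrite E1 /sq.
        by have := pow2_ge_0 (F s z - partial false F s z); nra.
      have dn : circ_int (fun s z => -1 * partial false (sq F) s z) s <= circ_int (fun s z => sq F s z + sq (partial false F) s z) s.
        apply: (circ_int_le (smooth_on_scal (-1) oD (smooth_on_partial false S1)) SG Ds) => z; rewrite E1 /sq.
        by have := pow2_ge_0 (F s z + partial false F s z); nra.
      rewrite (circ_int_scal _ (smooth_on_partial false S1) Ds) in dn.
      by apply: Rabs_le; lra.
  rewrite -int_cylE -int_cylE (cyl_plus oD Sr S1 S2) in H.
  apply: (Rmult_le_reg_l (r - - r)); first by lra.
  apply: Rle_trans H _; right; field; lra.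
(* In [theta], the same argument is applied to [E^2] and its derivative [2 E E_th]. *)
have [th0 [Hth0 <-]] := periodic_reduce (fun th => f_equal (fun x => x ^ 2) (P t th Dt)) th.
have Sh := smooth_on_partial true S.
have S0 := smooth_on_sq oD S; have S1 := smooth_on_sq oD Sh.
have H := @sobolev_1d (fun z => sq E t z) (fun z => Derive (fun z => sq E t z) z)
  (fun z => sq E t z + sq (partial true E) t z) 0 (2 * PI) th0 T.
have {}H : (2 * PI - 0) * E t th0 ^ 2 <= circ_int (sq E) t + (2 * PI - 0) * circ_int (fun t z => sq E t z + sq (partial true E) t z) t.
  apply: H => //.
  - by move=> z _; apply: Derive_correct; exact: (smooth_on_ex true z S0 Dt).
  - by move=> z _; exact: smooth_on_cont_th (smooth_on_partial true S0) Dt.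
  - by move=> z _; exact: smooth_on_cont_th (smooth_on_plus oD S0 S1) Dt.
  - move=> z _; have X : ex_partial true E t z by exact: smooth_on_ex S Dt.
    have -> : Derive (fun z => sq E t z) z = 2 * (E t z * partial true E t z).
      have -> : Derive (fun z => sq E t z) z = partial true (fun t th => E t th * E t th) t z.
        by apply: Derive_ext => u; rewrite /sq; ring.
      by rewrite partial_mult //; ring.
    have := pow2_ge_0 (E t z + partial true E t z).
    have := pow2_ge_0 (E t z - partial true E t z).
    by move=> h1 h2; apply: Rabs_le; rewrite /sq; lra.
rewrite (circ_int_plus S0 S1 Dt) in H.
have J1 := step E S; have J2 := step _ Sh.
have nn F : smooth_on D F -> 0 <= int_cyl (- r) r (sq F).
  by move=> SF; apply: (cyl_ge0 oD Sr (smooth_on_sq oD SF)) => *; exact: sq_ge0.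
have n1 := nn _ S; have n2 := nn _ (smooth_on_partial false S).
have n3 := nn _ Sh; have n4 := nn _ (smooth_on_partial false Sh).
have Jn F : smooth_on D F -> 0 <= circ_int (sq F) t.
  move=> SF; have -> : 0 = circ_int (fun _ _ => 0) t by rewrite circ_int_const; ring.
  by apply: (circ_int_le (smooth_on_const D 0) (smooth_on_sq oD SF) Dt) => *; exact: sq_ge0.
have j1 := Jn _ S; have j2 := Jn _ Sh.
have r0 : 0 < / r by apply: Rinv_0_lt_compat; lra.
have p0 : 0 < / PI by apply: Rinv_0_lt_compat.
have e2 : / (2 * r) = / r / 2 by field; lra.
rewrite e2 in J1 J2.
have E2 : E t th0 ^ 2 <= (1 + / PI) * (circ_int (sq E) t + circ_int (sq (partial true E)) t).
  apply: (Rmult_le_reg_l (2 * PI)); first lra.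
  have -> : 2 * PI * ((1 + / PI) * (circ_int (sq E) t + circ_int (sq (partial true E)) t))
    = (2 * PI + 2) * (circ_int (sq E) t + circ_int (sq (partial true E)) t) by field; lra.
  lra.
apply: Rle_trans E2 _.
rewrite (Rmult_comm (1 + / r)) Rmult_assoc; apply: Rmult_le_compat_l; first lra.
rewrite Rmult_plus_distr_l.
nra.
Qed.

(** ** Two notions of smallness treated at once *)

(** Interior estimates are used twice: to pass from bounded integrals to bounded suprema, and
    from integrals that tend to [0] to suprema that tend to [0]. Both classes of sequences are
    closed under the operations below, and one proof serves for both. *)
Definition ideal (S : (nat -> R) -> Prop) : Prop :=
  (forall C x y z, 0 <= C -> S x -> S y ->
     eventually (fun k => z k <= C * (x k + y k)) -> S z) /\
  (forall x, (forall eps, 0 < eps -> eventually (fun k => x k <= eps)) -> S x).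

Definition bounded_seq (x : nat -> R) : Prop := exists B, eventually (fun k => x k <= B).

Definition vanishing (x : nat -> R) : Prop :=
  forall eps, 0 < eps -> eventually (fun k => x k <= eps).

Lemma ideal_bounded_seq : ideal bounded_seq.
Proof.
split; last by move=> x H; exists 1; apply: H; lra.
move=> C x y z C0 [B H] [B' H'] H2; exists (C * (B + B')).
apply: filter_imp (filter_and _ _ H2 (filter_and _ _ H H')) => k [h1 [h2 h3]].
by apply: Rle_trans h1 _; apply: Rmult_le_compat_l => //; lra.
Qed.

Lemma ideal_vanishing : ideal vanishing.
Proof.
split=> // C x y z C0 H H' H2 eps He.
have Hd : 0 < eps / (2 * (C + 1)) by apply: Rdiv_lt_0_compat; lra.
apply: filter_imp (filter_and _ _ H2 (filter_and _ _ (H _ Hd) (H' _ Hd))) => k [h1 [h2 h3]].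
apply: Rle_trans h1 _; apply: (Rle_trans _ ((C + 1) * (eps / (2 * (C + 1)) + eps / (2 * (C + 1))))).
  apply: (Rle_trans _ (C * (eps / (2 * (C + 1)) + eps / (2 * (C + 1))))).
    by apply: Rmult_le_compat_l; lra.
  by apply: Rmult_le_compat_r; lra.
by right; field; lra.
Qed.

Definition ev_periodic (F : funseq) : Prop :=
  forall a, 0 < a -> eventually (fun k => periodic_on (strip a) (F k)).

Definition sq_int_in (S : (nat -> R) -> Prop) (F : funseq) : Prop :=
  forall r, 0 < r -> S (fun k => int_cyl (- r) r (sq (F k))).

Lemma sq_int_in_unif0 S F : ideal S -> ev_smooth F -> unif_conv F (fun _ _ => 0) -> sq_int_in S F.
Proof.
move=> [_ IS] ES H r Hr; apply: IS => eps He.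
have PI0 := PI_RGT_0.
pose c := 4 * PI * r.
have c0 : 0 < c by rewrite /c; apply: Rmult_lt_0_compat; lra.
pose d := Rmin 1 (eps / c).
have d0 : 0 < d by apply: Rmin_glb_lt; [lra|apply: Rdiv_lt_0_compat].
have Hr1 : 0 < r + 1 by lra.
apply: filter_imp (filter_and _ _ (ES _ Hr1) (H r Hr d d0)) => k [S1 U].
have Sr : seg_in (strip (r + 1)) (- r) r by apply: seg_in_strip; lra.
have oD := @open_strip (r + 1).
have : int_cyl (- r) r (sq (F k)) <= int_cyl (- r) r (fun _ _ => d).
  apply: (cyl_le oD Sr (smooth_on_sq oD S1) (smooth_on_const _ d)) => t th Ht.
  have h := U t th (Rabs_le _ _ Ht); rewrite Rminus_0_r in h.
  have h1 : d <= 1 by exact: Rmin_l.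
  rewrite /sq -pow2_abs; have := Rabs_pos (F k t th); nra.
rewrite cyl_const => h; apply: Rle_trans h _.
apply: (Rle_trans _ (c * (eps / c))); last by right; field; lra.
have h2 : d <= eps / c by exact: Rmin_r.
have -> : 2 * PI * (r - - r) * d = c * d by rewrite /c; ring.
by apply: Rmult_le_compat_l; lra.
Qed.

Lemma sq_int_in_cvs0 S F : ideal S -> converges F (fun _ _ => 0) -> sq_int_in S F.
Proof. by move=> IS H; apply: sq_int_in_unif0 IS (proj1 H) (converges_unif_conv H). Qed.

(** Sequences on which the interior estimates act: nothing but the integral of the square is
    controlled, while the Laplacian tends to [0] with all derivatives. *)
Definition almost_harmonic (S : (nat -> R) -> Prop) (F : funseq) : Prop :=
  [/\ ev_smooth F, ev_periodic F, sq_int_in S F & converges (fun k => lap (F k)) (fun _ _ => 0)].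

Lemma lap_partial D d F t th : open_dom D -> smooth_on D F -> D t ->
  partial d (lap F) t th = lap (partial d F) t th.
Proof.
move=> oD S Dt; rewrite /lap partial_plus; try (apply: (@smooth_on_ex D) => //; do 2!apply: smooth_on_partial => //).
have X e : partial d (partial e (partial e F)) t th = partial e (partial e (partial d F)) t th.
  rewrite (smooth_on_comm2 d e th oD (smooth_on_partial e S) Dt).
  by apply: (partial_ext_loc e th oD Dt) => s z Ds; exact: smooth_on_comm2 oD S Ds.
by rewrite !X.
Qed.

Lemma ev_periodic_partial_seq d F : ev_smooth F -> ev_periodic F -> ev_periodic (partial_seq d F).
Proof.
move=> E P a Ha; apply: filter_imp (filter_and _ _ (E a Ha) (P a Ha)) => k [S Pk].
exact: periodic_partial (@open_strip a) S Pk.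
Qed.

Lemma partial0 d : partial d (fun _ _ => 0) = (fun _ _ => 0).
Proof. by apply: fun2_ext => t th; rewrite partial_const. Qed.

(** The Laplacian commutes with derivatives, and Caccioppoli's inequality on a strip wider by [1]
    controls the gradient; so arbitrarily many derivatives can be taken. *)
Lemma almost_harmonic_partial S d F : ideal S -> almost_harmonic S F -> almost_harmonic S (partial_seq d F).
Proof.
move=> IS [E P L C]; split; [exact: ev_smooth_partial_seq|exact: ev_periodic_partial_seq| |]; last first.
  have := converges_partial d C; rewrite partial0; apply: converges_ext => //.
  move=> a Ha; apply: filter_imp (E a Ha) => k Sk t th Ht.
  exact: lap_partial (@open_strip a) Sk Ht.
move=> r Hr.
have Hr1 : 0 < r + 1 by lra.
have Hr2 : 0 < r + 2 by lra.
have LL := sq_int_in_cvs0 IS C Hr1.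
pose c := 2 * ((r + 1) ^ 2 - r ^ 2) ^ 2.
have c0 : 0 < c by rewrite /c; apply: Rmult_lt_0_compat; [lra|apply: pow_lt; nra].
pose C1 := ((r + 1) ^ 4 + 8 * (r + 1) ^ 2) / c.
have A0 : 0 <= (r + 1) ^ 4 by apply: pow_le; lra.
have A1 : 0 <= (r + 1) ^ 2 by apply: pow_le; lra.
have C10 : 0 <= C1 by apply: Rdiv_le_0_compat => //; lra.
apply: (IS.1 C1 _ _ _ C10 (L _ Hr1) LL).
apply: filter_imp (filter_and _ _ (E _ Hr2) (P _ Hr2)) => k [Sk Pk].
have h1 : r < r + 1 by lra.
have h2 : r + 1 < r + 2 by lra.
have := caccioppoli Hr h1 h2 Sk Pk.
have oD := @open_strip (r + 2).
have Sr : seg_in (strip (r + 2)) (- r) r by apply: seg_in_strip; lra.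
have Sr1 : seg_in (strip (r + 2)) (- (r + 1)) (r + 1) by apply: seg_in_strip; lra.
have nn F' : smooth_on (strip (r + 2)) F' -> 0 <= int_cyl (- r) r (sq F').
  by move=> SF; apply: (cyl_ge0 oD Sr (smooth_on_sq oD SF)) => *; exact: sq_ge0.
have nn' F' : smooth_on (strip (r + 2)) F' -> 0 <= int_cyl (- (r + 1)) (r + 1) (sq F').
  by move=> SF; apply: (cyl_ge0 oD Sr1 (smooth_on_sq oD SF)) => *; exact: sq_ge0.
have n1 := nn _ (smooth_on_partial false Sk); have n2 := nn _ (smooth_on_partial true Sk).
have n3 := nn' _ Sk; have n4 := nn' _ (smooth_on_lap oD Sk).
set x := int_cyl (- (r + 1)) (r + 1) (sq (F k)) in n3 *.
set y := int_cyl (- (r + 1)) (r + 1) (sq (lap (F k))) in n4 *.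
move=> H.
have HX : int_cyl (- r) r (sq (partial_seq d F k)) <=
   int_cyl (- r) r (sq (partial false (F k))) + int_cyl (- r) r (sq (partial true (F k))).
  by rewrite /partial_seq; case: (d); lra.
apply: Rle_trans HX _; apply: (Rmult_le_reg_l c) => //.
have E1 : c * (C1 * (x + y)) = ((r + 1) ^ 4 + 8 * (r + 1) ^ 2) * (x + y) by rewrite /C1; field; lra.
rewrite E1.
by apply: Rle_trans H _; nra.
Qed.

Lemma almost_harmonic_sup S F r : ideal S -> almost_harmonic S F -> 0 < r ->
  exists x, S x /\ eventually (fun k => forall t th, Rabs t <= r -> F k t th ^ 2 <= x k).
Proof.
move=> IS HF Hr.
have H1 := almost_harmonic_partial false IS HF; have H2 := almost_harmonic_partial true IS HF.
have H3 := almost_harmonic_partial false IS H2.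
have [E P L0 _] := HF; have [_ _ L1 _] := H1; have [_ _ L2' _] := H2; have [_ _ L3 _] := H3.
have PI0 := PI_RGT_0.
have k0 : 0 <= (1 + / r) * (1 + / PI).
  apply: Rmult_le_pos; first by have := Rinv_0_lt_compat _ Hr; lra.
  by have := Rinv_0_lt_compat _ PI0; lra.
have id0 x : eventually (fun k => x k <= 1 * x k) by exists 0%N => *; lra.
have sumS x y : S x -> S y -> S (fun k => x k + y k).
  move=> Sx Sy; apply: (IS.1 1 _ _ _ _ Sx Sy); first lra.
  by exists 0%N => *; lra.
have S1 := sumS _ _ (L0 r Hr) (L1 r Hr); have S2 := sumS _ _ (L2' r Hr) (L3 r Hr).
exists (fun k => (1 + / r) * (1 + / PI) *
  ((int_cyl (- r) r (sq (F k)) + int_cyl (- r) r (sq (partial_seq false F k)))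
   + (int_cyl (- r) r (sq (partial_seq true F k)) + int_cyl (- r) r (sq (partial_seq false (partial_seq true F) k))))); split.
  by apply: (IS.1 _ _ _ _ k0 S1 S2); exists 0%N => k _; apply: Rle_refl.
have Hr1 : 0 < r + 1 by lra.
apply: filter_imp (filter_and _ _ (E _ Hr1) (P _ Hr1)) => k [Sk Pk] t th Ht.
have Hr' : 0 < r < r + 1 by lra.
exact: sup_le_cyl Hr' Sk Pk t th Ht.
Qed.

Lemma almost_harmonic_vanishing_unif F : almost_harmonic vanishing F -> unif_conv F (fun _ _ => 0).
Proof.
move=> H a Ha eps He.
have [x [Vx Hx]] := almost_harmonic_sup ideal_vanishing H Ha.
have He2 : 0 < (eps / 2) ^ 2 by apply: pow_lt; lra.
apply: filter_imp (filter_and _ _ Hx (Vx _ He2)) => k [h1 h2] t th Ht.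
have h := Rle_trans _ _ _ (h1 t th Ht) h2; rewrite Rminus_0_r.
rewrite -pow2_abs in h; have := Rabs_pos (F k t th) => h3.
by nra.
Qed.

Lemma almost_harmonic_vanishing_converges F : almost_harmonic vanishing F -> converges F (fun _ _ => 0).
Proof.
move=> H; apply: tame_converges; first exact: tame_const.
  by case: H.
move=> N; elim: N F H => [|N IH] F H.
all: split; first exact: (converges_bounded (tame_const 0)).
all: split; first exact: almost_harmonic_vanishing_unif.
  by [].
by move=> d; rewrite partial0; apply: IH; apply: almost_harmonic_partial H; exact: ideal_vanishing.
Qed.

(** * A function with small Fourier coefficients is small *)

Definition cos_kernel (N : nat) (x : R) : R := ((1 + cos x) / 2) ^ N.

Lemma ex_RInt_cd (g h : R -> R) a b : (forall x, continuous g x) -> (forall x, ex_derive h x) ->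
  ex_RInt (fun x => g x * h x) a b.
Proof.
move=> Hg Hh; apply: ex_RInt_continuous => z _.
apply: (continuous_mult g h); [exact: Hg|exact: ex_derive_continuous].
Qed.

Lemma RInt_extR (f g : R -> R) a b : (forall x, f x = g x) -> RInt f a b = RInt g a b.
Proof. by move=> E; apply: RInt_ext => x _; exact: E. Qed.

Lemma RInt_lin (f g : R -> R) c d a b : ex_RInt f a b -> ex_RInt g a b ->
  RInt (fun x => c * f x + d * g x) a b = c * RInt f a b + d * RInt g a b.
Proof.
move=> Hf Hg; apply: is_RInt_unique.
apply: (is_RInt_plus (fun x => c * f x) (fun x => d * g x)).
- exact: (is_RInt_scal f a b c _ (RInt_correct _ _ _ Hf)).
- exact: (is_RInt_scal g a b d _ (RInt_correct _ _ _ Hg)).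
Qed.

Lemma ex_RInt_lin (f g : R -> R) c d a b : ex_RInt f a b -> ex_RInt g a b ->
  ex_RInt (fun x => c * f x + d * g x) a b.
Proof.
move=> [If Hf] [Ig Hg]; eexists.
apply: (is_RInt_plus (fun x => c * f x) (fun x => d * g x)).
- exact: (is_RInt_scal f a b c _ Hf).
- exact: (is_RInt_scal g a b d _ Hg).
Qed.

(** One factor [(1 + cos x) / 2] replaces the frequency [p] by the average of [p], [p], [p + 1]
    and [p - 1]. These weights are convex, hence the bound does not deteriorate with [N]. *)
Lemma cos_kernel_mode (g : R -> R) (d : R) : (forall x, continuous g x) -> 0 <= d ->
  forall N p th0,
  (forall l, le l (Nat.add N p) ->
     Rabs (RInt (fun x => g x * cos (INR l * x)) 0 (2 * PI)) <= d /\
     Rabs (RInt (fun x => g x * sin (INR l * x)) 0 (2 * PI)) <= d) ->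
  Rabs (RInt (fun x => g x * (cos_kernel N (x - th0) * cos (INR p * (x - th0)))) 0 (2 * PI)) <= 2 * d.
Proof.
move=> Hg d0.
have ex N p th0 : ex_RInt (fun x => g x * (cos_kernel N (x - th0) * cos (INR p * (x - th0)))) 0 (2 * PI).
  by apply: ex_RInt_cd => // x; rewrite /cos_kernel; auto_derive.
elim=> [|N IH] p th0 H.
- have [H1 H2] := H p (Nat.le_refl _).
  rewrite (@RInt_extR _ (fun x => cos (INR p * th0) * (g x * cos (INR p * x)) + sin (INR p * th0) * (g x * sin (INR p * x)))); last first.
    move=> x; rewrite /cos_kernel /= Rmult_minus_distr_l cos_minus; ring.
  rewrite RInt_lin; try (by apply: ex_RInt_cd => // x; auto_derive).
  apply: Rle_trans (Rabs_triang _ _) _; rewrite !Rabs_mult.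
  have c1 : Rabs (cos (INR p * th0)) <= 1 by apply: Rabs_le; apply: COS_bound.
  have s1 : Rabs (sin (INR p * th0)) <= 1 by apply: Rabs_le; apply: SIN_bound.
  have -> : 2 * d = 1 * d + 1 * d by ring.
  by apply: Rplus_le_compat; apply: Rmult_le_compat => //; apply: Rabs_pos.
- have I0 : Rabs (RInt (fun x => g x * (cos_kernel N (x - th0) * cos (INR p * (x - th0)))) 0 (2 * PI)) <= 2 * d.
    by apply: IH => l Hl; apply: H; lia.
  have I1 : Rabs (RInt (fun x => g x * (cos_kernel N (x - th0) * cos (INR p.+1 * (x - th0)))) 0 (2 * PI)) <= 2 * d.
    by apply: IH => l Hl; apply: H; lia.
  case: p H I0 I1 => [|p] H I0 I1.
  + rewrite (@RInt_extR _ (fun x => / 2 * (g x * (cos_kernel N (x - th0) * cos (INR 0 * (x - th0))))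
       + / 2 * (g x * (cos_kernel N (x - th0) * cos (INR 1 * (x - th0)))))); last first.
      move=> x; rewrite /cos_kernel -(tech_pow_Rmult _ N) /= Rmult_0_l cos_0 Rmult_1_l; field.
    rewrite RInt_lin //.
    apply: Rle_trans (Rabs_triang _ _) _; rewrite !Rabs_mult (Rabs_pos_eq (/ 2)); lra.
  + have I2 : Rabs (RInt (fun x => g x * (cos_kernel N (x - th0) * cos (INR p * (x - th0)))) 0 (2 * PI)) <= 2 * d.
      by apply: IH => l Hl; apply: H; lia.
    rewrite (@RInt_extR _ (fun x => / 2 * (g x * (cos_kernel N (x - th0) * cos (INR p.+1 * (x - th0))))
       + / 4 * (1 * (g x * (cos_kernel N (x - th0) * cos (INR p.+2 * (x - th0))))
              + 1 * (g x * (cos_kernel N (x - th0) * cos (INR p * (x - th0))))))); last first.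
      move=> x; move: (x - th0) => y.
      have -> : INR p.+2 * y = INR p.+1 * y + y by rewrite (S_INR p.+1); ring.
      have -> : INR p * y = INR p.+1 * y - y by rewrite (S_INR p); ring.
      move: (INR p.+1 * y) => z.
      rewrite cos_plus cos_minus /cos_kernel -(tech_pow_Rmult _ N); field.
    rewrite RInt_lin //; last exact: ex_RInt_lin.
    rewrite RInt_lin //.
    apply: Rle_trans (Rabs_triang _ _) _; rewrite !Rabs_mult (Rabs_pos_eq (/ 2)); last lra.
    rewrite (Rabs_pos_eq (/ 4)); last lra.
    have := Rabs_triang (1 * RInt (fun x => g x * (cos_kernel N (x - th0) * cos (INR p.+2 * (x - th0)))) 0 (2 * PI))
      (1 * RInt (fun x => g x * (cos_kernel N (x - th0) * cos (INR p * (x - th0)))) 0 (2 * PI)).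
    rewrite !Rmult_1_l; lra.
Qed.

Lemma cos_kernel_ge0 N x : 0 <= cos_kernel N x.
Proof. by apply: pow_le; have := COS_bound x; lra. Qed.

Lemma ex_derive_cos_kernel N th0 x : ex_derive (fun x => cos_kernel N (x - th0)) x.
Proof. by rewrite /cos_kernel; auto_derive. Qed.

Lemma ex_RInt_ed (h : R -> R) a b : (forall x, ex_derive h x) -> ex_RInt h a b.
Proof. by move=> Hh; apply: ex_RInt_continuous => z _; exact: ex_derive_continuous. Qed.

Lemma cos_2PI_add x : cos (x + 2 * PI) = cos x.
Proof. by rewrite cos_plus cos_2PI sin_2PI; ring. Qed.

Lemma sin_2PI_add x : sin (x + 2 * PI) = sin x.
Proof. by rewrite sin_plus cos_2PI sin_2PI; ring. Qed.

(** [(sin K_N)' = K_N - (N + 1) (1 - cos) K_N], and the left side integrates to [0]: the mass of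
    the kernel concentrates where [cos = 1], at the rate [1 / (N + 1)]. *)
Lemma cos_kernel_conc N th0 :
  INR N.+1 * RInt (fun x => (1 - cos (x - th0)) * cos_kernel N (x - th0)) 0 (2 * PI)
  = RInt (fun x => cos_kernel N (x - th0)) 0 (2 * PI).
Proof.
pose h x := sin (x - th0) * cos_kernel N (x - th0).
pose h1 x := 1 * cos_kernel N (x - th0) + - INR N.+1 * ((1 - cos (x - th0)) * cos_kernel N (x - th0)).
have Dh x : is_derive h x (h1 x).
  have e : sin (x - th0) * sin (x - th0) = (1 - cos (x - th0)) * (1 + cos (x - th0)).
    by have := sin2_cos2 (x - th0); rewrite /Rsqr; lra.
  rewrite /h /h1 /cos_kernel; auto_derive => //; rewrite -/(Rminus x th0).
  case: N @h @h1 => [|N] h h1; first by rewrite /=; field.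
  rewrite S_INR Nat.pred_succ -tech_pow_Rmult -/(Rdiv (1 + cos (x - th0)) 2).
  move: (((1 + cos (x - th0)) / 2) ^ N) => q.
  have -> : sin (x - th0) * (1 * - sin (x - th0) * / 2 * ((INR N + 1) * q))
    = - (sin (x - th0) * sin (x - th0)) * / 2 * ((INR N + 1) * q) by ring.
  by rewrite e !S_INR; field.
have I1 : ex_RInt (fun x => cos_kernel N (x - th0)) 0 (2 * PI) by apply: ex_RInt_ed; exact: ex_derive_cos_kernel.
have I2 : ex_RInt (fun x => (1 - cos (x - th0)) * cos_kernel N (x - th0)) 0 (2 * PI).
  by apply: ex_RInt_ed => y; rewrite /cos_kernel; auto_derive.
have H : is_RInt h1 0 (2 * PI) (h (2 * PI) - h 0).
  apply: (is_RInt_derive h h1) => y _; first exact: Dh.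
  by apply: ex_derive_continuous; rewrite /h1 /cos_kernel; auto_derive.
have := is_RInt_unique _ _ _ _ H; rewrite RInt_lin //.
have -> : h (2 * PI) = h 0.
  rewrite /h /cos_kernel.
  have -> : 2 * PI - th0 = 0 - th0 + 2 * PI by ring.
  by have [-> ->] := (sin_2PI_add (0 - th0), cos_2PI_add (0 - th0)).
lra.
Qed.

(** By the concentration identity the mass loses at most half when [N] grows by one. *)
Lemma cos_kernel_mass N th0 : 2 * PI / 2 ^ N <= RInt (fun x => cos_kernel N (x - th0)) 0 (2 * PI).
Proof.
elim: N => [|N IH].
  by rewrite (@RInt_extR _ (fun _ => 1)) // RInt_const /scal /= /mult /=; lra.
have I1 : ex_RInt (fun x => cos_kernel N (x - th0)) 0 (2 * PI) by apply: ex_RInt_ed; exact: ex_derive_cos_kernel.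
have I2 : ex_RInt (fun x => (1 - cos (x - th0)) * cos_kernel N (x - th0)) 0 (2 * PI).
  by apply: ex_RInt_ed => y; rewrite /cos_kernel; auto_derive.
rewrite (@RInt_extR _ (fun x => 1 * cos_kernel N (x - th0) + - / 2 * ((1 - cos (x - th0)) * cos_kernel N (x - th0)))); last first.
  by move=> x; rewrite /cos_kernel -tech_pow_Rmult; field.
rewrite RInt_lin //.
have := cos_kernel_conc N th0.
have -> : 2 * PI / 2 ^ N.+1 = (2 * PI / 2 ^ N) / 2.
  by rewrite -tech_pow_Rmult; field; apply: pow_nonzero; lra.
move: IH; move: (RInt _ 0 (2 * PI)) => c; move: (RInt _ 0 (2 * PI)) => d IH H.
have p0 : 0 < 2 * PI / 2 ^ N.
  by apply: Rdiv_lt_0_compat; [exact: twopi_gt0|apply: pow_lt; lra].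
have N1 : 1 <= INR N.+1 by rewrite S_INR; have := pos_INR N; lra.
have : d <= c.
  case: (Rle_dec 0 d) => d0; last lra.
  by rewrite -H; nra.
lra.
Qed.

(** A quantitative form of the completeness of the trigonometric system, for equi-Lipschitz
    functions: finitely many Fourier coefficients determine the function up to [eps]. The
    average of [g] against the kernel is a combination of these coefficients, and it differs
    little from the value of [g] because the kernel concentrates. *)
Lemma small_modes (Lam eps : R) : 0 < Lam -> 0 < eps ->
  exists N delta, 0 < delta /\ forall g g1 : R -> R,
  (forall x, is_derive g x (g1 x)) -> (forall x, g (x + 2 * PI) = g x) ->
  (forall x, Rabs (g1 x) <= Lam) ->
  (forall l, le l N ->
     Rabs (RInt (fun x => g x * cos (INR l * x)) 0 (2 * PI)) <= delta /\
     Rabs (RInt (fun x => g x * sin (INR l * x)) 0 (2 * PI)) <= delta) ->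
  forall x, Rabs (g x) <= eps.
Proof.
move=> L0 e0; have PI0 := PI_RGT_0; have PI3 : 1 < PI by have := PI2_1; lra.
pose h := Rmin 1 (eps / (4 * Lam)).
have h0 : 0 < h by apply: Rmin_glb_lt; [lra|apply: Rdiv_lt_0_compat; lra].
have h1 : h <= 1 by exact: Rmin_l.
have hL : Lam * h <= eps / 4.
  have : h <= eps / (4 * Lam) by exact: Rmin_r.
  move=> /(Rmult_le_compat_l Lam _ _ (Rlt_le _ _ L0)).
  by have -> : Lam * (eps / (4 * Lam)) = eps / 4 by field; lra.
have ch : cos h < 1 by rewrite -cos_0; apply: cos_decreasing_1; lra.
pose K := Lam * PI / (1 - cos h).
have K0 : 0 < K by apply: Rdiv_lt_0_compat; [apply: Rmult_lt_0_compat|]; lra.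
have [N HN] : exists N, K / (eps / 4) <= INR N.
  by have [N HN] := INR_unbounded (K / (eps / 4)); exists N; lra.
pose delta := eps / 8 * (2 * PI / 2 ^ N).
have mass0 : 0 < 2 * PI / 2 ^ N.
  by apply: Rdiv_lt_0_compat; [exact: twopi_gt0|apply: pow_lt; lra].
exists N, delta; split; first by apply: Rmult_lt_0_compat; lra.
move=> g g1 Dg Pg Bg Hm.
have lip x y : Rabs (g x - g y) <= Lam * Rabs (x - y).
  have [c [_ ->]] : exists c, Rmin y x <= c <= Rmax y x /\ g x - g y = g1 c * (x - y).
    apply: MVT_gen => z _; first exact: Dg.
    by apply/continuity_pt_filterlim; apply: ex_derive_continuous; eexists; exact: Dg.
  by rewrite Rabs_mult; apply: Rmult_le_compat_r => //; exact: Rabs_pos.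
(* The kernel is only controlled through [int (1 - cos) K]; so [|g x - g y|] is bounded by
   [eps / 4] near the diagonal and by a multiple of [1 - cos (x - y)] away from it. *)
have modc x y : Rabs (x - y) <= PI -> Rabs (g x - g y) <= eps / 4 + K * (1 - cos (x - y)).
  move=> Hxy; have := COS_bound (x - y) => -[_ c1].
  case: (Rle_dec (Rabs (x - y)) h) => Hh.
    apply: Rle_trans (lip x y) _.
    have := Rmult_le_compat_l _ _ _ (Rlt_le _ _ L0) Hh.
    by have : 0 <= K * (1 - cos (x - y)) by [apply: Rmult_le_pos; lra]; lra.
  have {}Hh : h < Rabs (x - y) by lra.
  have Hcos : cos (x - y) <= cos h.
    have -> : cos (x - y) = cos (Rabs (x - y)) by rewrite /Rabs; case: Rcase_abs => // _; rewrite cos_neg.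
    by apply: Rlt_le; apply: cos_decreasing_1; lra.
  apply: (Rle_trans _ (Lam * PI)).
    by apply: Rle_trans (lip x y) _; apply: Rmult_le_compat_l; lra.
  have : K * (1 - cos h) <= K * (1 - cos (x - y)) by apply: Rmult_le_compat_l; lra.
  by have -> : K * (1 - cos h) = Lam * PI by [rewrite /K; field; lra]; lra.
have modc2 x y : 0 <= x <= 2 * PI -> 0 <= y <= 2 * PI ->
    Rabs (g x - g y) <= eps / 4 + K * (1 - cos (x - y)).
  move=> Hx Hy.
  case: (Rle_dec (x - y) PI) => H1; last first.
    rewrite -(Pg y); have -> : cos (x - y) = cos (x - (y + 2 * PI)).
      by rewrite -(cos_2PI_add (x - (y + 2 * PI))); congr cos; ring.
    by apply: modc; apply: Rabs_le; lra.
  case: (Rle_dec (- PI) (x - y)) => H2; first by apply: modc; apply: Rabs_le; lra.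
  rewrite -(Pg x); have -> : cos (x - y) = cos (x + 2 * PI - y).
    by rewrite -(cos_2PI_add (x - y)); congr cos; ring.
  by apply: modc; apply: Rabs_le; lra.
move=> x; have [y [Hy <-]] := periodic_reduce Pg x => {x}.
have Cg z : continuous g z by apply: ex_derive_continuous; eexists; exact: Dg.
set c := RInt (fun x => cos_kernel N (x - y)) 0 (2 * PI).
have c0 : 2 * PI / 2 ^ N <= c by exact: cos_kernel_mass.
have I1 : ex_RInt (fun x => cos_kernel N (x - y)) 0 (2 * PI) by apply: ex_RInt_ed; exact: ex_derive_cos_kernel.
have I2 : ex_RInt (fun x => (1 - cos (x - y)) * cos_kernel N (x - y)) 0 (2 * PI).
  by apply: ex_RInt_ed => z; rewrite /cos_kernel; auto_derive.
have I3 : ex_RInt (fun x => g x * cos_kernel N (x - y)) 0 (2 * PI).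
  by apply: ex_RInt_cd => //; exact: ex_derive_cos_kernel.
have d0 : 0 <= delta by apply: Rmult_le_pos; lra.
have small : Rabs (RInt (fun x => g x * cos_kernel N (x - y)) 0 (2 * PI)) <= 2 * delta.
  have H := @cos_kernel_mode g delta Cg d0 N 0%N y.
  rewrite (@RInt_extR _ (fun x => g x * (cos_kernel N (x - y) * cos (INR 0 * (x - y))))).
    by apply: H => l Hl; apply: Hm; lia.
  by move=> x; rewrite /= Rmult_0_l cos_0 Rmult_1_r.
have conc := cos_kernel_conc N y; rewrite -/c in conc.
set d := RInt (fun x => (1 - cos (x - y)) * cos_kernel N (x - y)) 0 (2 * PI) in conc.
have Kd : K * d <= eps / 4 * c.
  have dn : 0 <= d.
    apply: RInt_ge_0 => //; first exact: Rlt_le twopi_gt0.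
    move=> x _; apply: Rmult_le_pos (cos_kernel_ge0 _ _); have := COS_bound (x - y); lra.
  have K1 : K <= INR N.+1 * (eps / 4).
    have : K / (eps / 4) * (eps / 4) <= INR N * (eps / 4) by apply: Rmult_le_compat_r; lra.
    have -> : K / (eps / 4) * (eps / 4) = K by field; lra.
    by rewrite S_INR; lra.
  have := Rmult_le_compat_r _ _ _ dn K1.
  by rewrite -conc; lra.
have bound s : s = 1 \/ s = - 1 -> s * g y * c <= s * RInt (fun x => g x * cos_kernel N (x - y)) 0 (2 * PI) + (eps / 4 * c + K * d).
  move=> Hs.
  have H : RInt (fun x => (s * g y) * cos_kernel N (x - y) + 0 * cos_kernel N (x - y)) 0 (2 * PI) <=
    RInt (fun x => s * (g x * cos_kernel N (x - y)) + 1 * (eps / 4 * cos_kernel N (x - y) + K * ((1 - cos (x - y)) * cos_kernel N (x - y)))) 0 (2 * PI).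
    apply: RInt_le; first exact: Rlt_le twopi_gt0.
    - exact: ex_RInt_lin.
    - by apply: ex_RInt_lin => //; exact: ex_RInt_lin.
    - move=> x Hx.
      have Hx' : 0 <= x <= 2 * PI by lra.
      have := modc2 x y Hx' Hy.
      have k0 := cos_kernel_ge0 N (x - y).
      move=> /(Rmult_le_compat_r _ _ _ k0).
      have : s * (g y - g x) <= Rabs (g x - g y).
        rewrite -Rabs_Ropp; case: Hs => ->.
          by apply: Rle_trans (Rle_abs _); lra.
        by rewrite Rabs_Ropp; apply: Rle_trans (Rle_abs _); lra.
      by move=> /(Rmult_le_compat_r _ _ _ k0); lra.
  rewrite !RInt_lin // in H; last exact: ex_RInt_lin.
  by rewrite -/c -/d in H; lra.
have b1 := bound 1 (or_introl erefl); have b2 := bound (-1) (or_intror erefl).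
have s1 := Rle_trans _ _ _ (Rle_abs _) small.
have s2 : - RInt (fun x => g x * cos_kernel N (x - y)) 0 (2 * PI) <= 2 * delta.
  by rewrite -Rabs_Ropp in small; exact: Rle_trans (Rle_abs _) small.
have dc : 2 * delta <= eps / 4 * c.
  by rewrite /delta; have := Rmult_le_compat_l (eps / 4) _ _ (ltac:(lra)) c0; lra.
have cp : 0 < c by lra.
apply: Rabs_le; split; apply: (Rmult_le_reg_r c) => //; nra.
Qed.

(** * The equations of the Fourier modes *)

(** A growth bound [C exp (mu T)] that is known only at some point within distance [W] of [T]:
    this is what an integral bound on every cell provides. The index from which the bound holds
    may depend on [T]. *)
Definition sampled_growth (mu : R) (b : nat -> R -> R) : Prop :=
  exists W C, forall T, eventually (fun k =>
    exists s, Rabs (s - T) <= W /\ Rabs (b k s) <= C * exp (mu * T)).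

Definition vanish_loc (b : nat -> R -> R) : Prop :=
  forall a, 0 < a -> forall eps, 0 < eps ->
  eventually (fun k => forall t, Rabs t <= a -> Rabs (b k t) <= eps).

Definition ev_derive (b b1 : nat -> R -> R) : Prop :=
  forall a, 0 < a -> eventually (fun k => forall t, Rabs t < a -> is_derive (b k) t (b1 k t)).

Lemma mvt (f f1 : R -> R) a s t : Rabs s < a -> Rabs t < a ->
  (forall x, Rabs x < a -> is_derive f x (f1 x)) ->
  exists c, Rmin s t <= c <= Rmax s t /\ f t - f s = f1 c * (t - s).
Proof.
move=> Hs Ht H.
have Hx x : Rmin s t <= x <= Rmax s t -> Rabs x < a.
  move: Hs Ht => /Rabs_def2 Hs /Rabs_def2 Ht.
  by rewrite /Rmin /Rmax; case: Rle_dec => _ Hx; apply: Rabs_def1; lra.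
apply: MVT_gen => x Hx'; first by apply: H; apply: Hx; lra.
by apply/continuity_pt_filterlim; apply: ex_derive_continuous; eexists; apply: H; apply: Hx.
Qed.

Lemma between_strip s t c a : Rabs s < a -> Rabs t < a -> Rmin s t <= c <= Rmax s t -> Rabs c < a.
Proof.
move=> /Rabs_def2 Hs /Rabs_def2 Ht.
by rewrite /Rmin /Rmax; case: Rle_dec => _ Hx; apply: Rabs_def1; lra.
Qed.

Lemma exp_le_abs l x M : Rabs x <= M -> exp (l * x) <= exp (Rabs l * M).
Proof.
move=> H; have : l * x <= Rabs l * M.
  apply: Rle_trans (Rle_abs _) _; rewrite Rabs_mult.
  by apply: Rmult_le_compat_l => //; exact: Rabs_pos.
by case=> [h|->]; [apply: Rlt_le; exact: exp_increasing|lra].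
Qed.

Lemma is_derive_expmul (b : R -> R) b1 l t : is_derive b t b1 ->
  is_derive (fun t => exp (l * t) * b t) t (exp (l * t) * (l * b t + b1)).
Proof.
move=> H.
have He : is_derive (fun t => exp (l * t)) t (l * exp (l * t)) by auto_derive => //; ring.
have := is_derive_mult _ _ _ _ _ He H Rmult_comm; rewrite /plus /mult /=.
have -> : l * exp (l * t) * b t + exp (l * t) * b1 = exp (l * t) * (l * b t + b1) by ring.
by [].
Qed.

(** [exp (- l t) b] has the derivative [exp (- l t) r]. *)
Lemma propagate_diff l a (b r : R -> R) s t d : Rabs s < a -> Rabs t < a ->
  (forall x, Rabs x < a -> is_derive b x (l * b x + r x)) ->
  (forall x, Rabs x < a -> Rabs (r x) <= d) ->
  Rabs (exp (- l * t) * b t - exp (- l * s) * b s) <= exp (Rabs l * a) * d * (2 * a).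
Proof.
move=> Hs Ht Hb Hr.
have D x : Rabs x < a -> is_derive (fun t => exp (- l * t) * b t) x (exp (- l * x) * r x).
  move=> Hx; have := is_derive_expmul (- l) (Hb x Hx).
  by have -> : - l * b x + (l * b x + r x) = r x by ring.
have [c [Hc ->]] := mvt Hs Ht D.
have Hca := between_strip Hs Ht Hc.
rewrite !Rabs_mult; apply: Rmult_le_compat; try exact: Rabs_pos.
- by rewrite -Rabs_mult; exact: Rabs_pos.
- apply: Rmult_le_compat; try exact: Rabs_pos; last exact: Hr.
  rewrite Rabs_pos_eq; last exact: Rlt_le (exp_pos _).
  by rewrite -(Rabs_Ropp l); apply: exp_le_abs; lra.
- by apply: Rabs_le; move: Hs Ht => /Rabs_def2 Hs /Rabs_def2 Ht; lra.
Qed.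

Lemma propagate l a (b r : R -> R) s t d : Rabs s < a -> Rabs t < a ->
  (forall x, Rabs x < a -> is_derive b x (l * b x + r x)) ->
  (forall x, Rabs x < a -> Rabs (r x) <= d) ->
  Rabs (exp (- l * t) * b t) <= Rabs (exp (- l * s) * b s) + exp (Rabs l * a) * d * (2 * a).
Proof.
move=> Hs Ht Hb Hr; have H := propagate_diff Hs Ht Hb Hr.
have := Rabs_triang (exp (- l * s) * b s) (exp (- l * t) * b t - exp (- l * s) * b s).
have -> : exp (- l * s) * b s + (exp (- l * t) * b t - exp (- l * s) * b s) = exp (- l * t) * b t by ring.
lra.
Qed.

Lemma unweight l a t x y : Rabs t <= a -> Rabs (exp (- l * t) * x) <= y ->
  Rabs x <= exp (Rabs l * a) * y.
Proof.
move=> Ht H.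
have -> : x = exp (l * t) * (exp (- l * t) * x).
  by rewrite -Rmult_assoc -exp_plus; have -> : l * t + - l * t = 0 by [ring]; rewrite exp_0; ring.
rewrite Rabs_mult; apply: Rmult_le_compat; try exact: Rabs_pos; last exact: H.
rewrite Rabs_pos_eq; last exact: Rlt_le (exp_pos _).
exact: exp_le_abs.
Qed.

Lemma first_order_from l b r tau : ev_derive b (fun k t => l * b k t + r k t) -> vanish_loc r ->
  (forall eps, 0 < eps -> eventually (fun k => Rabs (b k tau) <= eps)) -> vanish_loc b.
Proof.
move=> D V B a Ha eps He.
pose M := a + Rabs tau + 1.
have ta := Rabs_pos tau.
have M0 : 0 < M by rewrite /M; lra.
have Ex := exp_pos (Rabs l * M).
pose d := eps / (2 * exp (Rabs l * M) * (exp (Rabs l * M) * (2 * M))).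
have d0 : 0 < d.
  by apply: Rdiv_lt_0_compat => //; repeat apply: Rmult_lt_0_compat => //; lra.
pose d' := eps / (2 * exp (Rabs l * M) * exp (Rabs l * M)).
have d0' : 0 < d' by apply: Rdiv_lt_0_compat => //; repeat apply: Rmult_lt_0_compat => //; lra.
apply: filter_imp (filter_and _ _ (D M M0) (filter_and _ _ (V M M0 d d0) (B d' d0'))) => k [H1 [H2 H3]] t Ht.
have Hs : Rabs tau < M by rewrite /M; lra.
have Ht' : Rabs t < M by rewrite /M; lra.
have H2' x : Rabs x < M -> Rabs (r k x) <= d by move=> Hx; apply: H2; lra.
have P := propagate Hs Ht' H1 H2'.
have {}P := unweight (Rlt_le _ _ Ht') P.
apply: Rle_trans P _.
apply: (Rle_trans _ (exp (Rabs l * M) * (exp (Rabs l * M) * d' + exp (Rabs l * M) * d * (2 * M)))).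
  apply: Rmult_le_compat_l; first lra.
  apply: Rplus_le_compat_r; rewrite Rabs_mult.
  apply: Rmult_le_compat => //; try exact: Rabs_pos.
  rewrite Rabs_pos_eq; last exact: Rlt_le (exp_pos _).
  by rewrite -(Rabs_Ropp l); apply: exp_le_abs; lra.
by right; rewrite /d /d'; field; split; [lra|]; apply: Rgt_not_eq.
Qed.

(** The weighted function [exp (- l t) b] is nearly constant, and it is at most
    [C exp ((mu - l) T)] near [T]. As [l] and [mu] differ, this is small for [T] large of one sign. *)
Lemma first_order mu l b r : l <> mu -> ev_derive b (fun k t => l * b k t + r k t) ->
  vanish_loc r -> sampled_growth mu b -> vanish_loc b.
Proof.
move=> lmu D V [W [C P]] a Ha eps He.
have W0 : 0 <= W.
  have [N /(_ N (Nat.le_refl _)) [s [Hs _]]] := P 0.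
  by apply: Rle_trans Hs; exact: Rabs_pos.
pose A := exp (Rabs l * a) * (exp (Rabs l * W) * (Rabs C + 1)).
have A0 : 0 < A.
  have := Rabs_pos C => HC.
  by repeat apply: Rmult_lt_0_compat; try exact: exp_pos; lra.
have [T HT] : exists T, A * exp (- l * T) * exp (mu * T) <= eps / 2.
  have n0 : mu - l <> 0 by lra.
  pose x := 2 * A / eps.
  have x0 : 0 < x by apply: Rdiv_lt_0_compat; lra.
  exists (- x / (mu - l)); rewrite Rmult_assoc -exp_plus.
  have -> : - l * (- x / (mu - l)) + mu * (- x / (mu - l)) = - x by field.
  rewrite exp_Ropp; have := exp_ineq1 x (Rgt_not_eq _ _ x0) => hx.
  apply: (Rmult_le_reg_r (exp x)); first exact: exp_pos.
  rewrite Rmult_assoc Rinv_l; last exact: Rgt_not_eq (exp_pos _).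
  have E : A = eps / 2 * x by rewrite /x; field; lra.
  have : eps / 2 * x <= eps / 2 * exp x by apply: Rmult_le_compat_l; lra.
  lra.
pose M := a + Rabs T + W + 1.
have M0 : 0 < M by have := Rabs_pos T; rewrite /M; lra.
have Ex := exp_pos (Rabs l * M).
have Exa := exp_pos (Rabs l * a).
pose d := eps / (2 * exp (Rabs l * a) * (exp (Rabs l * M) * (2 * M))).
have d0 : 0 < d.
  by apply: Rdiv_lt_0_compat => //; repeat apply: Rmult_lt_0_compat => //; lra.
apply: filter_imp (filter_and _ _ (D M M0) (filter_and _ _ (V M M0 d d0) (P T))) => k [H1 [H2 [s [Hs1 Hs2]]]] t Ht.
have Hs : Rabs s < M.
  have := Rabs_triang (s - T) T; have -> : s - T + T = s by ring.
  by rewrite /M; lra.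
have Ht' : Rabs t < M by have := Rabs_pos T; rewrite /M; lra.
have H2' x : Rabs x < M -> Rabs (r k x) <= d by move=> Hx; apply: H2; lra.
have P1 := propagate Hs Ht' H1 H2'.
have {}P1 := unweight Ht P1.
apply: Rle_trans P1 _.
have -> : eps = eps / 2 + eps / 2 by lra.
rewrite Rmult_plus_distr_l; apply: Rplus_le_compat; last first.
  by right; rewrite /d; field; repeat split; apply: Rgt_not_eq.
apply: Rle_trans HT; rewrite /A !Rmult_assoc; apply: Rmult_le_compat_l; first lra.
rewrite Rabs_mult (Rabs_pos_eq (exp _)); last exact: Rlt_le (exp_pos _).
have e1 : exp (- l * s) <= exp (Rabs l * W) * exp (- l * T).
  have -> : - l * s = - l * (s - T) + - l * T by ring.
  rewrite exp_plus; apply: Rmult_le_compat_r; first exact: Rlt_le (exp_pos _).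
  by rewrite -(Rabs_Ropp l); exact: exp_le_abs.
have e2 : Rabs (b k s) <= (Rabs C + 1) * exp (mu * T).
  apply: Rle_trans Hs2 _; apply: Rmult_le_compat_r; first exact: Rlt_le (exp_pos _).
  by have := Rle_abs C; lra.
apply: Rle_trans (Rmult_le_compat _ _ _ _ (Rlt_le _ _ (exp_pos _)) (Rabs_pos _) e1 e2) _.
by right; ring.
Qed.

(** The mean value theorem for [exp (l t) a], whose derivative is [exp (l t) (a' + l a)], between
    sampling points on both sides of [T]; no bound of [a'] alone is available. *)
Lemma sampled_growth_derive mu l a a1 : ev_derive a a1 -> sampled_growth mu a ->
  sampled_growth mu (fun k t => a1 k t + l * a k t).
Proof.
move=> D [W [C P]].
have W0 : 0 <= W.
  have [N /(_ N (Nat.le_refl _)) [s [Hs _]]] := P 0.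
  by apply: Rle_trans Hs; exact: Rabs_pos.
pose W' := 2 * W + 1.
exists W', (exp (Rabs l * W') * (exp (Rabs l * W') * (Rabs C * exp (Rabs mu * (W + 1))))) => T.
pose M := Rabs T + W' + 1.
have M0 : 0 < M by have := Rabs_pos T; rewrite /M /W'; lra.
apply: filter_imp (filter_and _ _ (D M M0) (filter_and _ _ (P (T - (W + 1))) (P (T + (W + 1))))).
move=> k [Dk [[s1 [h1 g1]] [s2 [h2 g2]]]].
have {}h1 : - W <= s1 - (T - (W + 1)) <= W by exact/Rabs_le_between.
have {}h2 : - W <= s2 - (T + (W + 1)) <= W by exact/Rabs_le_between.
have r1 : Rabs (s1 - T) <= W' by apply: Rabs_le; rewrite /W'; lra.
have r2 : Rabs (s2 - T) <= W' by apply: Rabs_le; rewrite /W'; lra.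
have inM s : Rabs (s - T) <= W' -> Rabs s < M.
  move=> H; have := Rabs_triang (s - T) T; have -> : s - T + T = s by ring.
  by rewrite /M; lra.
pose B := exp (Rabs l * W') * (Rabs C * exp (Rabs mu * (W + 1)) * exp (mu * T)).
have weighted s S0 : Rabs (s - T) <= W' -> Rabs (S0 - T) <= W + 1 -> Rabs (a k s) <= C * exp (mu * S0) ->
    Rabs (exp (l * s) * a k s) <= exp (l * T) * B.
  move=> q1 q2 q3; rewrite Rabs_mult (Rabs_pos_eq (exp _)); last exact: Rlt_le (exp_pos _).
  have -> : exp (l * T) * B = (exp (Rabs l * W') * exp (l * T)) * (Rabs C * (exp (Rabs mu * (W + 1)) * exp (mu * T))).
    by rewrite /B; ring.
  apply: Rmult_le_compat; [exact: Rlt_le (exp_pos _)|exact: Rabs_pos| |].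
  - have -> : l * s = l * (s - T) + l * T by ring.
    rewrite exp_plus; apply: Rmult_le_compat_r; first exact: Rlt_le (exp_pos _).
    exact: exp_le_abs.
  - apply: Rle_trans q3 _.
    apply: (Rle_trans _ (Rabs C * exp (mu * S0))).
      by apply: Rmult_le_compat_r; [exact: Rlt_le (exp_pos _)|exact: Rle_abs].
    apply: Rmult_le_compat_l; first exact: Rabs_pos.
    have -> : mu * S0 = mu * (S0 - T) + mu * T by ring.
    rewrite exp_plus; apply: Rmult_le_compat_r; first exact: Rlt_le (exp_pos _).
    exact: exp_le_abs.
have B1 := weighted s1 _ r1 _ g1; have B2 := weighted s2 _ r2 _ g2.
have {}B1 : Rabs (exp (l * s1) * a k s1) <= exp (l * T) * B.
  by apply: B1; apply: Rabs_le; lra.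
have {}B2 : Rabs (exp (l * s2) * a k s2) <= exp (l * T) * B.
  by apply: B2; apply: Rabs_le; lra.
have [c [Hc E]] := mvt (inM _ r1) (inM _ r2) (fun x Hx => is_derive_expmul l (Dk x Hx)).
have rc : Rabs (c - T) <= W'.
  by move: Hc; rewrite /W' Rmin_left ?Rmax_right; try lra; move=> Hc; apply: Rabs_le; lra.
exists c; split=> //.
have d2 : 2 <= s2 - s1 by lra.
have key : Rabs (exp (l * c) * (l * a k c + a1 k c)) <= exp (l * T) * B.
  apply: (Rmult_le_reg_r 2); first lra.
  apply: (Rle_trans _ (Rabs (exp (l * c) * (l * a k c + a1 k c)) * (s2 - s1))).
    by apply: Rmult_le_compat_l => //; exact: Rabs_pos.
  have -> : Rabs (exp (l * c) * (l * a k c + a1 k c)) * (s2 - s1)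
     = Rabs (exp (l * c) * (l * a k c + a1 k c) * (s2 - s1)).
    by rewrite (Rabs_mult _ (s2 - s1)) (Rabs_pos_eq (s2 - s1)) //; lra.
  rewrite -E.
  have := Rabs_triang (exp (l * s2) * a k s2) (- (exp (l * s1) * a k s1)).
  rewrite Rabs_Ropp /Rminus; lra.
have -> : a1 k c + l * a k c = exp (- l * c) * (exp (l * c) * (l * a k c + a1 k c)).
  by rewrite -Rmult_assoc -exp_plus; have -> : - l * c + l * c = 0 by [ring]; rewrite exp_0; ring.
rewrite Rabs_mult (Rabs_pos_eq (exp _)); last exact: Rlt_le (exp_pos _).
apply: Rle_trans (Rmult_le_compat_l _ _ _ (Rlt_le _ _ (exp_pos _)) key) _.
rewrite -Rmult_assoc -exp_plus.
have -> : - l * c + l * T = - l * (c - T) by ring.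
rewrite /B !Rmult_assoc; apply: Rmult_le_compat_r.
  repeat apply: Rmult_le_pos; try exact: Rlt_le (exp_pos _); exact: Rabs_pos.
by rewrite -(Rabs_Ropp l); exact: exp_le_abs.
Qed.

Lemma ev_derive_ext b b1 b1' : ev_derive b b1 -> (forall k t, b1 k t = b1' k t) -> ev_derive b b1'.
Proof.
by move=> D E a Ha; apply: filter_imp (D a Ha) => k H t Ht; rewrite -E; exact: H.
Qed.

(** [a'' = l^2 a + r] factors into two equations of first order, with the exponents [l] and [- l].
    An exponent other than [mu] admits no homogeneous solution of growth [exp (mu t)]; the
    exponent [mu] is excluded by the value of [a' + mu a] at [tau]. *)
Lemma mode_vanish mu l a a1 r tau : ev_derive a a1 ->
  ev_derive a1 (fun k t => l ^ 2 * a k t + r k t) -> vanish_loc r -> sampled_growth mu a ->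
  (l ^ 2 <> mu ^ 2 \/ (mu <> 0 /\ l ^ 2 = mu ^ 2 /\ eventually (fun k => a1 k tau + mu * a k tau = 0))) ->
  vanish_loc a.
Proof.
move=> D1 D2 V P.
have Db s : s ^ 2 = l ^ 2 -> ev_derive (fun k t => a1 k t + s * a k t)
    (fun k t => s * (a1 k t + s * a k t) + r k t).
  move=> Hs x Hx; apply: filter_imp (filter_and _ _ (D1 x Hx) (D2 x Hx)) => k [h1 h2] t Ht.
  have -> : s * (a1 k t + s * a k t) + r k t = plus (l ^ 2 * a k t + r k t) (scal s (a1 k t)).
    by rewrite -Hs /plus /scal /= /mult /=; ring.
  by apply: (is_derive_plus (a1 k)); [exact: h2|apply: is_derive_scal; exact: h1].
have fin s : s ^ 2 = l ^ 2 -> - s <> mu -> vanish_loc (fun k t => a1 k t + s * a k t) -> vanish_loc a.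
  move=> Hs ns Vb; apply: (first_order ns _ Vb P).
  by apply: ev_derive_ext D1 _ => k t; ring.
case=> [n|[mu0 [E B]]].
- have nl : l <> mu by move=> E; apply: n; rewrite E.
  have nl' : - l <> mu by move=> E; apply: n; rewrite -E; ring.
  apply: (fin l) => //; apply: first_order nl (Db l erefl) V _.
  exact: sampled_growth_derive.
- apply: (fin mu) => //; first lra.
  apply: (first_order_from (Db mu (esym E)) V (tau := tau)) => eps He.
  by apply: filter_imp B => k ->; rewrite Rabs_R0; lra.
Qed.

Definition trig (i : bool) (c z : R) : R := if i then cos (c * z) else sin (c * z).

Definition fourier (X : R -> R -> R) (i : bool) (c t : R) : R := circ_int (fun s z => X s z * trig i c z) t.

Lemma tame_trig' i c : tame (fun _ z => trig i c z).
Proof. exact: tame_trig. Qed.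

Lemma smooth_on_tame D G : tame G -> smooth_on D G.
Proof. by move=> [_ [S _]]; apply: smooth_on_sub S. Qed.

Lemma smooth_on_trig D i c : smooth_on D (fun _ z => trig i c z).
Proof. exact: smooth_on_tame (tame_trig' i c). Qed.

Lemma trig_bound i c z : -1 <= trig i c z <= 1.
Proof. by case: i; [apply: COS_bound|apply: SIN_bound]. Qed.

Lemma trig_periodic i (m : nat) z : trig i (INR m) (z + 2 * PI) = trig i (INR m) z.
Proof.
have -> : trig i (INR m) (z + 2 * PI) = if i then cos (INR m * z + 2 * INR m * PI) else sin (INR m * z + 2 * INR m * PI).
  by rewrite /trig; have -> : INR m * (z + 2 * PI) = INR m * z + 2 * INR m * PI by ring.
by rewrite cos_period sin_period.
Qed.

Lemma partial_t_trig F i c t z : ex_partial false F t z ->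
  partial false (fun s z => F s z * trig i c z) t z = partial false F t z * trig i c z.
Proof.
move=> H; rewrite partial_mult //; last exact: ex_derive_const.
have -> : partial false (fun _ z => trig i c z) t z = 0 by rewrite /= Derive_const.
ring.
Qed.

Lemma fourier_derive D X i c t : open_dom D -> smooth_on D X -> D t ->
  is_derive (fourier X i c) t (fourier (partial false X) i c t).
Proof.
move=> oD S Dt; have H := circ_int_derive oD (smooth_on_mult oD S (smooth_on_trig D i c)) Dt.
have E : circ_int (partial false (fun s z => X s z * trig i c z)) t = fourier (partial false X) i c t.
  by apply: circ_int_ext => z; rewrite partial_t_trig //; exact: smooth_on_ex S Dt.
by rewrite -E.
Qed.

(** Two integrations by parts over the circle turn the equation for [X] into the equation
    [a'' = l^2 a + r] for each of its Fourier coefficients. *)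
Lemma fourier_lap D X i (m : nat) t : open_dom D -> smooth_on D X -> periodic_on D X -> D t ->
  fourier (partial false (partial false X)) i (INR m) t
  = INR m ^ 2 * fourier X i (INR m) t + fourier (lap X) i (INR m) t.
Proof.
move=> oD S P Dt; set c := INR m.
have St := smooth_on_partial false (smooth_on_partial false S).
have Sh := smooth_on_partial true S; have Shh := smooth_on_partial true Sh.
have Ph := periodic_partial true oD S P.
have ST j := smooth_on_trig D j c.
have PT j : periodic_on D (fun _ z => trig j c z) by move=> s z _; exact: trig_periodic.
have dT j s z : partial true (fun _ z => trig j c z) s z = (if j then - c else c) * trig (~~ j) c z.
  by case: j; apply: is_derive_unique; rewrite /trig; auto_derive => //=; ring.
have E : fourier (partial true (partial true X)) i c t = - c ^ 2 * fourier X i c t.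
  rewrite /fourier.
  have p1 := circ_int_parts oD (ST i) Sh (PT i) Ph Dt.
  have p2 := circ_int_parts oD (ST (~~ i)) S (PT (~~ i)) P Dt.
  have e1 : circ_int (fun s z => partial true (partial true X) s z * trig i c z) t
     = circ_int (fun s z => trig i c z * partial true (partial true X) s z) t by apply: circ_int_ext => z; ring.
  rewrite e1 p1.
  have e2 : circ_int (fun s z => partial true (fun _ z => trig i c z) s z * partial true X s z) t
     = (if i then - c else c) * circ_int (fun s z => trig (~~ i) c z * partial true X s z) t.
    rewrite -(circ_int_scal (D := D)) //; last exact: smooth_on_mult (ST _) Sh.
    by apply: circ_int_ext => z; rewrite dT; ring.
  have e3 : circ_int (fun s z => partial true (fun _ z => trig (~~ i) c z) s z * X s z) t
     = (if ~~ i then - c else c) * circ_int (fun s z => X s z * trig i c z) t.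
    rewrite -(circ_int_scal (D := D)) //; last exact: smooth_on_mult S (ST _).
    by apply: circ_int_ext => z; rewrite dT negbK; ring.
  by rewrite e2 p2 e3; case: (i) => /=; ring.
have -> : fourier (lap X) i c t = fourier (partial false (partial false X)) i c t
   + fourier (partial true (partial true X)) i c t.
  rewrite /fourier -(circ_int_plus (D := D)) //; try exact: smooth_on_mult.
  by apply: circ_int_ext => z; rewrite /lap; ring.
rewrite E; ring.
Qed.

Lemma fourier_abs_le D X i c t K : open_dom D -> smooth_on D X -> D t -> (forall z, Rabs (X t z) <= K) ->
  Rabs (fourier X i c t) <= 2 * PI * K.
Proof.
move=> oD S Dt H; have ST := smooth_on_mult oD S (smooth_on_trig D i c).
have b z : Rabs (X t z * trig i c z) <= K.
  have h := trig_bound i c z; rewrite Rabs_mult -(Rmult_1_r K).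
  by apply: Rmult_le_compat; try exact: Rabs_pos; [exact: H|apply: Rabs_le].
have b' z : - K <= X t z * trig i c z <= K by apply/Rabs_le_between; exact: b.
rewrite -(circ_int_const K t); apply: Rabs_le; split.
- have -> : - circ_int (fun _ _ => K) t = circ_int (fun _ _ => - K) t by rewrite !circ_int_const; ring.
  by apply: (circ_int_le (smooth_on_const D _) ST Dt) => z; have := b' z; lra.
- by apply: (circ_int_le ST (smooth_on_const D _) Dt) => z; have := b' z; lra.
Qed.

(** Young's inequality [|x| <= w / 2 + x^2 / (2 w)] with a free weight: for [w] of the size
    [exp (mu t)] it turns a bound of the energy by [exp (2 mu t)] into one of the coefficient by
    [exp (mu t)]. *)
Lemma fourier_sq_le D X i c t w : open_dom D -> smooth_on D X -> D t -> 0 < w ->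
  Rabs (fourier X i c t) <= PI * w + circ_int (sq X) t / (2 * w).
Proof.
move=> oD S Dt k0; have ST := smooth_on_mult oD S (smooth_on_trig D i c).
have SQ := smooth_on_sq oD S.
have k20 : 0 < / (2 * w) by apply: Rinv_0_lt_compat; lra.
have b z : Rabs (X t z * trig i c z) <= w / 2 + / (2 * w) * sq X t z.
  have h := trig_bound i c z; rewrite Rabs_mult.
  apply: (Rle_trans _ (Rabs (X t z) * 1)).
    by apply: Rmult_le_compat_l; [exact: Rabs_pos|apply: Rabs_le].
  apply: (Rmult_le_reg_l (2 * w)); first lra.
  have -> : 2 * w * (w / 2 + / (2 * w) * sq X t z) = w ^ 2 + sq X t z by field; lra.
  rewrite /sq -(pow2_abs (X t z)); have := pow2_ge_0 (w - Rabs (X t z)); lra.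
have b' z : - (w / 2 + / (2 * w) * sq X t z) <= X t z * trig i c z <= w / 2 + / (2 * w) * sq X t z.
  by apply/Rabs_le_between; exact: b.
have SB := smooth_on_plus oD (smooth_on_const D (w / 2)) (smooth_on_scal (/ (2 * w)) oD SQ).
have E : circ_int (fun s z => w / 2 + / (2 * w) * sq X s z) t = PI * w + circ_int (sq X) t / (2 * w).
  rewrite (circ_int_plus (smooth_on_const D _) (smooth_on_scal _ oD SQ) Dt) (circ_int_scal _ SQ Dt) circ_int_const; field; lra.
rewrite -E; apply: Rabs_le; split.
- have -> : - circ_int (fun s z => w / 2 + / (2 * w) * sq X s z) t
     = circ_int (fun s z => -1 * (w / 2 + / (2 * w) * sq X s z)) t by rewrite (circ_int_scal _ SB Dt); ring.
  by apply: (circ_int_le (smooth_on_scal _ oD SB) ST Dt) => z; have := b' z; lra.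
- by apply: (circ_int_le ST SB Dt) => z; have := b' z; lra.
Qed.

(** * A Liouville theorem for sequences *)

(** A harmonic function on the cylinder that is [O (exp (mu t))] in both directions is a multiple of
    the mode [exp (mu t)], here excluded at [tau]. For a sequence with Laplacian tending to [0]:
    every Fourier coefficient tends to [0], the interior estimates make the functions
    equi-Lipschitz, hence they tend to [0] uniformly, and again by the interior estimates with
    all derivatives. *)
Lemma liouville (mu tau : R) (m : nat) (D : funseq) : mu <> 0 -> mu ^ 2 = INR m ^ 2 ->
  almost_harmonic bounded_seq D ->
  (exists W C, forall T, eventually (fun k => exists s, Rabs (s - T) <= W /\
     circ_int (sq (D k)) s <= C * exp (2 * mu * T))) ->
  (forall i, eventually (fun k =>
     fourier (partial false (D k)) i (INR m) tau + mu * fourier (D k) i (INR m) tau = 0)) ->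
  converges D (fun _ _ => 0).
Proof.
move=> mu0 mum HD [W [C HP]] HB.
have [E P _ L] := HD.
have PI0 := PI_RGT_0.
have D1 i (l : nat) : ev_derive (fun k => fourier (D k) i (INR l)) (fun k => fourier (partial false (D k)) i (INR l)).
  move=> a Ha; apply: filter_imp (E a Ha) => k S t Ht.
  exact: fourier_derive (@open_strip a) S Ht.
have D2 i (l : nat) : ev_derive (fun k => fourier (partial false (D k)) i (INR l))
   (fun k t => INR l ^ 2 * fourier (D k) i (INR l) t + fourier (lap (D k)) i (INR l) t).
  move=> a Ha; apply: filter_imp (filter_and _ _ (E a Ha) (P a Ha)) => k [S Pk] t Ht.
  rewrite -(fourier_lap i l (@open_strip a) S Pk Ht).
  exact: fourier_derive (@open_strip a) (smooth_on_partial false S) Ht.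
have V i (l : nat) : vanish_loc (fun k => fourier (lap (D k)) i (INR l)).
  move=> a Ha eps He; have Ha1 : 0 < a + 1 by lra.
  have He' : 0 < eps / (2 * PI) by apply: Rdiv_lt_0_compat; lra.
  apply: filter_imp (filter_and _ _ (E _ Ha1) (converges_unif_conv L Ha He')) => k [S U] t Ht.
  have -> : eps = 2 * PI * (eps / (2 * PI)) by field; lra.
  apply: (fourier_abs_le i _ (@open_strip (a + 1)) (smooth_on_lap (@open_strip (a + 1)) S) (strip_lt Ht)) => z.
  by have := U t z Ht; rewrite Rminus_0_r; lra.
have Pt i (l : nat) : sampled_growth mu (fun k => fourier (D k) i (INR l)).
  exists W, (PI + C / 2) => T.
  have M0 : 0 < Rabs T + Rabs W + 1 by have := Rabs_pos T; have := Rabs_pos W; lra.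
  apply: filter_imp (filter_and _ _ (HP T) (E _ M0)) => k [[s [Hs HJ]] S].
  exists s; split=> //.
  have Ds : strip (Rabs T + Rabs W + 1) s.
    rewrite /strip; have := Rabs_triang (s - T) T; have -> : s - T + T = s by ring.
    by have := Rle_abs W; lra.
  have e0 := exp_pos (mu * T).
  apply: Rle_trans (fourier_sq_le i (INR l) (@open_strip _) S Ds e0) _.
  rewrite Rmult_plus_distr_r; apply: Rplus_le_compat_l.
  apply/Rle_div_l; first lra.
  have -> : C / 2 * exp (mu * T) * (2 * exp (mu * T)) = C * exp (2 * mu * T); last exact: HJ.
  by have -> : 2 * mu * T = mu * T + mu * T by [ring]; rewrite exp_plus; field.
have VC i (l : nat) : vanish_loc (fun k => fourier (D k) i (INR l)).
  apply: (mode_vanish (D1 i l) (D2 i l) (V i l) (Pt i l) (tau := tau)).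
  case: (Nat.eq_dec l m) => [->|n]; first by right; split=> //; split=> //; exact: HB.
  left=> H; apply: n; apply: INR_eq; rewrite mum in H.
  by have := pos_INR l; have := pos_INR m; nra.
have U : unif_conv D (fun _ _ => 0).
  move=> a Ha eps He.
  have [x [[B HBx] Hx]] := almost_harmonic_sup ideal_bounded_seq (almost_harmonic_partial true ideal_bounded_seq HD) Ha.
  have L0 : 0 < Rabs B + 1 by have := Rabs_pos B; lra.
  have He2 : 0 < eps / 2 by lra.
  have [N [del [del0 HN]]] := small_modes L0 He2.
  have HV : eventually (fun k => forall l, le l N -> forall i t, Rabs t <= a -> Rabs (fourier (D k) i (INR l) t) <= del).
    elim: N {HN} => [|N IH].
      apply: filter_imp (filter_and _ _ (VC true 0%N a Ha del del0) (VC false 0%N a Ha del del0)) => k [h1 h2] l Hl.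
      have -> : l = 0%N by lia.
      by case.
    apply: filter_imp (filter_and _ _ IH (filter_and _ _ (VC true N.+1 a Ha del del0) (VC false N.+1 a Ha del del0))) => k [h0 [h1 h2]] l Hl.
    case: (Nat.eq_dec l N.+1) => [->|n]; first by case.
    by apply: h0; lia.
  have Ha1 : 0 < a + 1 by lra.
  apply: filter_imp (filter_and _ _ (filter_and _ _ (E _ Ha1) (P _ Ha1)) (filter_and _ _ HV (filter_and _ _ HBx Hx))).
  move=> k [[S Pk] [H1 [H2 H3]]] t z Ht; rewrite Rminus_0_r.
  have Ds := strip_lt Ht.
  suff : Rabs (D k t z) <= eps / 2 by lra.
  apply: (HN (fun z => D k t z) (fun z => partial true (D k) t z)).
  - by move=> y; apply: Derive_correct; exact: (smooth_on_ex true y S Ds).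
  - by move=> y; exact: Pk.
  - move=> y; have := Rle_trans _ _ _ (H3 t y Ht) H2; rewrite /partial_seq -pow2_abs.
    have := Rle_abs B; have := Rabs_pos (partial true (D k) t y); nra.
  - by move=> l Hl; split; [exact: (H1 l Hl true t Ht)|exact: (H1 l Hl false t Ht)].
apply: almost_harmonic_vanishing_converges; split=> //.
exact: sq_int_in_unif0 ideal_vanishing E U.
Qed.

(** * Subtracting the resonant mode *)

Lemma RInt_cos_period (k : nat) : (0 < k)%N -> RInt (fun z => cos (INR k * z)) 0 (2 * PI) = 0.
Proof.
move=> k0; have K : INR k <> 0 by apply: not_0_INR; move=> E; rewrite E in k0.
have H : is_RInt (fun z => cos (INR k * z)) 0 (2 * PI) (sin (INR k * (2 * PI)) / INR k - sin (INR k * 0) / INR k).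
  apply: (is_RInt_derive (fun z => sin (INR k * z) / INR k)) => z _.
    by auto_derive => //; field.
  by apply: ex_derive_continuous; auto_derive.
rewrite (is_RInt_unique _ _ _ _ H).
have -> : INR k * (2 * PI) = 0 + 2 * INR k * PI by ring.
by rewrite sin_period Rmult_0_r sin_0 Rminus_eq_0.
Qed.

Lemma RInt_sin_period (k : nat) : RInt (fun z => sin (INR k * z)) 0 (2 * PI) = 0.
Proof.
case: k => [|k].
  rewrite (@RInt_extR _ (fun _ => 0)); last by move=> x; rewrite /= Rmult_0_l sin_0.
  by rewrite RInt_const /scal /= /mult /= Rmult_0_r.
have K : INR k.+1 <> 0 by exact: not_0_INR.
move: K; move E : (k.+1) => l K.
have H : is_RInt (fun z => sin (INR l * z)) 0 (2 * PI) (- cos (INR l * (2 * PI)) / INR l - - cos (INR l * 0) / INR l).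
  apply: (is_RInt_derive (fun z => - cos (INR l * z) / INR l)) => z _.
    by auto_derive => //; field.
  by apply: ex_derive_continuous; auto_derive.
rewrite (is_RInt_unique _ _ _ _ H).
have -> : INR l * (2 * PI) = 0 + 2 * INR l * PI by ring.
by rewrite cos_period Rmult_0_r Rminus_eq_0.
Qed.

(** Besides the resonant frequency [m], only [3m] occurs: it comes from the products of three
    functions of frequency [m] in the Willmore equation. *)
Lemma fourier_trigpoly (m : nat) (i : bool) (x1 x2 x3 x4 : R) : (0 < m)%N ->
  RInt (fun z => (x1 * cos (INR m * z) + x2 * sin (INR m * z)
     + x3 * cos (3 * INR m * z) + x4 * sin (3 * INR m * z)) * trig i (INR m) z) 0 (2 * PI)
  = PI * (if i then x1 else x2) :> R.
Proof.
move=> m0; set c := INR m.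
have C2 : RInt (fun z => cos (INR (m + m) * z)) 0 (2 * PI) = 0.
  by apply: RInt_cos_period; rewrite addn_gt0 m0.
have C4 : RInt (fun z => cos (INR (m + m + (m + m)) * z)) 0 (2 * PI) = 0.
  by apply: RInt_cos_period; rewrite !addn_gt0 m0.
have S2 := RInt_sin_period (m + m); have S4 := RInt_sin_period (m + m + (m + m)).
have e2 : INR (m + m) = 2 * c by rewrite plus_INR /c; ring.
have e4 : INR (m + m + (m + m)) = 4 * c by rewrite !plus_INR /c; ring.
rewrite e2 in C2 S2; rewrite e4 in C4 S4.
have X (h : R -> R) : (forall z, ex_derive h z) -> ex_RInt h 0 (2 * PI) by exact: ex_RInt_ed.
have D1 : forall z, ex_derive (fun z => cos (2 * c * z)) z by move=> z; auto_derive.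
have D2 : forall z, ex_derive (fun z => cos (4 * c * z)) z by move=> z; auto_derive.
have D3 : forall z, ex_derive (fun z => sin (2 * c * z)) z by move=> z; auto_derive.
have D4 : forall z, ex_derive (fun z => sin (4 * c * z)) z by move=> z; auto_derive.
have D5 : forall z : R, ex_derive (fun _ => 1) z by move=> z; auto_derive.
have I1 := X _ D1; have I2 := X _ D2; have I3 := X _ D3; have I4 := X _ D4; have I5 := X _ D5.
have T1 : RInt (fun _ => 1) 0 (2 * PI) = 2 * PI by rewrite RInt_const /scal /= /mult /=; ring.
have trigs z : [/\ cos (2 * c * z) = cos (c * z) * cos (c * z) - sin (c * z) * sin (c * z),
   sin (2 * c * z) = 2 * (sin (c * z) * cos (c * z)),
   cos (4 * c * z) = cos (3 * c * z) * cos (c * z) - sin (3 * c * z) * sin (c * z),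
   sin (4 * c * z) = sin (3 * c * z) * cos (c * z) + cos (3 * c * z) * sin (c * z) &
   (cos (2 * c * z) = cos (3 * c * z) * cos (c * z) + sin (3 * c * z) * sin (c * z) /\
    sin (2 * c * z) = sin (3 * c * z) * cos (c * z) - cos (3 * c * z) * sin (c * z))].
  have f2 : 2 * c * z = c * z + c * z by ring.
  have f4 : 4 * c * z = 3 * c * z + c * z by ring.
  have f2' : 2 * c * z = 3 * c * z - c * z by ring.
  split; [by rewrite f2 cos_plus|by rewrite f2 sin_plus; ring|by rewrite f4 cos_plus|by rewrite f4 sin_plus|].
  by split; rewrite f2' ?cos_minus ?sin_minus.
have P z : cos (c * z) * cos (c * z) + sin (c * z) * sin (c * z) = 1.
  by have := sin2_cos2 (c * z); rewrite /Rsqr; lra.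
case: i.
- rewrite (@RInt_extR _ (fun z => 1 * (x1 / 2 * 1 + (x1 / 2 + x3 / 2) * cos (2 * c * z))
     + 1 * ((x2 / 2 + x4 / 2) * sin (2 * c * z) + 1 * (x3 / 2 * cos (4 * c * z) + x4 / 2 * sin (4 * c * z))))).
    rewrite !RInt_lin //; try (repeat (apply: ex_RInt_lin => //)).
    by rewrite C2 C4 S2 S4 T1; field.
  move=> z; have [a1 a2 a3 a4 [a5 a6]] := trigs z; have p := P z.
  rewrite /trig -/c.
  have b1 : cos (3 * c * z) * cos (c * z) = (cos (2 * c * z) + cos (4 * c * z)) / 2 by lra.
  have b2 : sin (3 * c * z) * cos (c * z) = (sin (2 * c * z) + sin (4 * c * z)) / 2 by lra.
  have b3 : cos (c * z) * cos (c * z) = (1 + cos (2 * c * z)) / 2 by lra.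
  have b4 : sin (c * z) * cos (c * z) = sin (2 * c * z) / 2 by lra.
  have -> : forall C S C3 S3 : R, (x1 * C + x2 * S + x3 * C3 + x4 * S3) * cos (c * z) = x1 * (C * cos (c * z)) + x2 * (S * cos (c * z)) + x3 * (C3 * cos (c * z)) + x4 * (S3 * cos (c * z)) by move=> *; ring.
  rewrite b3 b4 b1 b2; field.
- rewrite (@RInt_extR _ (fun z => 1 * (x2 / 2 * 1 + (- x2 / 2 + x4 / 2) * cos (2 * c * z))
     + 1 * ((x1 / 2 - x3 / 2) * sin (2 * c * z) + 1 * (- x4 / 2 * cos (4 * c * z) + x3 / 2 * sin (4 * c * z))))).
    rewrite !RInt_lin //; try (repeat (apply: ex_RInt_lin => //)).
    by rewrite C2 C4 S2 S4 T1; field.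
  move=> z; have [a1 a2 a3 a4 [a5 a6]] := trigs z; have p := P z.
  rewrite /trig -/c.
  have b1 : cos (3 * c * z) * sin (c * z) = (sin (4 * c * z) - sin (2 * c * z)) / 2 by lra.
  have b2 : sin (3 * c * z) * sin (c * z) = (cos (2 * c * z) - cos (4 * c * z)) / 2 by lra.
  have b3 : sin (c * z) * sin (c * z) = (1 - cos (2 * c * z)) / 2 by lra.
  have b4 : cos (c * z) * sin (c * z) = sin (2 * c * z) / 2 by lra.
  have -> : forall C S C3 S3 : R, (x1 * C + x2 * S + x3 * C3 + x4 * S3) * sin (c * z) = x1 * (C * sin (c * z)) + x2 * (S * sin (c * z)) + x3 * (C3 * sin (c * z)) + x4 * (S3 * sin (c * z)) by move=> *; ring.
  rewrite b4 b3 b1 b2; field.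
Qed.

Definition mode (mu : R) (m : nat) (c1 c2 t th : R) : R :=
  exp (mu * t) * (c1 * cos (INR m * th) + c2 * sin (INR m * th)).

(** The solution of [lap w = forcing] that has no mode [exp (mu t)] at [tau]: the frequency [m]
    is resonant and produces the factor [t], and the constant [1 / (2 mu)] makes
    [w' + mu w] equal to [0] at [tau] for the coefficients of frequency [m]. *)
Definition response (mu : R) (m : nat) (tau p q r s t th : R) : R :=
  exp (mu * t) * ((t - tau - / (2 * mu)) * (p * cos (INR m * th) + q * sin (INR m * th))
     + (r * cos (3 * INR m * th) + s * sin (3 * INR m * th))).

Definition forcing (mu : R) (m : nat) (p q r s t th : R) : R :=
  exp (mu * t) * (2 * mu * (p * cos (INR m * th) + q * sin (INR m * th))
     + (mu ^ 2 - 9 * mu ^ 2) * (r * cos (3 * INR m * th) + s * sin (3 * INR m * th))).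

(** [a' + mu a] annihilates the solution [exp (- mu t)] of [a'' = mu^2 a]; what remains is the
    coefficient of [exp (mu t)], normalised so that it does not depend on [tau] for harmonic [X]. *)
Definition mode_coef (mu : R) (m : nat) (X : R -> R -> R) (i : bool) (tau : R) : R :=
  exp (- mu * tau) * (fourier (partial false X) i (INR m) tau + mu * fourier X i (INR m) tau) / (2 * mu * PI).

Lemma tame_cos_sin m c1 c2 : tame (fun _ th => c1 * cos (m * th) + c2 * sin (m * th)).
Proof.
by apply: tame_plus; apply: tame_scal; [apply: tame_cos|apply: tame_sin].
Qed.

Lemma tame_mode mu m c1 c2 : tame (mode mu m c1 c2).
Proof. apply: tame_mult; [exact: tame_exp|exact: tame_cos_sin]. Qed.

Lemma tame_response mu m tau p q r s : tame (response mu m tau p q r s).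
Proof.
apply: tame_mult; first exact: tame_exp.
apply: tame_plus; last exact: tame_cos_sin.
apply: tame_mult; last exact: tame_cos_sin.
apply: tame_minus; last exact: tame_const.
by apply: tame_minus; [exact: tame_id|exact: tame_const].
Qed.

Lemma partial_t_response mu m tau p q r s t th :
  partial false (response mu m tau p q r s) t th = mu * response mu m tau p q r s t th
   + mode mu m p q t th.
Proof. by apply: is_derive_unique; rewrite /response /mode; auto_derive => //; ring. Qed.

Lemma partial_t_mode mu m c1 c2 t th :
  partial false (mode mu m c1 c2) t th = mu * mode mu m c1 c2 t th.
Proof. by apply: is_derive_unique; rewrite /mode; auto_derive => //; ring. Qed.

Lemma lap_mode mu m c1 c2 t th : mu ^ 2 = INR m ^ 2 -> lap (mode mu m c1 c2) t th = 0.
Proof.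
move=> E; rewrite /lap.
have -> : partial false (mode mu m c1 c2) = fun t th => mu * mode mu m c1 c2 t th.
  by apply: fun2_ext => u v; exact: partial_t_mode.
have -> : partial true (mode mu m c1 c2) = fun t th => INR m * mode mu m c2 (- c1) t th.
  by apply: fun2_ext => u v; apply: is_derive_unique; rewrite /mode; auto_derive => //; ring.
rewrite !partial_scal partial_t_mode.
have -> : partial true (mode mu m c2 (- c1)) t th = INR m * mode mu m (- c1) (- c2) t th.
  by apply: is_derive_unique; rewrite /mode; auto_derive => //; ring.
rewrite -!Rmult_assoc.
have -> : mu * mu = INR m * INR m by move: E; rewrite /= !Rmult_1_r.
rewrite /mode; ring.
Qed.

Lemma lap_response mu m tau p q r s t th : mu <> 0 -> mu ^ 2 = INR m ^ 2 ->
  lap (response mu m tau p q r s) t th = forcing mu m p q r s t th.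
Proof.
move=> mu0 E; rewrite /lap.
have -> : partial false (response mu m tau p q r s) = fun t th => mu * response mu m tau p q r s t th
   + mode mu m p q t th.
  by apply: fun2_ext => u v; exact: partial_t_response.
rewrite partial_plus; [|apply: (@smooth_on_ex all_t) => //; apply: smooth_on_tame..]; last exact: tame_mode.
  rewrite partial_scal partial_t_response partial_t_mode.
  pose g u v := exp (mu * u) * ((u - tau - / (2 * mu)) * INR m * (q * cos (INR m * v) - p * sin (INR m * v))
     + 3 * INR m * (s * cos (3 * INR m * v) - r * sin (3 * INR m * v))).
  have -> : partial true (response mu m tau p q r s) = g.
    by apply: fun2_ext => u v; apply: is_derive_unique; rewrite /response /g; auto_derive => //; ring.
  have -> : partial true g t th = exp (mu * t) * ((t - tau - / (2 * mu)) * (INR m * INR m) * (- q * sin (INR m * th) - p * cos (INR m * th))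
     + 9 * (INR m * INR m) * (- s * sin (3 * INR m * th) - r * cos (3 * INR m * th))).
    by apply: is_derive_unique; rewrite /g; auto_derive => //; ring.
  have -> : INR m * INR m = mu * mu by move: E; rewrite /= !Rmult_1_r.
  by rewrite /response /mode /forcing; field.
exact: tame_scal (tame_response _ _ _ _ _ _ _).
Qed.

Lemma fourier_mode mu m c1 c2 i t : (0 < m)%N ->
  fourier (mode mu m c1 c2) i (INR m) t = exp (mu * t) * PI * (if i then c1 else c2).
Proof.
move=> m0; rewrite /fourier /circ_int.
rewrite (@RInt_extR _ (fun z => (exp (mu * t) * c1 * cos (INR m * z) + exp (mu * t) * c2 * sin (INR m * z)
     + 0 * cos (3 * INR m * z) + 0 * sin (3 * INR m * z)) * trig i (INR m) z)); last first.
  by move=> z; rewrite /mode; ring.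
by rewrite fourier_trigpoly //; case: i; ring.
Qed.

Lemma fourier_response mu m tau p q r s i t : (0 < m)%N ->
  fourier (response mu m tau p q r s) i (INR m) t
  = exp (mu * t) * (t - tau - / (2 * mu)) * PI * (if i then p else q).
Proof.
move=> m0; rewrite /fourier /circ_int; set k := t - tau - / (2 * mu).
rewrite (@RInt_extR _ (fun z => (exp (mu * t) * k * p * cos (INR m * z) + exp (mu * t) * k * q * sin (INR m * z)
     + exp (mu * t) * r * cos (3 * INR m * z) + exp (mu * t) * s * sin (3 * INR m * z)) * trig i (INR m) z)); last first.
  by move=> z; rewrite /response -/k; ring.
by rewrite fourier_trigpoly //; case: i; ring.
Qed.

Lemma fourier_plus D X Y i c t : open_dom D -> smooth_on D X -> smooth_on D Y -> D t ->
  fourier (fun t th => X t th + Y t th) i c t = fourier X i c t + fourier Y i c t.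
Proof.
move=> oD SX SY Dt; rewrite /fourier -(circ_int_plus (D := D)) //; try (apply: smooth_on_mult => //; exact: smooth_on_trig).
by apply: circ_int_ext => z; ring.
Qed.

Lemma fourier_scal D X i c t k : open_dom D -> smooth_on D X -> D t ->
  fourier (fun t th => k * X t th) i c t = k * fourier X i c t.
Proof.
move=> oD SX Dt; rewrite /fourier -(circ_int_scal (D := D)) //; last (apply: smooth_on_mult => //; exact: smooth_on_trig).
by apply: circ_int_ext => z; ring.
Qed.

Lemma fourier_ext X Y i c t : (forall z, X t z = Y t z) -> fourier X i c t = fourier Y i c t.
Proof. by move=> E; apply: circ_int_ext => z; rewrite E. Qed.

Lemma exp_mulN mu t : exp (- mu * t) * exp (mu * t) = 1.
Proof. by rewrite -exp_plus; have -> : - mu * t + mu * t = 0 by [ring]; exact: exp_0. Qed.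

Lemma mode_coef_mode mu m c1 c2 i tau : (0 < m)%N -> mu <> 0 ->
  mode_coef mu m (mode mu m c1 c2) i tau = if i then c1 else c2.
Proof.
move=> m0 mu0; rewrite /mode_coef.
have -> : fourier (partial false (mode mu m c1 c2)) i (INR m) tau = mu * fourier (mode mu m c1 c2) i (INR m) tau.
  rewrite -(fourier_scal _ _ _ open_all (smooth_on_tame _ (tame_mode mu m c1 c2))) //.
  by apply: fourier_ext => z; exact: partial_t_mode.
rewrite fourier_mode //.
have -> : exp (- mu * tau) * (mu * (exp (mu * tau) * PI * (if i then c1 else c2)) + mu * (exp (mu * tau) * PI * (if i then c1 else c2)))
   = (exp (- mu * tau) * exp (mu * tau)) * (2 * mu * PI * (if i then c1 else c2)) by ring.
by rewrite exp_mulN; field; split=> //; apply: Rgt_not_eq PI_RGT_0.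
Qed.

(** The resonance makes the coefficient of the mode grow linearly, starting from [0] at [tau0]. *)
Lemma mode_coef_response mu m tau0 p q r s i tau : (0 < m)%N -> mu <> 0 ->
  mode_coef mu m (response mu m tau0 p q r s) i tau = (tau - tau0) * (if i then p else q).
Proof.
move=> m0 mu0; rewrite /mode_coef.
have SR := smooth_on_tame all_t (tame_response mu m tau0 p q r s).
have SH := smooth_on_tame all_t (tame_mode mu m p q).
have -> : fourier (partial false (response mu m tau0 p q r s)) i (INR m) tau
   = mu * fourier (response mu m tau0 p q r s) i (INR m) tau + fourier (mode mu m p q) i (INR m) tau.
  rewrite -(fourier_scal _ _ _ open_all SR) // -(fourier_plus _ _ open_all _ SH) //; last exact: smooth_on_scal open_all SR.
  by apply: fourier_ext => z; exact: partial_t_response.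
rewrite fourier_mode // fourier_response //; set x := if i then p else q.
have -> : exp (- mu * tau) * (mu * (exp (mu * tau) * (tau - tau0 - / (2 * mu)) * PI * x) + exp (mu * tau) * PI * x
   + mu * (exp (mu * tau) * (tau - tau0 - / (2 * mu)) * PI * x))
   = (exp (- mu * tau) * exp (mu * tau)) * (PI * x * (2 * mu * (tau - tau0 - / (2 * mu)) + 1)) by ring.
by rewrite exp_mulN; field; split=> //; apply: Rgt_not_eq PI_RGT_0.
Qed.

Lemma mode_coef_minus D mu m X Y i tau : open_dom D -> smooth_on D X -> smooth_on D Y -> D tau ->
  mode_coef mu m (fun t th => X t th - Y t th) i tau = mode_coef mu m X i tau - mode_coef mu m Y i tau.
Proof.
move=> oD SX SY Dt; rewrite /mode_coef.
have E : (fun t th => X t th - Y t th) = (fun t th => X t th + -1 * Y t th).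
  by apply: fun2_ext => t th; ring.
have SY' := smooth_on_scal (-1) oD SY.
rewrite E (fourier_plus _ _ oD SX SY' Dt) (fourier_scal _ _ _ oD SY Dt).
have -> : fourier (partial false (fun t th => X t th + -1 * Y t th)) i (INR m) tau
   = fourier (fun t th => partial false X t th + -1 * partial false Y t th) i (INR m) tau.
  apply: fourier_ext => z; rewrite partial_plus ?partial_scal //; [exact: smooth_on_ex SX Dt|exact: smooth_on_ex SY' Dt].
have [SXt SYt] := (smooth_on_partial false SX, smooth_on_partial false SY).
rewrite (fourier_plus _ _ oD SXt (smooth_on_scal (-1) oD SYt) Dt) (fourier_scal _ _ _ oD SYt Dt).
by rewrite /Rdiv; ring.
Qed.

Notation int_cell L j := (int_cyl (IZR j * L) ((IZR j + 1) * L)).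
Notation mid L j := ((IZR j + / 2) * L).

Definition off_mode (mu : R) (m : nat) (tau : R) (X : R -> R -> R) (t th : R) : R :=
  X t th - mode mu m (mode_coef mu m X true tau) (mode_coef mu m X false tau) t th.

(** Up to a constant, [mode_coef] is [exp (- mu t) b] for a solution of [b' = mu b + r], where [r] is a
    coefficient of the Laplacian. *)
Lemma mode_coef_converges mu m (Y : funseq) i s t : ev_smooth Y -> ev_periodic Y -> mu ^ 2 = INR m ^ 2 -> mu <> 0 ->
  converges (fun k => lap (Y k)) (fun _ _ => 0) ->
  forall eps, 0 < eps -> eventually (fun k => Rabs (mode_coef mu m (Y k) i t - mode_coef mu m (Y k) i s) <= eps).
Proof.
move=> E P mum mu0 L eps He.
have PI0 := PI_RGT_0.
pose a := Rabs s + Rabs t + 1.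
have a0 : 0 < a by have := Rabs_pos s; have := Rabs_pos t; rewrite /a; lra.
have hs : Rabs s < a by have := Rabs_pos t; rewrite /a; lra.
have ht : Rabs t < a by have := Rabs_pos s; rewrite /a; lra.
have ex := exp_pos (Rabs mu * a).
have am : 0 < Rabs mu by exact: Rabs_pos_lt.
pose c := / (2 * Rabs mu * PI) * (exp (Rabs mu * a) * (2 * PI) * (2 * a)).
have c0 : 0 < c.
  apply: Rmult_lt_0_compat; first by apply: Rinv_0_lt_compat; repeat first [lra | apply: Rmult_lt_0_compat].
  by repeat first [lra | apply: Rmult_lt_0_compat].
pose d := eps / c.
have d0 : 0 < d by apply: Rdiv_lt_0_compat.
have oD := @open_strip a.
apply: filter_imp (filter_and _ _ (filter_and _ _ (E a a0) (P a a0)) (converges_unif_conv L a0 d0)) => k [[S Pk] U].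
pose b x := fourier (partial false (Y k)) i (INR m) x + mu * fourier (Y k) i (INR m) x.
have Hb x : Rabs x < a -> is_derive b x (mu * b x + fourier (lap (Y k)) i (INR m) x).
  move=> Hx.
  have h1 := fourier_derive i (INR m) oD (smooth_on_partial false S) Hx.
  rewrite (fourier_lap i m oD S Pk Hx) in h1.
  have h2 := is_derive_scal _ _ mu _ (fourier_derive i (INR m) oD S Hx).
  have := is_derive_plus _ _ _ _ _ h1 h2; rewrite /plus /scal /= /mult /=.
  have -> // : INR m * (INR m * 1) * fourier (Y k) i (INR m) x + fourier (lap (Y k)) i (INR m) x
       + mu * fourier (partial false (Y k)) i (INR m) x = mu * b x + fourier (lap (Y k)) i (INR m) x.
  have -> : INR m * (INR m * 1) = mu * mu by move: mum; rewrite /= !Rmult_1_r.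
  by rewrite /b; ring.
have Hr x : Rabs x < a -> Rabs (fourier (lap (Y k)) i (INR m) x) <= 2 * PI * d.
  move=> Hx; apply: (fourier_abs_le i _ oD (smooth_on_lap oD S) Hx) => z.
  by have := U x z (Rlt_le _ _ Hx); rewrite Rminus_0_r; lra.
have H := propagate_diff hs ht Hb Hr.
have -> : mode_coef mu m (Y k) i t - mode_coef mu m (Y k) i s
   = / (2 * mu * PI) * (exp (- mu * t) * b t - exp (- mu * s) * b s).
  by rewrite /mode_coef /b /Rdiv; ring.
rewrite Rabs_mult.
have -> : Rabs (/ (2 * mu * PI)) = / (2 * Rabs mu * PI).
  rewrite Rabs_inv (Rabs_mult _ PI) (Rabs_mult 2 mu) (Rabs_pos_eq 2); last by lra.
  by rewrite (Rabs_pos_eq PI) //; lra.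
apply: Rle_trans (Rmult_le_compat_l _ _ _ _ H) _.
  by apply: Rlt_le; apply: Rinv_0_lt_compat; repeat first [lra | apply: Rmult_lt_0_compat].
by right; rewrite /d /c; field; repeat split; apply: Rgt_not_eq => //; lra.
Qed.

Lemma seg_in_cell L (j : Z) a : 0 < L -> Rabs (IZR j) * L + L < a ->
  seg_in (strip a) (IZR j * L) ((IZR j + 1) * L).
Proof.
move=> L0 H; split; first lra.
move=> t Ht; rewrite /strip; apply: Rabs_def1.
- have : IZR j * L <= Rabs (IZR j) * L by apply: Rmult_le_compat_r; [lra|exact: Rle_abs].
  lra.
- have : - Rabs (IZR j) * L <= IZR j * L.
    by apply: Rmult_le_compat_r; [lra|]; have := Rle_abs (- IZR j); rewrite Rabs_Ropp; lra.
  lra.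
Qed.

Lemma trig_comb_bound c1 c2 x y : Rabs (c1 * cos x + c2 * sin y) <= Rabs c1 + Rabs c2.
Proof.
apply: Rle_trans (Rabs_triang _ _) _; rewrite !Rabs_mult.
have h1 : Rabs (cos x) <= 1 by apply: Rabs_le; apply: COS_bound.
have h2 : Rabs (sin y) <= 1 by apply: Rabs_le; apply: SIN_bound.
have := Rabs_pos c1; have := Rabs_pos c2; nra.
Qed.

Lemma sq_exp mu t x : exp (-2 * mu * t) * x ^ 2 = (exp (- mu * t) * x) ^ 2.
Proof. by have -> : -2 * mu * t = - mu * t + - mu * t by [ring]; rewrite exp_plus; ring. Qed.

(** Let [w] be the response, [Y = X - w], and [D] the function [Y] without its mode at [L / 2]. Then
    [lap D] tends to [0]. On the cell with midpoint [tau] the function [D] differs from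
    [off_mode tau X] by the response centred at [tau] instead of [L / 2], up to modes whose
    coefficients tend to [0]; that response is [O (exp (mu t))] with a constant independent of the
    cell. So the bound on the cells passes to [D], and the Liouville theorem applies. *)
Lemma response_limit (mu L p q r s : R) (m : nat) (X : funseq) :
  0 < L -> (0 < m)%N -> mu ^ 2 = INR m ^ 2 ->
  ev_smooth X -> ev_periodic X -> converges (fun k => lap (X k)) (forcing mu m p q r s) ->
  (exists C, forall j : Z, eventually (fun k =>
     int_cell L j
       (fun t th => exp (-2 * mu * t) * off_mode mu m (mid L j) (X k) t th ^ 2) <= C)) ->
  converges (fun k => off_mode mu m (L / 2) (X k)) (response mu m (L / 2) p q r s).
Proof.
move=> L0 m0 mum EX PX LX [C HC].
have PI0 := PI_RGT_0.
have m1 : 0 < INR m by apply: lt_0_INR; apply/ltP.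
have mu0 : mu <> 0 by move=> E; rewrite E in mum; have := pow_lt _ 2 m1; lra.
pose w := response mu m (L / 2) p q r s.
have Nw : tame w by exact: tame_response.
have Sw D : smooth_on D w by exact: smooth_on_tame.
have Nh c1 c2 : tame (mode mu m c1 c2) by exact: tame_mode.
have Sh D c1 c2 : smooth_on D (mode mu m c1 c2) by apply: smooth_on_tame; exact: Nh.
have hper c1 c2 (c : nat) th : c1 * cos (INR c * (th + 2 * PI)) + c2 * sin (INR c * (th + 2 * PI))
    = c1 * cos (INR c * th) + c2 * sin (INR c * th).
  by have := trig_periodic true c th; have := trig_periodic false c th; rewrite /trig => -> ->.
have Pw D : periodic_on D w.
  move=> t th _; rewrite /w /response hper.
  have -> : 3 * INR m = INR (3 * m) by rewrite mult_INR /=; ring.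
  by rewrite hper.
have Ph D c1 c2 : periodic_on D (mode mu m c1 c2) by move=> t th _; rewrite /mode hper.
pose Y : funseq := fun k t th => X k t th - w t th.
have smm D F G : open_dom D -> smooth_on D F -> smooth_on D G -> smooth_on D (fun t th => F t th - G t th).
  move=> oD SF SG; apply: (smooth_on_ext oD _ (smooth_on_plus oD SF (smooth_on_scal (-1) oD SG))) => t th _; ring.
have EY : ev_smooth Y by move=> a Ha; apply: filter_imp (EX a Ha) => k S; apply: smm => //; exact: open_strip.
have PY : ev_periodic Y.
  by move=> a Ha; apply: filter_imp (PX a Ha) => k P t th Dt; rewrite /Y P // (Pw (strip a)).
have lap_minus a F G t th : smooth_on (strip a) F -> smooth_on (strip a) G -> strip a t ->
    lap (fun t th => F t th - G t th) t th = lap F t th - lap G t th.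
  move=> SF SG Dt; have oD := @open_strip a.
  have H d : partial d (partial d (fun t th => F t th - G t th)) t th
     = partial d (partial d F) t th - partial d (partial d G) t th.
    have e1 u v : strip a u -> partial d (fun t th => F t th - G t th) u v = partial d F u v + -1 * partial d G u v.
      move=> Du; rewrite (@partial_ext _ (fun t th => F t th + -1 * G t th)); last by move=> *; ring.
      have SG1 := smooth_on_scal (-1) oD SG.
      by rewrite partial_plus ?partial_scal //; [exact: smooth_on_ex SF Du|exact: smooth_on_ex SG1 Du].
    rewrite (partial_ext_loc d th oD Dt e1).
    have [SFd SGd] := (smooth_on_partial d SF, smooth_on_partial d SG).
    have SG1 := smooth_on_scal (-1) oD SGd.
    rewrite partial_plus ?partial_scal; [ring|exact: smooth_on_ex SFd Dt|exact: smooth_on_ex SG1 Dt].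
  by rewrite /lap !H; ring.
have LY : converges (fun k => lap (Y k)) (fun _ _ => 0).
  apply: converges_ext (converges_minus LX (converges_lap Nw)).
  - move=> a Ha; apply: filter_imp (EX a Ha) => k S t th Ht.
    by rewrite /Y (lap_minus a).
  - by move=> t th; rewrite lap_response //; ring.
pose D : funseq := fun k t th => Y k t th - mode mu m (mode_coef mu m (Y k) true (L / 2)) (mode_coef mu m (Y k) false (L / 2)) t th.
have DE k t th : D k t th = X k t th - w t th - mode mu m (mode_coef mu m (Y k) true (L / 2)) (mode_coef mu m (Y k) false (L / 2)) t th by [].
have ED : ev_smooth D by move=> a Ha; apply: filter_imp (EY a Ha) => k S; apply: smm => //; exact: open_strip.
have PD : ev_periodic D.
  by move=> a Ha; apply: filter_imp (PY a Ha) => k P t th Dt; rewrite /D P // (Ph (strip a)).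
have LD : converges (fun k => lap (D k)) (fun _ _ => 0).
  apply: converges_ext LY => // a Ha; apply: filter_imp (EY a Ha) => k S t th Ht.
  by rewrite /D (lap_minus a) // lap_mode //; ring.
(* [B0] bounds [exp (- mu t)] times the response centred at the midpoint of a cell; the two
   modes add at most [2] in the end. *)
pose B0 := (L + Rabs (/ (2 * mu))) * (Rabs p + Rabs q) + (Rabs r + Rabs s).
pose C1 := 2 * C + 2 * PI * L * (2 * (2 + B0) ^ 2).
have pcX a k i tau : smooth_on (strip a) (X k) -> strip a tau ->
    mode_coef mu m (X k) i tau = mode_coef mu m (Y k) i tau + (tau - L / 2) * (if i then p else q).
  move=> S Dt; rewrite (mode_coef_minus mu m i (@open_strip a) S (Sw (strip a)) Dt) mode_coef_response //; ring.
have cells : forall j : Z, eventually (fun k =>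
   int_cell L j (fun t th => exp (-2 * mu * t) * sq (D k) t th) <= C1).
  move=> j; pose tau := (mid L j).
  pose a := Rabs (IZR j) * L + L + 1.
  have a0 : 0 < a by have := Rabs_pos (IZR j) => h; have : 0 <= Rabs (IZR j) * L by [apply: Rmult_le_pos; lra]; rewrite /a; lra.
  have oD := @open_strip a.
  have Sc : seg_in (strip a) (IZR j * L) ((IZR j + 1) * L) by apply: seg_in_cell => //; rewrite /a; lra.
  have Dtau : strip a tau by apply: (proj2 Sc); rewrite /tau; lra.
  have c1 := @mode_coef_converges mu m Y true (L / 2) tau EY PY mum mu0 LY 1 Rlt_0_1.
  have c2 := @mode_coef_converges mu m Y false (L / 2) tau EY PY mum mu0 LY 1 Rlt_0_1.
  apply: filter_imp (filter_and _ _ (filter_and _ _ c1 c2) (filter_and _ _ (HC j) (filter_and _ _ (EX a a0) (ED a a0)))).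
  move=> k [[{}c1 {}c2] [HCk [SX SD]]].
  rewrite -/tau in HCk.
  have Se : smooth_on (strip a) (fun t _ => exp (-2 * mu * t)) by exact: smooth_on_exp.
  have SO : smooth_on (strip a) (off_mode mu m tau (X k)) by exact: smm.
  have SO2 : smooth_on (strip a) (fun t th => exp (-2 * mu * t) * sq (off_mode mu m tau (X k)) t th).
    by apply: smooth_on_mult => //; exact: smooth_on_sq.
  have SD2 : smooth_on (strip a) (fun t th => exp (-2 * mu * t) * sq (D k) t th).
    by apply: smooth_on_mult => //; exact: smooth_on_sq.
  have SB := smooth_on_plus oD (smooth_on_scal 2 oD SO2) (smooth_on_const (strip a) (2 * (2 + B0) ^ 2)).
  have : int_cell L j (fun t th => exp (-2 * mu * t) * sq (D k) t th)
     <= int_cell L j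
          (fun t th => 2 * (exp (-2 * mu * t) * sq (off_mode mu m tau (X k)) t th) + 2 * (2 + B0) ^ 2).
    apply: (cyl_le oD Sc SD2 SB) => t th Ht; rewrite /sq !sq_exp.
    set d1 := mode_coef mu m (Y k) true tau - mode_coef mu m (Y k) true (L / 2).
    set d2 := mode_coef mu m (Y k) false tau - mode_coef mu m (Y k) false (L / 2).
    pose rho := (tau - t + / (2 * mu)) * (p * cos (INR m * th) + q * sin (INR m * th))
       + -1 * (r * cos (3 * INR m * th) + s * sin (3 * INR m * th)).
    have E : exp (- mu * t) * D k t th = exp (- mu * t) * off_mode mu m tau (X k) t th
       + ((d1 * cos (INR m * th) + d2 * sin (INR m * th)) + rho).
      have -> : (d1 * cos (INR m * th) + d2 * sin (INR m * th)) + rho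
        = (exp (- mu * t) * exp (mu * t)) * ((d1 * cos (INR m * th) + d2 * sin (INR m * th)) + rho).
        by rewrite exp_mulN; ring.
      rewrite DE /off_mode (pcX a) // (pcX a) // /mode /w /response /rho /d1 /d2; ring.
    rewrite E.
    have b1 : Rabs ((d1 * cos (INR m * th) + d2 * sin (INR m * th)) + rho) <= 2 + B0.
      apply: Rle_trans (Rabs_triang _ _) _; apply: Rplus_le_compat.
        by apply: Rle_trans (trig_comb_bound _ _ _ _) _; rewrite /d1 /d2; lra.
      apply: Rle_trans (Rabs_triang _ _) _; rewrite !Rabs_mult; apply: Rplus_le_compat.
        apply: Rmult_le_compat; try exact: Rabs_pos; last exact: trig_comb_bound.
        apply: Rle_trans (Rabs_triang _ _) _; apply: Rplus_le_compat_r.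
        by apply: Rabs_le; rewrite /tau; lra.
      have -> : Rabs (-1) = 1 by rewrite Rabs_left; lra.
      by rewrite Rmult_1_l; exact: trig_comb_bound.
    move: b1; set y := _ + rho; set x := exp (- mu * t) * _ => b1.
    have : y ^ 2 <= (2 + B0) ^ 2 by rewrite -pow2_abs; apply: pow_incr; split=> //; exact: Rabs_pos.
    have := pow2_ge_0 (x - y); nra.
  rewrite (cyl_plus oD Sc (smooth_on_scal 2 oD SO2) (smooth_on_const _ _)) (cyl_scal _ oD Sc SO2) cyl_const.
  move=> H; apply: Rle_trans H _; rewrite /C1.
  have -> : 2 * PI * ((IZR j + 1) * L - IZR j * L) * (2 * (2 + B0) ^ 2) = 2 * PI * L * (2 * (2 + B0) ^ 2) by ring.
  by rewrite /sq; lra.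
have cellsm a j k : Rabs (IZR j) * L + L < a -> smooth_on (strip a) (D k) ->
    [/\ seg_in (strip a) (IZR j * L) ((IZR j + 1) * L), smooth_on (strip a) (sq (D k)) &
     smooth_on (strip a) (fun t th => exp (-2 * mu * t) * sq (D k) t th)].
  move=> Ha SD; have oD := @open_strip a; have S2 := smooth_on_sq oD SD.
  by split=> //; [exact: seg_in_cell|apply: smooth_on_mult => //; exact: smooth_on_exp].
have cell_a j : 0 < Rabs (IZR j) * L + L + 1.
  have := Rabs_pos (IZR j) => h; have : 0 <= Rabs (IZR j) * L by [apply: Rmult_le_pos; lra]; lra.
have HelD : almost_harmonic bounded_seq D.
  have cellB (j : Z) : bounded_seq (fun k => int_cell L j (sq (D k))).
    pose M := Rabs (IZR j) * L + L + 1.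
    exists (exp (Rabs (2 * mu) * M) * C1).
    apply: filter_imp (filter_and _ _ (cells j) (ED _ (cell_a j))) => k [H SD].
    have Ha : Rabs (IZR j) * L + L < Rabs (IZR j) * L + L + 1 by lra.
    have [Sc S2 S3] := cellsm _ j k Ha SD.
    have oD := @open_strip (Rabs (IZR j) * L + L + 1).
    apply: (Rle_trans _ (exp (Rabs (2 * mu) * M) * int_cell L j (fun t th => exp (-2 * mu * t) * sq (D k) t th))); last first.
      by apply: Rmult_le_compat_l => //; exact: Rlt_le (exp_pos _).
    rewrite -(cyl_scal _ oD Sc S3); apply: (cyl_le oD Sc S2 (smooth_on_scal _ oD S3)) => t th Ht.
    have h : 1 <= exp (Rabs (2 * mu) * M) * exp (-2 * mu * t).
      rewrite -exp_plus -exp_0; have : 0 <= Rabs (2 * mu) * M + -2 * mu * t.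
        have : Rabs (2 * mu * t) <= Rabs (2 * mu) * M.
          rewrite Rabs_mult; apply: Rmult_le_compat_l; first exact: Rabs_pos.
          by apply: Rlt_le; exact: (proj2 Sc t Ht).
        by have := Rle_abs (2 * mu * t); lra.
      by case=> [hh|<-]; [apply: Rlt_le; exact: exp_increasing|rewrite exp_0; lra].
    by rewrite -Rmult_assoc; have := sq_ge0 (D k) t th; nra.
  have sumB (n : nat) : bounded_seq (fun k => int_cyl (- (INR n * L)) (INR n * L) (sq (D k))).
    elim: n => [|n IH].
      exists 0; exists 0%N => k _; rewrite /= Rmult_0_l Ropp_0 int_cylE RInt_point; exact: Rle_refl.
    have [B1 H1] := cellB (Z.of_nat n); have [B2 H2] := cellB (- Z.of_nat n - 1)%Z.
    have [B3 H3] := IH.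
    have N0 := pos_INR n.
    pose a := INR n.+1 * L + 1.
    have a0 : 0 < a by rewrite /a S_INR; nra.
    exists (B2 + B3 + B1).
    apply: filter_imp (filter_and _ _ (filter_and _ _ H1 H2) (filter_and _ _ H3 (ED a a0))) => k [[h1 h2] [h3 SD]].
    rewrite -INR_IZR_INZ in h1.
    rewrite minus_IZR opp_IZR -INR_IZR_INZ in h2.
    have oD := @open_strip a; have S2 := smooth_on_sq oD SD.
    have nL : 0 <= INR n * L by apply: Rmult_le_pos; lra.
    have G u v : - (INR n.+1 * L) <= u -> u <= v -> v <= INR n.+1 * L -> seg_in (strip a) u v.
      by move=> g1 g2 g3; split=> // t Ht; rewrite /strip /a; apply: Rabs_def1; lra.
    have E1 : INR n.+1 * L = INR n * L + L by rewrite S_INR; ring.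
    have G1 : seg_in (strip a) (- (INR n.+1 * L)) (- (INR n * L)) by apply: G; lra.
    have G2 : seg_in (strip a) (- (INR n * L)) (INR n * L) by apply: G; lra.
    have G3 : seg_in (strip a) (INR n * L) (INR n.+1 * L) by apply: G; lra.
    have G4 : seg_in (strip a) (- (INR n.+1 * L)) (INR n * L) by apply: G; lra.
    rewrite -(cyl_chasles oD G4 G3 S2) -(cyl_chasles oD G1 G2 S2).
    have e2 : (- INR n - 1) * L = - (INR n.+1 * L) by lra.
    have e3 : (- INR n - 1 + 1) * L = - (INR n * L) by ring.
    have e4 : (INR n + 1) * L = INR n.+1 * L by lra.
    by rewrite e2 e3 in h2; rewrite e4 in h1; lra.
  split=> // x Hx.
  have [n Hn] := INR_unbounded (x / L).
  have xn : x < INR n * L by apply/Rlt_div_l.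
  have [B HBn] := sumB n; exists B.
  have a0 : 0 < INR n * L + 1 by lra.
  apply: filter_imp (filter_and _ _ HBn (ED _ a0)) => k [H SD].
  apply: Rle_trans H.
  have oD := @open_strip (INR n * L + 1).
  have Sn : seg_in (strip (INR n * L + 1)) (- (INR n * L)) (INR n * L) by apply: seg_in_strip; lra.
  have h1 : - (INR n * L) <= - x by lra.
  have h2 : - x <= x by lra.
  by apply: (cyl_sub_le oD Sn h1 h2 (Rlt_le _ _ xn) (smooth_on_sq oD SD)) => *; exact: sq_ge0.
have HP : exists W C, forall T, eventually (fun k => exists s, Rabs (s - T) <= W /\
     circ_int (sq (D k)) s <= C * exp (2 * mu * T)).
  exists L, ((Rabs C1 + 1) / L * exp (Rabs (2 * mu) * L)) => T.
  pose j := Int_part (T / L).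
  have [j1 j2] := base_Int_part (T / L); rewrite -/j in j1 j2.
  have TL : T = T / L * L by field; lra.
  have T1 : IZR j * L <= T by rewrite TL; apply: Rmult_le_compat_r; lra.
  have T2 : T <= (IZR j + 1) * L by rewrite TL; apply: Rmult_le_compat_r; lra.
  apply: filter_imp (filter_and _ _ (cells j) (ED _ (cell_a j))) => k [H SD].
  have Ha : Rabs (IZR j) * L + L < Rabs (IZR j) * L + L + 1 by lra.
  have [Sc S2 S3] := cellsm _ j k Ha SD.
  have oD := @open_strip (Rabs (IZR j) * L + L + 1).
  have [u [Hu1 Hu2]] : exists u, IZR j * L <= u <= (IZR j + 1) * L /\
      circ_int (fun t th => exp (-2 * mu * t) * sq (D k) t th) u <= (Rabs C1 + 1) / L.
    apply: NNPP => HN.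
    have : RInt (fun _ => (Rabs C1 + 1) / L) (IZR j * L) ((IZR j + 1) * L)
      <= int_cell L j (fun t th => exp (-2 * mu * t) * sq (D k) t th).
      apply: RInt_le; [lra|exact: ex_RInt_const|exact: ex_RInt_circ_int oD S3 Sc|].
      move=> u Hu; apply: Rnot_lt_le => Hlt; apply: HN; exists u; split; [lra|exact: Rlt_le Hlt].
    rewrite RInt_const /scal /= /mult /=.
    have -> : ((IZR j + 1) * L - IZR j * L) * ((Rabs C1 + 1) / L) = Rabs C1 + 1 by field; lra.
    by have := Rle_abs C1; lra.
  exists u; split; first by apply: Rabs_le; lra.
  have Du : strip (Rabs (IZR j) * L + L + 1) u by apply: (proj2 Sc).
  have E : circ_int (sq (D k)) u = exp (2 * mu * u) * circ_int (fun t th => exp (-2 * mu * t) * sq (D k) t th) u.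
    rewrite -(circ_int_scal _ S3 Du); apply: RInt_extR => z.
    rewrite -Rmult_assoc -exp_plus; have -> : 2 * mu * u + -2 * mu * u = 0 by ring.
    by rewrite exp_0 Rmult_1_l.
  rewrite E.
  have -> : (Rabs C1 + 1) / L * exp (Rabs (2 * mu) * L) * exp (2 * mu * T)
    = (exp (Rabs (2 * mu) * L) * exp (2 * mu * T)) * ((Rabs C1 + 1) / L) by ring.
  apply: Rle_trans (Rmult_le_compat_l _ _ _ (Rlt_le _ _ (exp_pos _)) Hu2) _.
  apply: Rmult_le_compat_r.
    by apply: Rdiv_le_0_compat => //; have := Rabs_pos C1; lra.
  have -> : 2 * mu * u = 2 * mu * (u - T) + 2 * mu * T by ring.
  rewrite exp_plus; apply: Rmult_le_compat_r; first exact: Rlt_le (exp_pos _).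
  by apply: exp_le_abs; apply: Rabs_le; lra.
have HB i : eventually (fun k =>
     fourier (partial false (D k)) i (INR m) (L / 2) + mu * fourier (D k) i (INR m) (L / 2) = 0).
  have La : 0 < L / 2 + 1 by lra.
  have Dt : strip (L / 2 + 1) (L / 2) by rewrite /strip Rabs_pos_eq; lra.
  apply: filter_imp (EY _ La) => k S.
  have E : mode_coef mu m (D k) i (L / 2) = 0.
    rewrite (mode_coef_minus mu m i (@open_strip (L / 2 + 1)) S (Sh _ _ _) Dt) mode_coef_mode //.
    by case: (i); ring.
  move: E; rewrite /mode_coef => /(Rmult_eq_compat_r (2 * mu * PI)).
  have n0 : 2 * mu * PI <> 0 by apply: Rmult_integral_contrapositive; split; [lra|apply: Rgt_not_eq].
  rewrite Rmult_0_l /Rdiv Rmult_assoc Rinv_l // Rmult_1_r => /Rmult_integral [] //.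
  by move=> E; have := exp_pos (- mu * (L / 2)); lra.
have H0 := liouville mu0 mum HelD HP HB.
apply: converges_ext (converges_plus H0 Nw); last by move=> t th; rewrite Rplus_0_l.
have La : 0 < L / 2 + 1 by lra.
have Dt : strip (L / 2 + 1) (L / 2) by rewrite /strip Rabs_pos_eq; lra.
move=> a Ha; apply: filter_imp (EX _ La) => k S t th _.
by rewrite DE /off_mode !(pcX _ _ _ _ S Dt) /mode; ring.
Qed.

(** * Geometry of conformal immersions *)

Lemma sum_plus n (x y : 'I_n -> R) :
  \big[Rplus/0]_(j < n) (x j + y j) = \big[Rplus/0]_(j < n) x j + \big[Rplus/0]_(j < n) y j.
Proof. by elim/big_rec3: _ => [|i a b c _ ->]; ring. Qed.

Lemma sum_scal n (c : R) (x : 'I_n -> R) :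
  \big[Rplus/0]_(j < n) (c * x j) = c * \big[Rplus/0]_(j < n) x j.
Proof. by elim/big_rec2: _ => [|i a b _ ->]; ring. Qed.

Lemma sum_ge0 n (x : 'I_n -> R) : (forall j, 0 <= x j) -> 0 <= \big[Rplus/0]_(j < n) x j.
Proof. by move=> H; elim/big_rec: _ => [|i a _ Ha]; [lra|have := H i; lra]. Qed.

Lemma sum_le n (x y : 'I_n -> R) : (forall j, x j <= y j) ->
  \big[Rplus/0]_(j < n) x j <= \big[Rplus/0]_(j < n) y j.
Proof. by move=> H; elim/big_rec2: _ => [|i a b _ Ha]; [lra|have := H i; lra]. Qed.

Lemma sum_term n (x : 'I_n -> R) j : (forall j, 0 <= x j) -> x j <= \big[Rplus/0]_(j < n) x j.
Proof.
move=> H.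
suff : forall s : seq 'I_n, j \in s -> x j <= \big[Rplus/0]_(i <- s) x i.
  by apply; rewrite mem_index_enum.
have ge s : 0 <= \big[Rplus/0]_(i <- s) x i.
  by elim/big_rec: _ => [|i a _ Ha]; [lra|have := H i; lra].
elim=> // i s IH; rewrite inE big_cons => /orP [/eqP <-|/IH]; first by have := ge s; lra.
by have := H i; lra.
Qed.

Lemma dot_sym n (x y : vec n) : dot x y = dot y x.
Proof. by apply: eq_bigr => j _; ring. Qed.

Lemma dot_plusl n (x y z : vec n) : dot (fun j => x j + y j) z = dot x z + dot y z.
Proof. by rewrite /dot -sum_plus; apply: eq_bigr => j _; ring. Qed.

Lemma dot_scall n c (x z : vec n) : dot (fun j => c * x j) z = c * dot x z.
Proof. by rewrite /dot -sum_scal; apply: eq_bigr => j _; ring. Qed.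

Lemma dot_ext n (x x' y y' : vec n) : (forall j, x j = x' j) -> (forall j, y j = y' j) ->
  dot x y = dot x' y'.
Proof. by move=> E E'; apply: eq_bigr => j _; rewrite E E'. Qed.

Lemma dot_lin n (x x' y y' : vec n) (a b c d : R) :
  dot (fun j => a * x j + b * x' j) (fun j => c * y j + d * y' j)
  = a * c * dot x y + a * d * dot x y' + b * c * dot x' y + b * d * dot x' y'.
Proof.
rewrite dot_plusl !dot_scall.
rewrite (dot_sym x (fun j => _)) (dot_sym x' (fun j => _)) !dot_plusl !dot_scall.
by rewrite !(dot_sym y) !(dot_sym y'); ring.
Qed.

Lemma normsq_ge0 n (x : vec n) : 0 <= normsq x.
Proof. by apply: sum_ge0 => j; nra. Qed.

Lemma normsq_scal n c (x : vec n) : normsq (fun j => c * x j) = c ^ 2 * normsq x.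
Proof. by rewrite /normsq dot_scall dot_sym dot_scall; ring. Qed.

Lemma smooth_on_big n D (F : 'I_n -> R -> R -> R) : open_dom D -> (forall j, smooth_on D (F j)) ->
  smooth_on D (fun t th => \big[Rplus/0]_(j < n) F j t th).
Proof.
move=> oD H; elim: (index_enum 'I_n) => [|i s IH].
  by apply: smooth_on_ext oD _ (smooth_on_const D 0) => t th _; rewrite big_nil.
by apply: smooth_on_ext oD _ (smooth_on_plus oD (H i) IH) => t th _; rewrite big_cons.
Qed.

Lemma converges_big n (F : 'I_n -> funseq) G : (forall j, converges (F j) (G j)) ->
  converges (fun k t th => \big[Rplus/0]_(j < n) F j k t th) (fun t th => \big[Rplus/0]_(j < n) G j t th).
Proof.
move=> H; elim: (index_enum 'I_n) => [|i s IH].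
  apply: converges_ext (converges_const 0); last by move=> t th; rewrite big_nil.
  by apply: ev_eq_refl => k t th; rewrite big_nil.
apply: converges_ext (converges_plus (H i) IH); last by move=> t th; rewrite big_cons.
by apply: ev_eq_refl => k t th; rewrite big_cons.
Qed.

Lemma converges_dot n (F F' : nat -> R -> R -> vec n) (G G' : R -> R -> vec n) :
  (forall j, converges (fun k t th => F k t th j) (fun t th => G t th j)) ->
  (forall j, converges (fun k t th => F' k t th j) (fun t th => G' t th j)) ->
  converges (fun k t th => dot (F k t th) (F' k t th)) (fun t th => dot (G t th) (G' t th)).
Proof. by move=> H H'; apply: converges_big => j; apply: converges_mult. Qed.

Definition smooth_map n (D : R -> Prop) (f : R -> R -> vec n) : Prop := forall j, smooth_on D (fun t th => f t th j).

Lemma smooth_map_dvec n D d (f : R -> R -> vec n) : smooth_map D f -> smooth_map D (dvec d f).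
Proof. by move=> H j; exact: smooth_on_partial (H j). Qed.

Lemma smooth_on_dot n D (f g : R -> R -> vec n) : open_dom D -> smooth_map D f -> smooth_map D g ->
  smooth_on D (fun t th => dot (f t th) (g t th)).
Proof. by move=> oD H H'; apply: smooth_on_big => // j; apply: smooth_on_mult. Qed.

Lemma partial_dot n D d (f g : R -> R -> vec n) t th : open_dom D -> smooth_map D f -> smooth_map D g -> D t ->
  partial d (fun t th => dot (f t th) (g t th)) t th
  = dot (dvec d f t th) (g t th) + dot (f t th) (dvec d g t th).
Proof.
move=> oD Hf Hg Dt; rewrite /dot -sum_plus.
elim: (index_enum 'I_n) => [|i s IH].
  rewrite big_nil (@partial_ext _ (fun _ _ => 0)) ?partial_const // => *; exact: big_nil.
rewrite big_cons -IH.
rewrite (@partial_ext _ (fun t th => f t th i * g t th i + \big[Rplus/0]_(j <- s) (f t th j * g t th j))); last first.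
  by move=> *; rewrite big_cons.
have S1 := smooth_on_mult oD (Hf i) (Hg i).
have S2 : smooth_on D (fun t th => \big[Rplus/0]_(j <- s) (f t th j * g t th j)).
  elim: (s) => [|j s' IHs].
    by apply: smooth_on_ext oD _ (smooth_on_const D 0) => u v _; rewrite big_nil.
  by apply: smooth_on_ext oD _ (smooth_on_plus oD (smooth_on_mult oD (Hf j) (Hg j)) IHs) => u v _; rewrite big_cons.
rewrite partial_plus; [|exact: smooth_on_ex S1 Dt|exact: smooth_on_ex S2 Dt].
congr (_ + _); rewrite partial_mult //; [exact: smooth_on_ex (Hf i) Dt|exact: smooth_on_ex (Hg i) Dt].
Qed.

Lemma exp_conf n (f : R -> R -> vec n) t th : 0 < normsq (dvec false f t th) ->
  exp (2 * conf_factor f t th) = normsq (dvec false f t th) /\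
  exp (- 2 * conf_factor f t th) = / normsq (dvec false f t th).
Proof.
move=> N0; rewrite /conf_factor.
have -> : 2 * (ln (normsq (dvec false f t th)) / 2) = ln (normsq (dvec false f t th)) by field.
have -> : - 2 * (ln (normsq (dvec false f t th)) / 2) = - ln (normsq (dvec false f t th)) by field.
by rewrite exp_Ropp exp_ln.
Qed.

(** Differentiating [|f_t|^2 = |f_th|^2] and [f_t . f_th = 0] shows that the flat Laplacian of a
    conformal map is normal; it is therefore the trace of the second fundamental form. *)
Lemma conformal_lap n D (f : R -> R -> vec n) t th j : open_dom D -> smooth_map D f ->
  (forall t th, D t -> conformal_immersion_at f t th) -> D t ->
  lap (fun s z => f s z j) t th = normsq (dvec false f t th) * mean_curv f t th j.
Proof.
move=> oD S C Dt; have [N0 [N1 N2]] := C t th Dt.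
pose W : vec n := fun j => lap (fun s z => f s z j) t th.
have S0 := smooth_map_dvec false S; have S1 := smooth_map_dvec true S.
have comm i : dvec false (dvec true f) t th i = dvec true (dvec false f) t th i.
  exact: smooth_on_comm oD (S i) Dt.
have E1 d : dot (dvec d (dvec true f) t th) (dvec true f t th) = dot (dvec d (dvec false f) t th) (dvec false f t th).
  have := @partial_ext_loc D _ _ d t th oD Dt (fun u v Du => proj1 (proj2 (C u v Du))).
  rewrite /normsq !(partial_dot d th oD) // (dot_sym (dvec true f t th)) (dot_sym (dvec false f t th)); lra.
have E2 d : dot (dvec d (dvec false f) t th) (dvec true f t th) + dot (dvec false f t th) (dvec d (dvec true f) t th) = 0.
  have := @partial_ext_loc D _ _ d t th oD Dt (fun u v Du => proj2 (proj2 (C u v Du))).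
  by rewrite !(partial_dot d th oD) // partial_const.
have Wd e : dot W (dvec e f t th) = dot (dvec false (dvec false f) t th) (dvec e f t th)
    + dot (dvec true (dvec true f) t th) (dvec e f t th).
  by rewrite -dot_plusl.
have W0 : dot W (dvec false f t th) = 0.
  rewrite Wd -(E1 false); have := E2 true.
  rewrite (dot_ext (x' := dvec false (dvec true f) t th) (y' := dvec true f t th) (fun i => esym (comm i)) (fun i => erefl)).
  by rewrite (dot_sym (dvec false f t th)); lra.
have W1 : dot W (dvec true f t th) = 0.
  rewrite Wd (E1 true); have := E2 false.
  rewrite (dot_sym (dvec false f t th)) (dot_ext (x := dvec false (dvec true f) t th) (x' := dvec true (dvec false f) t th) (y' := dvec false f t th) comm (fun i => erefl)).
  lra.
have [_ Ee] := exp_conf N0.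
rewrite /mean_curv Ee /sum2 /sff /normal_part Ee /sum2.
rewrite -Rmult_assoc Rinv_r; last lra.
move: (Wd false) (Wd true); rewrite W0 W1 => w0 w1.
have -> : lap (fun s z => f s z j) t th
  = dvec false (dvec false f) t th j + dvec true (dvec true f) t th j by [].
have -> : dot (dvec true (dvec true f) t th) (dvec false f t th)
  = - dot (dvec false (dvec false f) t th) (dvec false f t th) by lra.
have -> : dot (dvec true (dvec true f) t th) (dvec true f t th)
  = - dot (dvec false (dvec false f) t th) (dvec true f t th) by lra.
ring.
Qed.

(** ** Rescaling *)

Lemma Derive_affine (f : R -> R) (l c x : R) : Derive (fun z => l * (f z - c)) x = l * Derive f x.
Proof.
have -> : Derive f x = Derive (fun z => f z - c) x.
  by rewrite /Derive; congr (real _); apply: Lim_ext => h; congr (_ / _); ring.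
exact: Derive_scal.
Qed.

(** The difference quotients of the two sides agree, whether or not they converge. *)
Lemma partial_rescale l s c (F : R -> R -> R) d t th :
  partial d (fun u z => l * (F (s + u) z - c)) t th = l * partial d F (s + t) th.
Proof.
case: d => /=; first exact: (Derive_affine (fun z => F (s + t) z)).
rewrite (Derive_affine (fun u => F (s + u) th)); congr (_ * _).
by rewrite /Derive; congr (real _); apply: Lim_ext => h; rewrite Rplus_assoc.
Qed.

Definition affine_map n (l s : R) (c : vec n) (f : R -> R -> vec n) : R -> R -> vec n :=
  fun t th j => l * (f (s + t) th j - c j).

Lemma affine_map0E n l s (f : R -> R -> vec n) t th j : affine_map l s (fun _ => 0) f t th j = l * f (s + t) th j.
Proof. by rewrite /affine_map Rminus_0_r. Qed.

Lemma dvec_affine_map n d l s (c : vec n) f : dvec d (affine_map l s c f) = affine_map l s (fun _ => 0) (dvec d f).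
Proof.
apply: functional_extensionality => t; apply: functional_extensionality => th.
apply: functional_extensionality => j.
by rewrite affine_map0E; exact: (partial_rescale l s (c j) (fun u z => f u z j)).
Qed.

Lemma normsq_affine_map n d l s (c : vec n) f t th :
  normsq (dvec d (affine_map l s c f) t th) = l ^ 2 * normsq (dvec d f (s + t) th).
Proof. by rewrite dvec_affine_map -normsq_scal; apply: dot_ext => j; rewrite affine_map0E. Qed.

Lemma conformal_affine_map n l s (c : vec n) f t th : 0 < l ->
  conformal_immersion_at f (s + t) th -> conformal_immersion_at (affine_map l s c f) t th.
Proof.
move=> l0 [N0 [N1 N2]]; rewrite /conformal_immersion_at !normsq_affine_map N1; split.
  by apply: Rmult_lt_0_compat => //; exact: pow_lt.
split=> //; rewrite !dvec_affine_map.
rewrite (dot_ext (fun j => affine_map0E l s (dvec false f) t th j) (fun j => affine_map0E l s (dvec true f) t th j)).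
by rewrite dot_scall dot_sym dot_scall dot_sym N2; ring.
Qed.

Lemma sff_affine_map n l s (c : vec n) f p q t th j : 0 < l -> conformal_immersion_at f (s + t) th ->
  sff (affine_map l s c f) p q t th j = l * sff f p q (s + t) th j.
Proof.
move=> l0 C; have [N0 _] := C; have [N0' _] := conformal_affine_map c l0 C.
have [_ e1] := exp_conf N0; have [_ e2] := exp_conf N0'.
rewrite /sff /normal_part e1 e2 normsq_affine_map !dvec_affine_map affine_map0E /sum2.
have E r : dot (affine_map l s (fun _ => 0) (dvec p (dvec q f)) t th) (affine_map l s (fun _ => 0) (dvec r f) t th)
  = l ^ 2 * dot (dvec p (dvec q f) (s + t) th) (dvec r f (s + t) th).
  rewrite (dot_ext (fun j => affine_map0E l s (dvec p (dvec q f)) t th j) (fun j => affine_map0E l s (dvec r f) t th j)).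
  by rewrite dot_scall dot_sym dot_scall dot_sym; ring.
rewrite !dvec_affine_map !affine_map0E !E; field; split; lra.
Qed.

Lemma mean_curv_affine_map n l s (c : vec n) f t th j : 0 < l -> conformal_immersion_at f (s + t) th ->
  mean_curv (affine_map l s c f) t th j = / l * mean_curv f (s + t) th j.
Proof.
move=> l0 C; have [N0 _] := C; have [N0' _] := conformal_affine_map c l0 C.
have [_ e1] := exp_conf N0; have [_ e2] := exp_conf N0'.
rewrite /mean_curv /sum2 !(sff_affine_map c _ _ _ l0 C) e1 e2 normsq_affine_map; field; split; lra.
Qed.

(** Both sides of the equation have the weight [1 / l]: [e^(-2u)] contributes [l^(-2)], [H]
    contributes [1 / l], and [A] and [d f] contribute [l] each. *)
Lemma willmore_affine_map n l s (c : vec n) f T t th : 0 < l ->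
  (forall u z, 0 < u < T -> conformal_immersion_at f u z /\ willmore_at f u z) ->
  0 < s + t < T -> willmore_at (affine_map l s c f) t th.
Proof.
move=> l0 H Ht j.
pose O t := 0 < s + t < T.
have oO : open_dom O.
  move=> u [h1 h2].
  have d0 : 0 < Rmin (s + u) (T - (s + u)) by apply: Rmin_glb_lt; lra.
  exists (mkposreal _ d0) => v; rewrite /ball /= /AbsRing_ball /abs /minus /plus /opp /= => Hv.
  have := Rmin_l (s + u) (T - (s + u)); have := Rmin_r (s + u) (T - (s + u)).
  by move: Hv => /Rabs_def2 Hv; rewrite /O; lra.
have ext q F G : (forall t th, O t -> F t th = / l * G (s + t) th) ->
   forall t th, O t -> partial q F t th = / l * partial q G (s + t) th.
  move=> E u z Ou; rewrite (partial_ext_loc q z oO Ou E).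
  have := partial_rescale (/ l) s 0 G q u z => <-.
  by apply: partial_ext => *; rewrite Rminus_0_r.
have EH u z i : O u -> mean_curv (affine_map l s c f) u z i = / l * mean_curv f (s + u) z i.
  by move=> Ou; apply: mean_curv_affine_map => //; apply: (proj1 (H _ z Ou)).
have ES p q u z i : O u -> sff (affine_map l s c f) p q u z i = l * sff f p q (s + u) z i.
  by move=> Ou; apply: sff_affine_map => //; apply: (proj1 (H _ z Ou)).
have Ed d u z i : dvec d (affine_map l s c f) u z i = l * dvec d f (s + u) z i.
  by rewrite dvec_affine_map affine_map0E.
have L q : partial q (partial q (fun s0 z => mean_curv (affine_map l s c f) s0 z j)) t th
   = / l * partial q (partial q (fun s0 z => mean_curv f s0 z j)) (s + t) th.
  by apply: (ext) => // u z Ou; apply: (ext) => // u' z' Ou'; exact: EH.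
have R1 p q : partial q (fun s0 z => exp (- 2 * conf_factor (affine_map l s c f) s0 z)
            * dot (mean_curv (affine_map l s c f) s0 z) (sff (affine_map l s c f) p q s0 z) * dvec p (affine_map l s c f) s0 z j) t th
   = / l * partial q (fun s0 z => exp (- 2 * conf_factor f s0 z)
            * dot (mean_curv f s0 z) (sff f p q s0 z) * dvec p f s0 z j) (s + t) th.
  apply: (ext) => // u z Ou; have [C _] := H _ z Ou.
  have [N0 _] := C; have [N0' _] := conformal_affine_map c l0 C.
  have [_ e1] := exp_conf N0; have [_ e2] := exp_conf N0'.
  rewrite e1 e2 normsq_affine_map Ed.
  rewrite (dot_ext (fun i => EH u z i Ou) (fun i => ES p q u z i Ou)) dot_scall dot_sym dot_scall dot_sym.
  field; split; lra.
have R2 q : partial q (fun s0 z => normsq (mean_curv (affine_map l s c f) s0 z) * dvec q (affine_map l s c f) s0 z j) t th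
   = / l * partial q (fun s0 z => normsq (mean_curv f s0 z) * dvec q f s0 z j) (s + t) th.
  apply: (ext) => // u z Ou; rewrite Ed.
  rewrite /normsq (dot_ext (fun i => EH u z i Ou) (fun i => EH u z i Ou)) dot_scall dot_sym dot_scall.
  by field; lra.
have [_ W] := H _ th Ht; have {W} := W j.
rewrite /sum2 !L !R1 !R2 => W.
have -> : / l * partial false (partial false (fun s0 z => mean_curv f s0 z j)) (s + t) th
   + / l * partial true (partial true (fun s0 z => mean_curv f s0 z j)) (s + t) th
   = / l * (partial false (partial false (fun s0 z => mean_curv f s0 z j)) (s + t) th
   + partial true (partial true (fun s0 z => mean_curv f s0 z j)) (s + t) th) by ring.
rewrite W; ring.
Qed.

(** * The projections [F_i], [G_i] as resonant modes *)

Lemma Derive_shift (F : R -> R) s t : Derive F (s + t) = Derive (fun u => F (s + u)) t.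
Proof. by rewrite /Derive; congr (real _); apply: Lim_ext => h; rewrite Rplus_assoc. Qed.

Lemma fourier_coefE (m : nat) (F : R -> R -> R) (i : bool) (D : R -> Prop) s tau :
  open_dom D -> smooth_on D (fun t th => F (s + t) th) -> D tau ->
  let phi := if i then fourier_cos m F else fourier_sin m F in
  phi (s + tau) = / PI * fourier (fun t th => F (s + t) th) i (INR m) tau /\
  Derive phi (s + tau) = / PI * fourier (partial false (fun t th => F (s + t) th)) i (INR m) tau.
Proof.
move=> oD S Dt phi.
have E u : phi (s + u) = / PI * fourier (fun t th => F (s + t) th) i (INR m) u.
  by rewrite /phi; case: (i).
split=> //; rewrite Derive_shift (Derive_ext _ _ _ E) Derive_scal; congr (_ * _).
exact: is_derive_unique (fourier_derive _ _ oD S Dt).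
Qed.

Lemma projF_mode n (m : nat) L (i : nat) (f : R -> R -> vec n) j (D : R -> Prop) s tau t th :
  (0 < m)%N -> open_dom D -> smooth_on D (fun t th => f (s + t) th j) -> D tau -> midQ L i = s + tau ->
  projF m L i f (s + t) th j
  = mode (INR m) m (mode_coef (INR m) m (fun t th => f (s + t) th j) true tau)
      (mode_coef (INR m) m (fun t th => f (s + t) th j) false tau) t th.
Proof.
move=> m0 oD S Dt E.
have m1 : 0 < INR m by apply: lt_0_INR; apply/ltP.
have [c1 c2] := @fourier_coefE m (fun s z => f s z j) true D s tau oD S Dt.
have [s1 s2] := @fourier_coefE m (fun s z => f s z j) false D s tau oD S Dt.
rewrite /projF /gplus E c1 c2 s1 s2 /mode /mode_coef.
have -> : INR m * (s + t) - INR m * (s + tau) = INR m * t + - INR m * tau by ring.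
rewrite exp_plus; have PI0 := PI_RGT_0; field; split; lra.
Qed.

Lemma projG_mode n (m : nat) L (i : nat) (f : R -> R -> vec n) j (D : R -> Prop) s tau t th :
  (0 < m)%N -> open_dom D -> smooth_on D (fun t th => f (s + t) th j) -> D tau -> midQ L i = s + tau ->
  projG m L i f (s + t) th j
  = mode (- INR m) m (mode_coef (- INR m) m (fun t th => f (s + t) th j) true tau)
      (mode_coef (- INR m) m (fun t th => f (s + t) th j) false tau) t th.
Proof.
move=> m0 oD S Dt E.
have m1 : 0 < INR m by apply: lt_0_INR; apply/ltP.
have [c1 c2] := @fourier_coefE m (fun s z => f s z j) true D s tau oD S Dt.
have [s1 s2] := @fourier_coefE m (fun s z => f s z j) false D s tau oD S Dt.
rewrite /projG /gminus E c1 c2 s1 s2 /mode /mode_coef.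
have -> : - INR m * (s + t) + INR m * (s + tau) = - INR m * t + - - INR m * tau by ring.
rewrite exp_plus; have PI0 := PI_RGT_0; field; split; lra.
Qed.

(** The constant disappears because the mean of [cos (m th)] and [sin (m th)] is [0] for [m >= 1]. *)
Lemma mode_coef_affine (D : R -> Prop) mu m F a b i tau : (0 < m)%N -> mu <> 0 -> open_dom D -> smooth_on D F -> D tau ->
  mode_coef mu m (fun t th => a * F t th + b) i tau = a * mode_coef mu m F i tau.
Proof.
move=> m0 mu0 oD S Dt; rewrite /mode_coef.
have Sa := smooth_on_scal a oD S; have Sb := smooth_on_const D b.
have c0 : fourier (fun _ _ => b) i (INR m) tau = 0.
  have h : (0 < m)%N by [].
  rewrite /fourier /circ_int.
  transitivity (b * RInt (fun z => trig i (INR m) z) 0 (2 * PI)).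
    apply: (circ_int_scal (F := fun _ z => trig i (INR m) z) (D := D) b _ Dt); exact: smooth_on_trig.
  by case: (i) => /=; [rewrite RInt_cos_period|rewrite RInt_sin_period] => //; ring.
have c1 : fourier (fun _ _ => 0) i (INR m) tau = 0.
  rewrite /fourier (@circ_int_ext _ (fun _ _ => 0)) ?circ_int_const; [ring|by move=> *; ring].
rewrite (fourier_plus _ _ oD Sa Sb Dt) (fourier_scal _ _ _ oD S Dt) c0.
have -> : fourier (partial false (fun t th => a * F t th + b)) i (INR m) tau
  = fourier (fun t th => a * partial false F t th + 0) i (INR m) tau.
  apply: fourier_ext => z; rewrite partial_plus ?partial_scal ?partial_const //.
    exact: smooth_on_ex Sa Dt.
  exact: ex_partial_const.
have SFt := smooth_on_partial false S.
rewrite (fourier_plus _ _ oD (smooth_on_scal a oD SFt) (smooth_on_const D 0) Dt) (fourier_scal _ _ _ oD SFt Dt) c1.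
by rewrite /Rdiv; ring.
Qed.

Lemma mode_coef_ext (D : R -> Prop) mu m F G i tau : open_dom D -> D tau ->
  (forall t th, D t -> F t th = G t th) -> mode_coef mu m F i tau = mode_coef mu m G i tau.
Proof.
move=> oD Dt E; rewrite /mode_coef (@fourier_ext (partial false F) (partial false G)).
  by rewrite (@fourier_ext F G) // => z; exact: E.
by move=> z; exact: partial_ext_loc oD Dt E.
Qed.

Lemma smooth_on_minus D F G : open_dom D -> smooth_on D F -> smooth_on D G -> smooth_on D (fun t th => F t th - G t th).
Proof.
move=> oD SF SG; apply: (smooth_on_ext oD _ (smooth_on_plus oD SF (smooth_on_scal (-1) oD SG))) => t th _; ring.
Qed.

Lemma smooth_on_off_mode D mu m tau F : open_dom D -> smooth_on D F -> smooth_on D (off_mode mu m tau F).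
Proof. by move=> oD S; apply: smooth_on_minus => //; apply: smooth_on_tame; exact: tame_mode. Qed.

(** The refined bounds carry the weight of the conformal factor and concern all components
    together; the analysis is done for one component with the weight [exp (-2 mu t)]. *)
Lemma cell_weight n (mu L : R) (m : nat) (X : 'I_n -> funseq) (Wt : funseq) C :
  0 < L -> (forall i, ev_smooth (X i)) -> ev_smooth Wt ->
  (forall a, 0 < a -> eventually (fun k => forall t th, Rabs t <= a -> / 2 * exp (-2 * mu * t) <= Wt k t th)) ->
  (forall j : Z, eventually (fun k => int_cell L j
     (fun t th => Wt k t th * \big[Rplus/0]_(i < n) off_mode mu m (mid L j) (X i k) t th ^ 2) <= C)) ->
  forall i, exists C', forall j : Z, eventually (fun k => int_cell L j
     (fun t th => exp (-2 * mu * t) * off_mode mu m (mid L j) (X i k) t th ^ 2) <= C').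
Proof.
move=> L0 EX EW HW H i; exists (2 * C) => j.
pose a := Rabs (IZR j) * L + L + 1.
have a0 : 0 < a by have := Rabs_pos (IZR j) => h; have : 0 <= Rabs (IZR j) * L by [apply: Rmult_le_pos; lra]; rewrite /a; lra.
have oD := @open_strip a.
have Sc : seg_in (strip a) (IZR j * L) ((IZR j + 1) * L) by apply: seg_in_cell => //; rewrite /a; lra.
have EX' : eventually (fun k => forall i, smooth_on (strip a) (X i k)) by apply: eventually_ord => i'; exact: EX.
apply: filter_imp (filter_and _ _ (filter_and _ _ (H j) (HW a a0)) (filter_and _ _ EX' (EW a a0))).
move=> k [[Hk HWk] [SX SW]].
have SO i' : smooth_on (strip a) (fun t th => off_mode mu m (mid L j) (X i' k) t th ^ 2).
  by apply: (smooth_on_sq oD (smooth_on_off_mode mu m (mid L j) oD (SX i'))).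
have S1 : smooth_on (strip a) (fun t th => exp (-2 * mu * t) * off_mode mu m (mid L j) (X i k) t th ^ 2).
  by apply: smooth_on_mult => //; exact: smooth_on_exp.
have S2 : smooth_on (strip a) (fun t th => Wt k t th * \big[Rplus/0]_(i < n) off_mode mu m (mid L j) (X i k) t th ^ 2).
  by apply: smooth_on_mult => //; apply: smooth_on_big.
have : int_cell L j (fun t th => exp (-2 * mu * t) * off_mode mu m (mid L j) (X i k) t th ^ 2)
   <= int_cell L j (fun t th => 2 * (Wt k t th * \big[Rplus/0]_(i < n) off_mode mu m (mid L j) (X i k) t th ^ 2)).
  apply: (cyl_le oD Sc S1 (smooth_on_scal 2 oD S2)) => t th Ht.
  have w := HWk t th (Rlt_le _ _ (proj2 Sc t Ht)).
  have e0 := exp_pos (-2 * mu * t).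
  have := @sum_term n (fun i => off_mode mu m (mid L j) (X i k) t th ^ 2) i (fun i => pow2_ge_0 _).
  have := pow2_ge_0 (off_mode mu m (mid L j) (X i k) t th).
  move: (_ ^ 2) (\big[Rplus/0]_(_ < n) _) => x y x0 xy.
  have : / 2 * exp (-2 * mu * t) * x <= Wt k t th * y by apply: Rmult_le_compat; lra.
  lra.
by rewrite (cyl_scal _ oD Sc S2); lra.
Qed.

(** ** The expansion of the immersions *)

Definition model n (m : nat) (e : nat -> vec n) (t th : R) : vec n :=
  fun j => / INR m * exp (- INR m * t) * (cos (INR m * th) * e 1%N j + sin (INR m * th) * e 2%N j).

Lemma tame_model n m (e : nat -> vec n) j : tame (fun t th => model m e t th j).
Proof.
apply: tame_mult; first by apply: tame_mult; [exact: tame_const|exact: tame_exp].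
by apply: tame_plus; apply: tame_mult; try exact: tame_const; [exact: tame_cos|exact: tame_sin].
Qed.

Lemma dvec_model n m (e : nat -> vec n) t th j : (0 < m)%N ->
  dvec false (model m e) t th j = - exp (- INR m * t) * (cos (INR m * th) * e 1%N j + sin (INR m * th) * e 2%N j) /\
  dvec true (model m e) t th j = exp (- INR m * t) * (- sin (INR m * th) * e 1%N j + cos (INR m * th) * e 2%N j).
Proof.
move=> m0; have m1 : 0 < INR m by apply: lt_0_INR; apply/ltP.
by split; apply: is_derive_unique; rewrite /model; auto_derive => //; field; lra.
Qed.

Lemma away0_exp c : 0 <= c -> away0 (fun t _ => exp (-2 * c * t)).
Proof.
move=> c0 a Ha; exists (exp (- (2 * c * a))); split; first exact: exp_pos.
move=> t th Ht; rewrite Rabs_pos_eq; last exact: Rlt_le (exp_pos _).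
have : - (2 * c * a) <= -2 * c * t by have := Rle_trans _ _ _ (Rle_abs t) Ht; nra.
by case=> [h|->]; [apply: Rlt_le; exact: exp_increasing|lra].
Qed.

Lemma converges_half_exp (W : funseq) k : converges W (fun t _ => exp (k * t)) -> forall a, 0 < a ->
  eventually (fun i => forall t th, Rabs t <= a -> / 2 * exp (k * t) <= W i t th).
Proof.
move=> CW a Ha; pose d := / 2 * exp (- (Rabs k * a)).
have d0 : 0 < d by have := exp_pos (- (Rabs k * a)); rewrite /d; lra.
apply: filter_imp (converges_unif_conv CW Ha d0) => i H t th Ht.
have : - (Rabs k * a) <= k * t.
  have := Rle_abs (- (k * t)); rewrite Rabs_Ropp Rabs_mult.
  by have := Rmult_le_compat_l _ _ _ (Rabs_pos k) Ht; lra.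
have {}H := H t th Ht; move: H => /Rabs_def2; rewrite /d => H.
by case=> [/exp_increasing h|E]; [lra|rewrite -E in H *; lra].
Qed.

Lemma speed_limit n (m : nat) (fh : nat -> R -> R -> vec n) (e : nat -> vec n) : (0 < m)%N ->
  dot (e 1%N) (e 1%N) = 1 -> dot (e 2%N) (e 2%N) = 1 -> dot (e 1%N) (e 2%N) = 0 ->
  (forall j, converges (fun k t th => fh k t th j) (fun t th => model m e t th j)) ->
  converges (fun k t th => normsq (dvec false (fh k) t th)) (fun t _ => exp (-2 * INR m * t)).
Proof.
move=> m0 e11 e22 e12 Cf.
have := converges_dot (fun j => converges_partial false (Cf j)) (fun j => converges_partial false (Cf j)).
apply: converges_ext => [|t th]; first exact: ev_eq_refl.
rewrite -/(dvec false (model m e) t th).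
pose E := exp (- INR m * t); pose c := cos (INR m * th); pose s := sin (INR m * th).
rewrite (dot_ext (x' := fun j => (- E * c) * e 1%N j + (- E * s) * e 2%N j)
   (y' := fun j => (- E * c) * e 1%N j + (- E * s) * e 2%N j)).
- rewrite dot_lin (dot_sym (e 2%N)) e11 e22 e12.
  have -> : -2 * INR m * t = - INR m * t + - INR m * t by ring.
  rewrite exp_plus -/E; have := sin2_cos2 (INR m * th); rewrite /Rsqr -/c -/s => h.
  by have -> : - E * c * (- E * c) * 1 + - E * c * (- E * s) * 0 + - E * s * (- E * c) * 0 + - E * s * (- E * s) * 1 = E * E * (s * s + c * c) by [ring]; rewrite h; ring.
- by move=> j; have [-> _] := dvec_model e t th j m0; rewrite /E /c /s; ring.
- by move=> j; have [-> _] := dvec_model e t th j m0; rewrite /E /c /s; ring.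
Qed.

(** [lap f = e^(2u) H] and the convergence of [e^(2u)] and [H / eps] give the limit of the Laplacian of
    [X = f / eps + b]; the rest is [response_limit] with [mu = - m]. *)
Lemma expand_immersion n (m : nat) (L : R) (fh : nat -> R -> R -> vec n) (eps : nat -> R)
  (b : nat -> vec n) (e : nat -> vec n) (v1 v2 : vec n) :
  (0 < m)%N -> 0 < L ->
  converges (fun k t th => normsq (dvec false (fh k) t th)) (fun t _ => exp (-2 * INR m * t)) ->
  (forall j, converges (fun k t th => fh k t th j) (fun t th => model m e t th j)) ->
  (forall j, converges (fun k t th => mean_curv (fh k) t th j / eps k) (mode (INR m) m (v1 j) (v2 j))) ->
  (forall a, 0 < a -> eventually (fun k => forall t th, strip a t -> conformal_immersion_at (fh k) t th)) ->
  (forall j, ev_periodic (fun k t th => fh k t th j)) ->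
  let X := fun j k t th => / eps k * fh k t th j + b k j in
  (exists C, forall j : Z, eventually (fun k => int_cell L j
     (fun t th => / normsq (dvec false (fh k) t th) *
         \big[Rplus/0]_(i < n) off_mode (- INR m) m (mid L j) (X i k) t th ^ 2) <= C)) ->
  forall j, converges (fun k => off_mode (- INR m) m (L / 2) (X j k))
     (response (- INR m) m (L / 2) (- v1 j / (2 * INR m)) (- v2 j / (2 * INR m)) 0 0).
Proof.
move=> m0 L0 CN Cf CH Cc Pf X [C HC].
have m1 : 0 < INR m by apply: lt_0_INR; apply/ltP.
have AN := away0_exp (Rlt_le _ _ m1).
have CNi := converges_inv AN CN.
have EX j : ev_smooth (X j).
  have [E _] := Cf j; move=> a Ha; apply: filter_imp (E a Ha) => k S.
  apply: smooth_on_plus; [exact: open_strip|apply: smooth_on_scal S; exact: open_strip|exact: smooth_on_const].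
have EPX j : ev_periodic (X j).
  by move=> a Ha; apply: filter_imp (Pf j a Ha) => k P t th Dt; rewrite /X P.
have [EW _] := CNi.
have CNi' : converges (fun k t th => / normsq (dvec false (fh k) t th)) (fun t _ => exp (-2 * - INR m * t)).
  apply: converges_ext CNi => [|t th]; first exact: ev_eq_refl.
  by rewrite -exp_Ropp; congr exp; ring.
have HW := converges_half_exp CNi'.
move=> j.
have mu0 : (- INR m) ^ 2 = INR m ^ 2 by ring.
apply: (response_limit L0 m0 mu0 (EX j) (EPX j)); last first.
  exact: (cell_weight L0 EX EW HW HC j).
have := converges_mult CN (CH j).
apply: converges_ext => [a Ha|t th]; last first.
  rewrite /mode /forcing.
  have -> : exp (-2 * INR m * t) = exp (- INR m * t) * exp (- INR m * t).
    by rewrite -exp_plus; congr exp; ring.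
  have -> : exp (- INR m * t) * exp (- INR m * t) * (exp (INR m * t) * (v1 j * cos (INR m * th) + v2 j * sin (INR m * th)))
     = exp (- INR m * t) * (exp (- INR m * t) * exp (INR m * t)) * (v1 j * cos (INR m * th) + v2 j * sin (INR m * th)) by ring.
  by rewrite exp_mulN; field; lra.
have ES : eventually (fun k => forall i, smooth_on (strip a) (fun t th => fh k t th i)).
  by apply: eventually_ord => i; have [E _] := Cf i; exact: E.
apply: filter_imp (filter_and _ _ ES (Cc a Ha)) => k [S Ck] t th Ht.
have oD := @open_strip a.
have Eh := conformal_lap th j oD S Ck Ht.
have -> : lap (X j k) t th = / eps k * lap (fun s z => fh k s z j) t th.
  rewrite /lap /X.
  have H d : partial d (partial d (fun t th => / eps k * fh k t th j + b k j)) t th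
    = / eps k * partial d (partial d (fun t th => fh k t th j)) t th.
    rewrite -partial_scal; apply: (partial_ext_loc d th oD Ht) => u v Du.
    rewrite partial_plus ?partial_scal ?partial_const ?Rplus_0_r //.
      exact: smooth_on_ex (smooth_on_scal _ oD (S j)) Du.
    exact: ex_partial_const.
  by rewrite !H; ring.
rewrite Eh /Rdiv; ring.
Qed.

(** ** The expansion of the mean curvature *)

(** The limit immersion is [exp (- m t) / m] times this function for [a1 = e_1], [a2 = e_2]. *)
Definition model_dir (m a1 a2 th : R) : R := cos (m * th) * a1 + sin (m * th) * a2.

Definition model_normal (m a1 a2 th : R) : R := - sin (m * th) * a1 + cos (m * th) * a2.

(** [V . V] for [V = v_1 cos + v_2 sin], in terms of [al = |v_1|^2], [be = v_1 . v_2], [ga = |v_2|^2]. *)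
Definition bend_norm (m al be ga th : R) : R :=
  al * cos (m * th) ^ 2 + 2 * be * cos (m * th) * sin (m * th) + ga * sin (m * th) ^ 2.

(** [V . V'] divided by [m], for the same [V]. *)
Definition bend_cross (m al be ga th : R) : R :=
  be * (cos (m * th) ^ 2 - sin (m * th) ^ 2) + (ga - al) * cos (m * th) * sin (m * th).

Lemma cos_sin_3 x : cos (3 * x) = 4 * cos x ^ 3 - 3 * cos x /\ sin (3 * x) = 3 * sin x - 4 * sin x ^ 3.
Proof.
have -> : 3 * x = (x + x) + x by ring.
rewrite !cos_plus !sin_plus !cos_plus.
have H : sin x ^ 2 = 1 - cos x ^ 2 by have := sin2_cos2 x; rewrite /Rsqr; lra.
by split; ring [H].
Qed.

(** The right side of the Willmore equation for the limits: all its terms are [exp (m t)] times trigonometric polynomials of degree three, and reducing with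
    [sin^2 = 1 - cos^2] leaves the frequencies [m] and [3m]. The normalisation
    [|v_1|^2 + |v_2|^2 = 1] enters through the constant term of [V . V]. *)
Lemma bending_identity (m : nat) al be ga a1 a2 t th : (0 < m)%N -> al + ga = 1 ->
  let c := INR m in
  let S := bend_norm c al be ga in let X := bend_cross c al be ga in
  - 2 * ((partial false (fun t th => - / 2 * exp (c * t) * (S th * model_dir c a1 a2 th)) t th
        + partial false (fun t th => - / 2 * exp (c * t) * (X th * model_normal c a1 a2 th)) t th)
       + (partial true (fun t th => / 2 * exp (c * t) * (X th * model_dir c a1 a2 th)) t th
        + partial true (fun t th => / 2 * exp (c * t) * (S th * model_normal c a1 a2 th)) t th))
  + / 2 * (partial false (fun t th => - exp (c * t) * (S th * model_dir c a1 a2 th)) t th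
         + partial true (fun t th => exp (c * t) * (S th * model_normal c a1 a2 th)) t th)
  = forcing c m
     (/ 2 * (a1 * (/ 2 + (al - ga) / 2) + a2 * be)) (/ 2 * (a1 * be + a2 * (/ 2 - (al - ga) / 2)))
     (- / (8 * c) * (a1 * (al - ga) - a2 * (2 * be))) (- / (8 * c) * (a1 * (2 * be) + a2 * (al - ga))) t th.
Proof.
move=> m0 E c S X; have c0 : 0 < c by apply: lt_0_INR; apply/ltP.
rewrite {}/S {}/X; have -> : ga = 1 - al by lra.
move: E => _.
pose C := cos (c * th); pose N := sin (c * th); pose E := exp (c * t).
have H : N ^ 2 = 1 - C ^ 2 by have := sin2_cos2 (c * th); rewrite /Rsqr /N /C; lra.
have t1 F : partial false (fun t th => - / 2 * exp (c * t) * F th) t th = - / 2 * c * E * F th.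
  by apply: is_derive_unique; rewrite /E; auto_derive => //; ring.
have t2 F : partial false (fun t th => - exp (c * t) * F th) t th = - c * E * F th.
  by apply: is_derive_unique; rewrite /E; auto_derive => //; ring.
have T1 := t1 (fun th => bend_norm c al be (1 - al) th * model_dir c a1 a2 th).
have T2 := t1 (fun th => bend_cross c al be (1 - al) th * model_normal c a1 a2 th).
have T3 := t2 (fun th => bend_norm c al be (1 - al) th * model_dir c a1 a2 th).
cbv beta in T1, T2, T3; rewrite T1 T2 T3 {T1 T2 T3 t1 t2}.
have -> : partial true (fun t th => / 2 * exp (c * t) * (bend_cross c al be (1 - al) th * model_dir c a1 a2 th)) t th
  = / 2 * E * (c * (be * (-4 * C * N) + (1 - al - al) * (C ^ 2 - N ^ 2)) * (C * a1 + N * a2)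
     + (be * (C ^ 2 - N ^ 2) + (1 - al - al) * C * N) * (c * (- N * a1 + C * a2))).
  by apply: is_derive_unique; rewrite /bend_cross /model_dir /E /C /N; auto_derive => //; ring.
have dS (g : R -> R) :
  partial true (fun t th => g t * (bend_norm c al be (1 - al) th * model_normal c a1 a2 th)) t th
  = g t * (c * (-2 * al * C * N + 2 * be * (C ^ 2 - N ^ 2) + 2 * (1 - al) * N * C) * (- N * a1 + C * a2)
     + (al * C ^ 2 + 2 * be * C * N + (1 - al) * N ^ 2) * (c * (- C * a1 - N * a2))).
  by apply: is_derive_unique; rewrite /bend_norm /model_normal /C /N; auto_derive => //; ring.
have D1 := dS (fun t => / 2 * exp (c * t)); have D2 := dS (fun t => exp (c * t)).
cbv beta in D1, D2; rewrite D1 D2 {D1 D2 dS}.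
rewrite /forcing -/c.
have -> : 3 * c * th = 3 * (c * th) by ring.
have [-> ->] := cos_sin_3 (c * th).
rewrite /bend_norm /bend_cross /model_dir /model_normal -/C -/N -/E.
have -> : forall A1 A2 A3 A4 : R, E * (2 * c * A1 + (c ^ 2 - 9 * c ^ 2) * (- / (8 * c) * A2 * A3 + - / (8 * c) * A4 * (3 * N - 4 * N ^ 3)))
   = E * c * (2 * A1 + (A2 * A3 + A4 * (3 * N - 4 * N ^ 3))) by move=> *; field; lra.
clearbody C N E; clearbody c.
field [H].
Qed.

Definition mode_sign (m : nat) (p q : bool) : R := if p && q then INR m else - INR m.

Lemma partial_th_mode mu m c1 c2 t th :
  partial true (mode mu m c1 c2) t th = INR m * mode mu m c2 (- c1) t th.
Proof. by apply: is_derive_unique; rewrite /mode; auto_derive => //; ring. Qed.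

(** The second derivatives of the mode [exp (- m t)] are multiples of its first ones. That is why
    this mode, although it is not small, contributes nothing to the second fundamental form. *)
Lemma mode_second m c1 c2 p q t th :
  partial p (partial q (mode (- INR m) m c1 c2)) t th
  = mode_sign m p q * partial (p (+) q) (mode (- INR m) m c1 c2) t th.
Proof.
have Et a b : partial false (mode (- INR m) m a b) = (fun t th => - INR m * mode (- INR m) m a b t th).
  by apply: fun2_ext => u v; exact: partial_t_mode.
have Eh a b : partial true (mode (- INR m) m a b) = (fun t th => INR m * mode (- INR m) m b (- a) t th).
  by apply: fun2_ext => u v; exact: partial_th_mode.
have Es d k a b : partial d (fun t th => k * mode (- INR m) m a b t th) t th = k * partial d (mode (- INR m) m a b) t th.
  exact: partial_scal.
by case: p; case: q; rewrite /mode_sign ?[partial true (mode _ _ _ _)]Eh ?[partial false (mode _ _ _ _)]Et Es ?partial_t_mode ?partial_th_mode /mode /=; ring.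
Qed.

(** The limit of [A_pq / eps]: [exp (- m t) / 2] times [V] on the diagonal, and times
    [- V' / m] off it. *)
Definition model_sff (m : nat) (x1 x2 : R) (p q : bool) (t th : R) : R :=
  if p (+) q then - / 2 * exp (- INR m * t) * (- sin (INR m * th) * x1 + cos (INR m * th) * x2)
  else / 2 * exp (- INR m * t) * (cos (INR m * th) * x1 + sin (INR m * th) * x2).

Lemma response_second m tau x1 x2 p q t th : (0 < m)%N ->
  let phi := response (- INR m) m tau (- x1 / (2 * INR m)) (- x2 / (2 * INR m)) 0 0 in
  partial p (partial q phi) t th - mode_sign m p q * partial (p (+) q) phi t th = model_sff m x1 x2 p q t th.
Proof.
move=> m0 phi; rewrite {}/phi; have c0 : 0 < INR m by apply: lt_0_INR; apply/ltP.
set y1 := - x1 / (2 * INR m); set y2 := - x2 / (2 * INR m).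
have Et a b : partial false (response (- INR m) m tau a b 0 0)
   = (fun t th => - INR m * response (- INR m) m tau a b 0 0 t th + mode (- INR m) m a b t th).
  by apply: fun2_ext => u v; exact: partial_t_response.
have Eh a b : partial true (response (- INR m) m tau a b 0 0)
   = (fun t th => INR m * response (- INR m) m tau b (- a) 0 0 t th).
  by apply: fun2_ext => u v; apply: is_derive_unique; rewrite /response; auto_derive => //; ring.
have sR a b d u v : ex_partial d (fun t th => - INR m * response (- INR m) m tau a b 0 0 t th) u v.
  by apply: (@smooth_on_ex all_t) => //; apply: smooth_on_tame; apply: tame_scal; exact: tame_response.
have sH a b d u v : ex_partial d (mode (- INR m) m a b) u v.
  by apply: (@smooth_on_ex all_t) => //; apply: smooth_on_tame; exact: tame_mode.
have Es d k a b : partial d (fun t th => k * response (- INR m) m tau a b 0 0 t th) t th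
   = k * partial d (response (- INR m) m tau a b 0 0) t th by exact: partial_scal.
have Ep d a b : partial d (fun t th => - INR m * response (- INR m) m tau a b 0 0 t th + mode (- INR m) m a b t th) t th
   = - INR m * partial d (response (- INR m) m tau a b 0 0) t th + partial d (mode (- INR m) m a b) t th.
  by rewrite partial_plus // Es.
case: p; case: q; rewrite /mode_sign /model_sff.
- rewrite (Eh y1 y2) Es Eh -[true (+) true]/false Et; rewrite /= /response /mode /y1 /y2; field; lra.
- rewrite (Et y1 y2) Ep -[true (+) false]/true Eh partial_th_mode; rewrite /= /response /mode /y1 /y2; field; lra.
- rewrite -[false (+) true]/true (Eh y1 y2) Es Et; rewrite /= /response /mode /y1 /y2; field; lra.
- rewrite -[false (+) false]/false (Et y1 y2) Ep Et partial_t_mode; rewrite /= /response /mode /y1 /y2; field; lra.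
Qed.

(** Taking the normal part is linear and kills the tangent vector [d_r f]. *)
Lemma sff_decomp n (f : R -> R -> vec n) p q t th (a k : R) (B : vec n) r j :
  conformal_immersion_at f t th ->
  (forall i, dvec p (dvec q f) t th i = a * B i + k * dvec r f t th i) ->
  sff f p q t th j = a * (B j - (/ normsq (dvec false f t th) * dot B (dvec false f t th) * dvec false f t th j
     + / normsq (dvec false f t th) * dot B (dvec true f t th) * dvec true f t th j)).
Proof.
move=> C H; have [N0 [N1 N2]] := C; have [_ Ee] := exp_conf N0.
have D e : dot (dvec p (dvec q f) t th) (dvec e f t th)
   = a * dot B (dvec e f t th) + k * dot (dvec r f t th) (dvec e f t th).
  by rewrite (dot_ext H (fun _ => erefl)) dot_plusl !dot_scall.
rewrite /sff /normal_part Ee /sum2 H !D.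
rewrite /normsq in N0 N1 *.
case: r {H D} => /=.
- rewrite N1 (dot_sym (dvec true f t th)) N2; field; lra.
- rewrite N2; field; lra.
Qed.

(** By [mode_second] the second derivatives of the immersion are [eps B] plus a tangential
    vector, where [B] is formed from the rescaled remainder [Zf]; in the limit [B] lies in the span
    of [v_1] and [v_2] and is normal already. *)
Lemma sff_limit n (m : nat) (tau : R) (fh : nat -> R -> R -> vec n) (eps : nat -> R)
  (Zf : 'I_n -> funseq) (e : nat -> vec n) (v1 v2 : vec n) :
  (0 < m)%N ->
  dot v1 (e 1%N) = 0 -> dot v1 (e 2%N) = 0 -> dot v2 (e 1%N) = 0 -> dot v2 (e 2%N) = 0 ->
  eventually (fun k => eps k <> 0) ->
  (forall j, converges (fun k t th => fh k t th j) (fun t th => model m e t th j)) ->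
  converges (fun k t th => normsq (dvec false (fh k) t th)) (fun t _ => exp (-2 * INR m * t)) ->
  (forall a, 0 < a -> eventually (fun k => forall t th, strip a t -> conformal_immersion_at (fh k) t th)) ->
  (forall j, converges (Zf j) (response (- INR m) m tau (- v1 j / (2 * INR m)) (- v2 j / (2 * INR m)) 0 0)) ->
  (forall j, exists c1 c2 d : nat -> R, eventually (fun k => forall t th,
      fh k t th j = eps k * Zf j k t th + mode (- INR m) m (c1 k) (c2 k) t th + d k)) ->
  forall p q i, converges (fun k t th => sff (fh k) p q t th i / eps k) (model_sff m (v1 i) (v2 i) p q).
Proof.
move=> m0 v1e1 v1e2 v2e1 v2e2 Heps Cf CN Cc CZ HZ.
set c := INR m; have c0 : 0 < c by apply: lt_0_INR; apply/ltP.
have CNi := converges_inv (away0_exp (Rlt_le _ _ c0)) CN.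
pose B p q i k t th := partial p (partial q (Zf i k)) t th - mode_sign m p q * partial (p (+) q) (Zf i k) t th.
have CB p q i : converges (B p q i) (model_sff m (v1 i) (v2 i) p q).
  have := converges_minus (converges_partial p (converges_partial q (CZ i))) (converges_scal (mode_sign m p q) (converges_partial (p (+) q) (CZ i))).
  by apply: converges_ext => [|t th]; [exact: ev_eq_refl|exact: response_second].
have bend_perp p q t th d : dot (fun i => model_sff m (v1 i) (v2 i) p q t th) (dvec d (model m e) t th) = 0.
  have [x1 [x2 Ex]] : exists x1 x2, forall i, model_sff m (v1 i) (v2 i) p q t th = x1 * v1 i + x2 * v2 i.
    rewrite /model_sff; case: (p (+) q).
    - by exists (/ 2 * exp (- c * t) * sin (c * th)), (- / 2 * exp (- c * t) * cos (c * th)) => i; rewrite -/c; ring.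
    - by exists (/ 2 * exp (- c * t) * cos (c * th)), (/ 2 * exp (- c * t) * sin (c * th)) => i; rewrite -/c; ring.
  have [y1 [y2 Ey]] : exists y1 y2, forall i, dvec d (model m e) t th i = y1 * e 1%N i + y2 * e 2%N i.
    case: d.
    - exists (- exp (- c * t) * sin (c * th)), (exp (- c * t) * cos (c * th)) => i.
      by have [_ ->] := dvec_model e t th i m0; rewrite -/c; ring.
    - exists (- exp (- c * t) * cos (c * th)), (- exp (- c * t) * sin (c * th)) => i.
      by have [-> _] := dvec_model e t th i m0; rewrite -/c; ring.
  by rewrite (dot_ext Ex Ey) dot_lin v1e1 v1e2 v2e1 v2e2; ring.
move=> p q i.
have Cd d := converges_dot (F := fun k t th i => B p q i k t th) (F' := fun k => dvec d (fh k))
   (CB p q) (fun i => converges_partial d (Cf i)).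
have T d := converges_mult (converges_mult CNi (Cd d)) (converges_partial d (Cf i)).
apply: converges_ext (converges_minus (CB p q i) (converges_plus (T false) (T true))).
- move=> a Ha.
  have EZ : eventually (fun k => forall i', smooth_on (strip a) (Zf i' k)).
    by apply: eventually_ord => i'; have [E _] := CZ i'; exact: E.
  have ED : eventually (fun k => forall i', exists c1 c2 d, forall t th,
      fh k t th i' = eps k * Zf i' k t th + mode (- c) m c1 c2 t th + d).
    apply: eventually_ord => i'; have [c1 [c2 [d H]]] := HZ i'.
    by apply: filter_imp H => k H; exists (c1 k), (c2 k), (d k).
  apply: filter_imp (filter_and _ _ (filter_and _ _ EZ ED) (filter_and _ _ Heps (Cc a Ha))).
  move=> k [[SZ D] [ne Ck]] t th Ht; have oD := @open_strip a.
  rewrite (@sff_decomp _ _ p q t th (eps k) (mode_sign m p q) (fun i => B p q i k t th) (p (+) q) i (Ck t th Ht)).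
    by have -> : forall x, eps k * x / eps k = x by move=> x; field.
  move=> i'; have [c1 [c2 [d E]]] := D i'.
  have Sh : smooth_on (strip a) (mode (- c) m c1 c2) by apply: smooth_on_tame; exact: tame_mode.
  have E1 d' u v : strip a u -> partial d' (fun t th => fh k t th i') u v
      = eps k * partial d' (Zf i' k) u v + partial d' (mode (- c) m c1 c2) u v.
    move=> Du; have S1 := smooth_on_scal (eps k) oD (SZ i'); have S2 := smooth_on_plus oD S1 Sh.
    rewrite (@partial_ext _ (fun t th => (eps k * Zf i' k t th + mode (- c) m c1 c2 t th) + d)) //.
    rewrite partial_plus ?partial_const; [|exact: smooth_on_ex S2 Du|exact: ex_partial_const].
    rewrite partial_plus ?partial_scal; [ring|exact: smooth_on_ex S1 Du|exact: smooth_on_ex Sh Du].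
  have E2 : partial p (partial q (fun t th => fh k t th i')) t th
     = eps k * partial p (partial q (Zf i' k)) t th + partial p (partial q (mode (- c) m c1 c2)) t th.
    rewrite (partial_ext_loc p th oD Ht (E1 q)).
    have S1 := smooth_on_scal (eps k) oD (smooth_on_partial q (SZ i')).
    rewrite partial_plus ?partial_scal //; [exact: smooth_on_ex S1 Ht|exact: smooth_on_ex (smooth_on_partial q Sh) Ht].
  rewrite /dvec E2 E1 // mode_second -/c /B; ring.
- move=> t th.
  have b0 := bend_perp p q t th false; have b1 := bend_perp p q t th true.
  rewrite /dvec in b0 b1.
  by rewrite b0 b1; ring.
Qed.

(** By conformality [H] is the quotient of [lap f] by [|f_t|^2], which are periodic. *)
Lemma periodic_mean_curv n (fh : nat -> R -> R -> vec n) :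
  (forall j, ev_smooth (fun k t th => fh k t th j)) -> (forall j, ev_periodic (fun k t th => fh k t th j)) ->
  (forall a, 0 < a -> eventually (fun k => forall t th, strip a t -> conformal_immersion_at (fh k) t th)) ->
  forall j, ev_periodic (fun k t th => mean_curv (fh k) t th j).
Proof.
move=> Ef Pf Cc j a Ha.
have ESf : eventually (fun k => smooth_map (strip a) (fh k)) by apply: eventually_ord => i; exact: Ef.
have EPf : eventually (fun k => forall i, periodic_on (strip a) (fun t th => fh k t th i)).
  by apply: eventually_ord => i; exact: Pf.
apply: filter_imp (filter_and _ _ (filter_and _ _ ESf EPf) (Cc a Ha)) => k [[S P] Ck] t th Ht.
have oD := @open_strip a.
have Pd d i : dvec d (fh k) t (th + 2 * PI) i = dvec d (fh k) t th i.
  exact: (periodic_partial d oD (S i) (P i) th Ht).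
have Plap i : lap (fun s z => fh k s z i) t (th + 2 * PI) = lap (fun s z => fh k s z i) t th.
  rewrite /lap; congr (_ + _).
  - exact: (periodic_partial false oD (smooth_on_partial false (S i)) (periodic_partial false oD (S i) (P i)) th Ht).
  - exact: (periodic_partial true oD (smooth_on_partial true (S i)) (periodic_partial true oD (S i) (P i)) th Ht).
have E1 := conformal_lap (th + 2 * PI) j oD S Ck Ht; have E2 := conformal_lap th j oD S Ck Ht.
have N0 : 0 < normsq (dvec false (fh k) t th) := (Ck t th Ht).1.
have EN : normsq (dvec false (fh k) t (th + 2 * PI)) = normsq (dvec false (fh k) t th).
  by apply: dot_ext => i; exact: Pd.
apply: (Rmult_eq_reg_l (normsq (dvec false (fh k) t th))); last exact: Rgt_not_eq.
by rewrite -E2 -{1}EN -E1 Plap.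
Qed.

(** The right side of the Willmore equation is quadratic in [(H, A)], whose quotients by [eps]
    converge. *)
Lemma lap_mean_curv_limit n (m : nat) (fh : nat -> R -> R -> vec n) (eps : nat -> R)
  (e : nat -> vec n) (v1 v2 : vec n) :
  (0 < m)%N -> normsq v1 + normsq v2 = 1 -> eventually (fun k => eps k <> 0) ->
  (forall j, converges (fun k t th => fh k t th j) (fun t th => model m e t th j)) ->
  (forall j, converges (fun k t th => mean_curv (fh k) t th j / eps k) (mode (INR m) m (v1 j) (v2 j))) ->
  converges (fun k t th => normsq (dvec false (fh k) t th)) (fun t _ => exp (-2 * INR m * t)) ->
  (forall a, 0 < a -> eventually (fun k => forall t th, strip a t -> conformal_immersion_at (fh k) t th)) ->
  (forall a, 0 < a -> eventually (fun k => forall t th, strip a t -> willmore_at (fh k) t th)) ->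
  (forall p q i, converges (fun k t th => sff (fh k) p q t th i / eps k) (model_sff m (v1 i) (v2 i) p q)) ->
  let X := fun j k t th => mean_curv (fh k) t th j / eps k ^ 2 in
  let c := INR m in let al := normsq v1 in let be := dot v1 v2 in let ga := normsq v2 in
  forall j, let a1 := e 1%N j in let a2 := e 2%N j in
  converges (fun k => lap (X j k))
    (forcing c m
       (/ 2 * (a1 * (/ 2 + (al - ga) / 2) + a2 * be)) (/ 2 * (a1 * be + a2 * (/ 2 - (al - ga) / 2)))
       (- / (8 * c) * (a1 * (al - ga) - a2 * (2 * be))) (- / (8 * c) * (a1 * (2 * be) + a2 * (al - ga)))).
Proof.
move=> m0 vv Heps Cf CH CN Cc Cw CA X c al be ga.
have c0 : 0 < c by apply: lt_0_INR; apply/ltP.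
have CNi := converges_inv (away0_exp (Rlt_le _ _ c0)) CN.
have ie t : / exp (-2 * c * t) = exp (c * t) * exp (c * t).
  by rewrite -exp_Ropp -exp_plus; congr exp; ring.
pose Hs k t th i := mean_curv (fh k) t th i / eps k.
pose As p q k t th i := sff (fh k) p q t th i / eps k.
have CG p q j := converges_mult (converges_mult CNi (converges_dot (F := Hs) (F' := As p q) CH (CA p q))) (converges_partial p (Cf j)).
have CK q j := converges_mult (converges_dot (F := Hs) (F' := Hs) CH CH) (converges_partial q (Cf j)).
move=> j a1 a2.
have aga : al + ga = 1 by [].
have dotHA p q t th : dot (fun i => mode c m (v1 i) (v2 i) t th) (fun i => model_sff m (v1 i) (v2 i) p q t th)
   = if p (+) q then - / 2 * bend_cross c al be ga th else / 2 * bend_norm c al be ga th.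
  have Eh i : mode c m (v1 i) (v2 i) t th = (exp (c * t) * cos (c * th)) * v1 i + (exp (c * t) * sin (c * th)) * v2 i.
    by rewrite /mode -/c; ring.
  have en := exp_mulN c t.
  have fin x : exp (c * t) * (exp (- c * t) * x) = x by rewrite -Rmult_assoc (Rmult_comm (exp _)) en; ring.
  rewrite /model_sff -/c; case: (p (+) q).
  - rewrite (dot_ext Eh (y' := fun i => (/ 2 * exp (- c * t) * sin (c * th)) * v1 i + (- / 2 * exp (- c * t) * cos (c * th)) * v2 i)).
      rewrite dot_lin (dot_sym v2 v1) -/(normsq v1) -/(normsq v2) -/al -/be -/ga.
      by rewrite -[RHS]fin /bend_cross; ring.
    by move=> i; ring.
  - rewrite (dot_ext Eh (y' := fun i => (/ 2 * exp (- c * t) * cos (c * th)) * v1 i + (/ 2 * exp (- c * t) * sin (c * th)) * v2 i)).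
      rewrite dot_lin (dot_sym v2 v1) -/(normsq v1) -/(normsq v2) -/al -/be -/ga.
      by rewrite -[RHS]fin /bend_norm; ring.
    by move=> i; ring.
have dotHH t th : dot (fun i => mode c m (v1 i) (v2 i) t th) (fun i => mode c m (v1 i) (v2 i) t th)
   = exp (c * t) * exp (c * t) * bend_norm c al be ga th.
  have Eh i : mode c m (v1 i) (v2 i) t th = (exp (c * t) * cos (c * th)) * v1 i + (exp (c * t) * sin (c * th)) * v2 i.
    by rewrite /mode -/c; ring.
  rewrite (dot_ext Eh Eh) dot_lin (dot_sym v2 v1) -/(normsq v1) -/(normsq v2) -/al -/be -/ga /bend_norm; ring.
have fp t th : partial false (fun t th => model m e t th j) t th = - exp (- c * t) * model_dir c a1 a2 th.
  by have [E _] := dvec_model e t th j m0; exact: E.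
have ft t th : partial true (fun t th => model m e t th j) t th = exp (- c * t) * model_normal c a1 a2 th.
  by have [_ E] := dvec_model e t th j m0; exact: E.
have red t x : exp (c * t) * exp (c * t) * (exp (- c * t) * x) = exp (c * t) * x.
  have -> : exp (c * t) * exp (c * t) * (exp (- c * t) * x) = exp (c * t) * (exp (- c * t) * exp (c * t)) * x by ring.
  by rewrite exp_mulN; ring.
have G p q : converges (fun k t th => / normsq (dvec false (fh k) t th) * dot (Hs k t th) (As p q k t th)
      * partial p (fun t th => fh k t th j) t th)
    (fun t th => exp (c * t) * ((if p (+) q then - / 2 * bend_cross c al be ga th else / 2 * bend_norm c al be ga th)
      * (if p then model_normal c a1 a2 th else - model_dir c a1 a2 th))).
  apply: converges_ext (CG p q j) => [|t th]; first exact: ev_eq_refl.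
  rewrite dotHA -/c ie -[RHS]red; move: (if p (+) q then _ else _) => x.
  by case: (p); rewrite ?fp ?ft; ring.
have K q : converges (fun k t th => dot (Hs k t th) (Hs k t th) * partial q (fun t th => fh k t th j) t th)
    (fun t th => exp (c * t) * (bend_norm c al be ga th * (if q then model_normal c a1 a2 th else - model_dir c a1 a2 th))).
  apply: converges_ext (CK q j) => [|t th]; first exact: ev_eq_refl.
  rewrite dotHH -[RHS]red.
  by case: (q); rewrite ?fp ?ft; ring.
have gG p q (g : R -> R -> R) : (forall t th, exp (c * t) * ((if p (+) q then - / 2 * bend_cross c al be ga th else / 2 * bend_norm c al be ga th)
      * (if p then model_normal c a1 a2 th else - model_dir c a1 a2 th)) = g t th) ->
    converges (partial_seq q (fun k t th => / normsq (dvec false (fh k) t th) * dot (Hs k t th) (As p q k t th)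
      * partial p (fun t th => fh k t th j) t th)) (partial q g).
  by move=> E; apply: converges_partial; apply: converges_ext (G p q) => //; exact: ev_eq_refl.
have gK q (g : R -> R -> R) : (forall t th, exp (c * t) * (bend_norm c al be ga th * (if q then model_normal c a1 a2 th else - model_dir c a1 a2 th)) = g t th) ->
    converges (partial_seq q (fun k t th => dot (Hs k t th) (Hs k t th) * partial q (fun t th => fh k t th j) t th)) (partial q g).
  by move=> E; apply: converges_partial; apply: converges_ext (K q) => //; exact: ev_eq_refl.
have Gff := gG false false (fun t th => - / 2 * exp (c * t) * (bend_norm c al be ga th * model_dir c a1 a2 th)) (fun t th => ltac:(rewrite /=; ring)).
have Gtf := gG true false (fun t th => - / 2 * exp (c * t) * (bend_cross c al be ga th * model_normal c a1 a2 th)) (fun t th => ltac:(rewrite /=; ring)).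
have Gft := gG false true (fun t th => / 2 * exp (c * t) * (bend_cross c al be ga th * model_dir c a1 a2 th)) (fun t th => ltac:(rewrite /=; ring)).
have Gtt := gG true true (fun t th => / 2 * exp (c * t) * (bend_norm c al be ga th * model_normal c a1 a2 th)) (fun t th => ltac:(rewrite /=; ring)).
have Kf := gK false (fun t th => - exp (c * t) * (bend_norm c al be ga th * model_dir c a1 a2 th)) (fun t th => ltac:(rewrite /=; ring)).
have Kt := gK true (fun t th => exp (c * t) * (bend_norm c al be ga th * model_normal c a1 a2 th)) (fun t th => ltac:(rewrite /=; ring)).
apply: converges_ext (converges_plus (converges_scal (- 2) (converges_plus (converges_plus Gff Gtf) (converges_plus Gft Gtt)))
  (converges_scal (/ 2) (converges_plus Kf Kt))); last by move=> t th; exact: (bending_identity be a1 a2 t th m0 aga).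
move=> a Ha.
apply: filter_imp (filter_and _ _ Heps (filter_and _ _ (Cc a Ha) (Cw a Ha))) => k [ne [Ck Wk]] t th Ht.
have oD := @open_strip a.
have Elap : lap (X j k) t th = / eps k ^ 2 * lap (fun s z => mean_curv (fh k) s z j) t th.
  have H d : partial d (partial d (X j k)) t th = / eps k ^ 2 * partial d (partial d (fun s z => mean_curv (fh k) s z j)) t th.
    rewrite -partial_scal; apply: partial_ext => u v; rewrite -partial_scal.
    by apply: partial_ext => u' v'; rewrite /X /Rdiv; ring.
  by rewrite /lap !H; ring.
have EG p q : partial q (fun s z => exp (- 2 * conf_factor (fh k) s z)
            * dot (mean_curv (fh k) s z) (sff (fh k) p q s z) * dvec p (fh k) s z j) t th
   = eps k ^ 2 * partial_seq q (fun k t th => / normsq (dvec false (fh k) t th) * dot (Hs k t th) (As p q k t th)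
      * partial p (fun t th => fh k t th j) t th) k t th.
  rewrite /partial_seq -partial_scal; apply: (partial_ext_loc q th oD Ht) => u v Du.
  have [_ ->] := exp_conf (Ck u v Du).1.
  have -> : dot (mean_curv (fh k) u v) (sff (fh k) p q u v) = eps k * (eps k * dot (Hs k u v) (As p q k u v)).
    rewrite (dot_ext (x' := fun i => eps k * Hs k u v i) (y' := fun i => eps k * As p q k u v i)).
    - by rewrite dot_scall dot_sym dot_scall dot_sym.
    - by move=> i; rewrite /Hs; field.
    - by move=> i; rewrite /As; field.
  by rewrite /dvec; ring.
have EK q : partial q (fun s z => normsq (mean_curv (fh k) s z) * dvec q (fh k) s z j) t th
   = eps k ^ 2 * partial_seq q (fun k t th => dot (Hs k t th) (Hs k t th) * partial q (fun t th => fh k t th j) t th) k t th.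
  rewrite /partial_seq -partial_scal; apply: partial_ext => u v.
  have -> : normsq (mean_curv (fh k) u v) = eps k * (eps k * dot (Hs k u v) (Hs k u v)).
    rewrite /normsq (dot_ext (x' := fun i => eps k * Hs k u v i) (y' := fun i => eps k * Hs k u v i)).
    - by rewrite dot_scall dot_sym dot_scall.
    - by move=> i; rewrite /Hs; field.
    - by move=> i; rewrite /Hs; field.
  by rewrite /dvec; ring.
have := Wk t th Ht j; rewrite /sum2 !EG !EK => W.
rewrite Elap /lap W; field.
by [].
Qed.

Lemma expand_mean_curv n (m : nat) (L tau : R) (fh : nat -> R -> R -> vec n) (eps : nat -> R)
  (Zf : 'I_n -> funseq) (e : nat -> vec n) (v1 v2 : vec n) :
  (0 < m)%N -> 0 < L ->
  dot v1 (e 1%N) = 0 -> dot v1 (e 2%N) = 0 -> dot v2 (e 1%N) = 0 -> dot v2 (e 2%N) = 0 ->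
  normsq v1 + normsq v2 = 1 ->
  eventually (fun k => eps k <> 0) ->
  (forall j, converges (fun k t th => fh k t th j) (fun t th => model m e t th j)) ->
  (forall j, converges (fun k t th => mean_curv (fh k) t th j / eps k) (mode (INR m) m (v1 j) (v2 j))) ->
  converges (fun k t th => normsq (dvec false (fh k) t th)) (fun t _ => exp (-2 * INR m * t)) ->
  (forall a, 0 < a -> eventually (fun k => forall t th, strip a t -> conformal_immersion_at (fh k) t th)) ->
  (forall a, 0 < a -> eventually (fun k => forall t th, strip a t -> willmore_at (fh k) t th)) ->
  (forall j, ev_periodic (fun k t th => fh k t th j)) ->
  (forall j, converges (Zf j) (response (- INR m) m tau (- v1 j / (2 * INR m)) (- v2 j / (2 * INR m)) 0 0)) ->
  (forall j, exists c1 c2 d : nat -> R, eventually (fun k => forall t th,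
      fh k t th j = eps k * Zf j k t th + mode (- INR m) m (c1 k) (c2 k) t th + d k)) ->
  let X := fun j k t th => mean_curv (fh k) t th j / eps k ^ 2 in
  (exists C, forall j : Z, eventually (fun k => int_cell L j
     (fun t th => normsq (dvec false (fh k) t th) *
         \big[Rplus/0]_(i < n) off_mode (INR m) m (mid L j) (X i k) t th ^ 2) <= C)) ->
  let c := INR m in let al := normsq v1 in let be := dot v1 v2 in let ga := normsq v2 in
  forall j, let a1 := e 1%N j in let a2 := e 2%N j in
  converges (fun k => off_mode c m (L / 2) (X j k))
    (response c m (L / 2)
       (/ 2 * (a1 * (/ 2 + (al - ga) / 2) + a2 * be)) (/ 2 * (a1 * be + a2 * (/ 2 - (al - ga) / 2)))
       (- / (8 * c) * (a1 * (al - ga) - a2 * (2 * be))) (- / (8 * c) * (a1 * (2 * be) + a2 * (al - ga)))).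
Proof.
move=> m0 L0 v1e1 v1e2 v2e1 v2e2 vv Heps Cf CH CN Cc Cw Pf CZ HZ X [C HC] c al be ga.
have CA := sff_limit m0 v1e1 v1e2 v2e1 v2e2 Heps Cf CN Cc CZ HZ.
have CL := lap_mean_curv_limit m0 vv Heps Cf CH CN Cc Cw CA.
have EXj j : ev_smooth (X j).
  have [E _] := CH j; move=> a Ha; apply: filter_imp (E a Ha) => k S.
  have oD := @open_strip a.
  apply: (smooth_on_ext oD _ (smooth_on_scal (/ eps k) oD S)) => t th _.
  by rewrite /X /Rdiv /= Rmult_1_r Rinv_mult; ring.
have EPj j : ev_periodic (X j).
  move=> a Ha; apply: filter_imp (periodic_mean_curv (fun i => proj1 (Cf i)) Pf Cc j Ha) => k P t th Ht.
  by rewrite /X P.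
move=> j a1 a2.
apply: (response_limit L0 m0 erefl (EXj j) (EPj j) (CL j)).
exact: (cell_weight L0 EXj (proj1 CN) (converges_half_exp CN) HC j).
Qed.

(** * The neck *)

Lemma intQ_shift (D : R -> Prop) L (i : nat) s (j : Z) G G' : open_dom D -> 0 < L ->
  seg_in D (IZR j * L) ((IZR j + 1) * L) -> smooth_on D G' ->
  (forall t th, D t -> G (s + t) th = G' t th) ->
  (INR i - 1) * L = s + IZR j * L ->
  int_Q L i G = int_cell L j G'.
Proof.
move=> oD L0 Sc SG E Ei.
have Ei' : INR i * L = s + (IZR j + 1) * L by lra.
rewrite /int_Q Ei Ei' /int_cyl.
have I := ex_RInt_circ_int oD SG Sc.
have e1 : 1 * (s + IZR j * L) + - s = IZR j * L by ring.
have e2 : 1 * (s + (IZR j + 1) * L) + - s = (IZR j + 1) * L by ring.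
have H := RInt_comp_lin (circ_int G') 1 (- s) (s + IZR j * L) (s + (IZR j + 1) * L).
rewrite e1 e2 in H; rewrite -(H I).
have [ab Hd] := Sc.
apply: RInt_ext => t; rewrite Rmin_left ?Rmax_right; try lra; move=> Ht.
rewrite /scal /= /mult /= Rmult_1_l /circ_int; apply: RInt_extR => z.
rewrite -E; last by apply: Hd; lra.
by congr (G _ z); ring.
Qed.

Lemma projG_hom0 n (m : nat) L (f : R -> R -> vec n) j (D : R -> Prop) t th :
  (0 < m)%N -> open_dom D -> smooth_on D (fun t th => f t th j) -> D (L / 2) ->
  projG m L 1 f t th j
  = mode (- INR m) m (mode_coef (- INR m) m (fun t th => f t th j) true (L / 2))
      (mode_coef (- INR m) m (fun t th => f t th j) false (L / 2)) t th.
Proof.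
move=> m0 oD S Dt.
have E : (fun t th => f (0 + t) th j) = (fun t th => f t th j) by apply: fun2_ext => u v; rewrite Rplus_0_l.
have := @projG_mode n m L 1 f j D 0 (L / 2) t th m0 oD; rewrite E !Rplus_0_l; apply=> //.
by rewrite /midQ /=; field.
Qed.

Lemma projF_hom0 n (m : nat) L (f : R -> R -> vec n) j (D : R -> Prop) t th :
  (0 < m)%N -> open_dom D -> smooth_on D (fun t th => f t th j) -> D (L / 2) ->
  projF m L 1 f t th j
  = mode (INR m) m (mode_coef (INR m) m (fun t th => f t th j) true (L / 2))
      (mode_coef (INR m) m (fun t th => f t th j) false (L / 2)) t th.
Proof.
move=> m0 oD S Dt.
have E : (fun t th => f (0 + t) th j) = (fun t th => f t th j) by apply: fun2_ext => u v; rewrite Rplus_0_l.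
have := @projF_mode n m L 1 f j D 0 (L / 2) t th m0 oD; rewrite E !Rplus_0_l; apply=> //.
by rewrite /midQ /=; field.
Qed.

Lemma off_mode_scal (D : R -> Prop) mu m tau F G x t th : (0 < m)%N -> mu <> 0 -> open_dom D -> smooth_on D F -> D tau -> D t ->
  (forall t th, D t -> G t th = x * F t th) ->
  off_mode mu m tau G t th = x * off_mode mu m tau F t th.
Proof.
move=> m0 mu0 oD S Dtau Dt E.
have Ep i : mode_coef mu m G i tau = x * mode_coef mu m F i tau.
  rewrite -[RHS](@mode_coef_affine D mu m F x 0 i tau) //.
  by apply: (@mode_coef_ext D) => // u v Du; rewrite E //; ring.
by rewrite /off_mode E // !Ep /mode; ring.
Qed.

Lemma span_dot n (e : nat -> vec n) (v : vec n) (l : nat) : orthonormal_basis e ->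
  in_span e 3 n v -> (1 <= l <= n)%N -> (l < 3)%N -> dot v (e l) = 0.
Proof.
move=> ON [c Hc] Hl l3.
rewrite (dot_ext Hc (fun _ => erefl)).
have : forall i, i \in index_iota 3 n.+1 -> dot (e i) (e l) = 0.
  move=> i; rewrite mem_index_iota => /andP [h1 h2].
  rewrite ON ?Hl //; last by apply/andP; split; [apply: leq_trans h1|rewrite -ltnS].
  by case: eqP => // E; rewrite -E ltnNge h1 in l3.
elim: (index_iota 3 n.+1) => [|i r IH] H.
  rewrite /dot (eq_bigr (fun j => 0 * 0)); last by move=> j _; rewrite big_nil; ring.
  by rewrite sum_scal; ring.
rewrite (dot_ext (x' := fun j => 1 * (c i * e i j) + 1 * \big[Rplus/0]_(i0 <- r) (c i0 * e i0 j)) (y' := e l)); last by [].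
  rewrite dot_plusl !dot_scall IH; last by move=> i' Hi'; apply: H; rewrite inE Hi' orbT.
  by rewrite H ?mem_head //; ring.
by move=> j; rewrite big_cons; ring.
Qed.

(** For [n < 3] the span of [e_3, ..., e_n] is zero. *)
Lemma span_dim n (e : nat -> vec n) (v1 v2 : vec n) :
  in_span e 3 n v1 -> in_span e 3 n v2 -> normsq v1 + normsq v2 = 1 -> (3 <= n)%N.
Proof.
move=> [c1 H1] [c2 H2] H; rewrite leqNgt; apply/negP => Hn.
have Z v c : (forall j, v j = \big[Rplus/0]_(3 <= i < n.+1) (c i * e i j)) -> normsq v = 0.
  move=> Hv; rewrite /normsq /dot (eq_bigr (fun j => 0 * 0)); first by rewrite sum_scal; ring.
  by move=> j _; rewrite Hv big_geq //; ring.
by move: H; rewrite (Z _ _ H1) (Z _ _ H2); lra.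
Qed.

Lemma ev_subseq (sigma : nat -> nat) (P : nat -> Prop) : (forall k, (sigma k < sigma k.+1)%N) ->
  eventually P -> eventually (fun k => P (sigma k)).
Proof.
move=> H; have := eventually_subseq sigma (fun k => (elimT ltP (H k))).
by move=> F /F.
Qed.

(** Division by [0] yields [0], which does not approximate a nonzero limit. *)
Lemma divisor_neq0 n m (H : nat -> R -> R -> vec n) (eps : nat -> R) (v1 v2 : vec n) : (0 < m)%N ->
  normsq v1 + normsq v2 = 1 ->
  (forall j, converges (fun k t th => H k t th j / eps k) (mode (INR m) m (v1 j) (v2 j))) ->
  eventually (fun k => eps k <> 0).
Proof.
move=> m0 Hv CH; have m1 : 0 < INR m by apply: lt_0_INR; apply/ltP.
have key j th : mode (INR m) m (v1 j) (v2 j) 0 th <> 0 -> eventually (fun k => eps k <> 0).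
  move=> h0.
  have d0 := Rabs_pos_lt _ h0.
  apply: filter_imp (converges_unif_conv (CH j) Rlt_0_1 d0) => k U E.
  have := U 0 th; rewrite Rabs_R0 E /Rdiv Rinv_0 Rmult_0_r Rminus_0_l Rabs_Ropp => U0.
  by have := U0 (Rlt_le _ _ Rlt_0_1); lra.
have [j [Hj|Hj]] : exists j, v1 j <> 0 \/ v2 j <> 0.
  apply: NNPP => HN.
  have Z (v : vec n) : (forall j, v j = 0) -> normsq v = 0.
    move=> Hz; rewrite /normsq /dot (eq_bigr (fun j => 0 * 0)); first by rewrite sum_scal; ring.
    by move=> j _; rewrite Hz.
  have z1 j : v1 j = 0 by apply: NNPP => h; apply: HN; exists j; left.
  have z2 j : v2 j = 0 by apply: NNPP => h; apply: HN; exists j; right.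
  by move: Hv; rewrite (Z _ z1) (Z _ z2); lra.
- apply: (key j 0); rewrite /mode !Rmult_0_r exp_0 cos_0 sin_0; lra.
- apply: (key j (PI / (2 * INR m))); rewrite /mode Rmult_0_r exp_0.
  have -> : INR m * (PI / (2 * INR m)) = PI / 2 by field; lra.
  by rewrite cos_PI2 sin_PI2; lra.
Qed.

Lemma cell_mid L (j : Z) (D : R -> Prop) : 0 < L -> seg_in D (IZR j * L) ((IZR j + 1) * L) -> D (mid L j).
Proof. by move=> L0 [_ H]; apply: H; lra. Qed.

Lemma midQ_cell L (i : nat) s (j : Z) : (INR i - 1) * L = s + IZR j * L ->
  midQ L i = s + (mid L j).
Proof. by rewrite /midQ => H; lra. Qed.

(** On a cell of the neck the rescaled projection of [f] is the mode of the rescaled map, because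
    the midpoint of the cell is [s + tau]; the powers of [lam] cancel, those of [eps] remain. The
    constant [b] undoes the subtraction of the mean, which the refined bound on [f] does not
    contain. *)
Lemma neck_scaling n (m : nat) L (D : R -> Prop) (f : R -> R -> vec n) (i : nat) s (j : Z) (lam eps : R) (c b : vec n) :
  (0 < m)%N -> 0 < L -> open_dom D -> seg_in D (IZR j * L) ((IZR j + 1) * L) ->
  (INR i - 1) * L = s + IZR j * L -> 0 < lam -> eps <> 0 ->
  let fh := affine_map lam s c f in
  smooth_map D fh -> smooth_map D (mean_curv fh) ->
  (forall t th, D t -> conformal_immersion_at f (s + t) th) ->
  let X1 := fun j t th => / eps * fh t th j + b j in
  let X2 := fun j t th => mean_curv fh t th j / eps ^ 2 in
  let tau := (mid L j) in
  (forall j, b j = lam * c j / eps) ->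
  [/\ int_Q L i (fun t th => exp (- 2 * conf_factor f t th) * normsq (vsub (f t th) (projG m L i f t th)))
      = eps ^ 2 * int_cell L j (fun t th => / normsq (dvec false fh t th) *
           \big[Rplus/0]_(l < n) off_mode (- INR m) m tau (X1 l) t th ^ 2),
     willmore_Q L f i = int_cell L j
          (fun t th => normsq (mean_curv fh t th) * normsq (dvec false fh t th)) &
     int_Q L i (fun t th => exp (2 * conf_factor f t th) * normsq (vsub (mean_curv f t th) (projF m L i (mean_curv f) t th)))
      = eps ^ 4 * int_cell L j (fun t th => normsq (dvec false fh t th) *
           \big[Rplus/0]_(l < n) off_mode (INR m) m tau (X2 l) t th ^ 2)].
Proof.
move=> m0 L0 oD Sc Ei lam0 eps0 fh Sf SH Cf X1 X2 tau Eb.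
have m1 : 0 < INR m by apply: lt_0_INR; apply/ltP.
have Dtau : D tau by exact: cell_mid.
have Em : midQ L i = s + tau by exact: midQ_cell.
have Cfh t th : D t -> conformal_immersion_at fh t th.
  by move=> Dt; apply: conformal_affine_map => //; exact: Cf.
have SN : smooth_on D (fun t th => normsq (dvec false fh t th)).
  by apply: smooth_on_dot => //; exact: smooth_map_dvec.
have SNi : smooth_on D (fun t th => / normsq (dvec false fh t th)).
  by apply: smooth_on_inv => // t th Dt; apply: Rgt_not_eq; exact: (Cfh t th Dt).1.
have SF l : smooth_on D (fun t th => f (s + t) th l).
  apply: (smooth_on_ext oD _ (smooth_on_plus oD (smooth_on_scal (/ lam) oD (Sf l)) (smooth_on_const D (c l)))) => t th _.
  by rewrite /fh /affine_map; field; lra.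
have EH t th l : D t -> mean_curv f (s + t) th l = lam * mean_curv fh t th l.
  by move=> Dt; rewrite (mean_curv_affine_map c l lam0 (Cf t th Dt)); field; lra.
have SHs l : smooth_on D (fun t th => mean_curv f (s + t) th l).
  by apply: (smooth_on_ext oD _ (smooth_on_scal lam oD (SH l))) => t th Dt; rewrite EH.
have S1 l : smooth_on D (X1 l) by apply: smooth_on_plus => //; [exact: smooth_on_scal|exact: smooth_on_const].
have S2 l : smooth_on D (X2 l).
  by apply: (smooth_on_ext oD _ (smooth_on_scal (/ eps ^ 2) oD (SH l))) => t th Dt; rewrite /X2 /Rdiv; ring.
have EN t th : normsq (dvec false fh t th) = lam ^ 2 * normsq (dvec false f (s + t) th).
  exact: normsq_affine_map.
have SG : smooth_on D (fun t th => / normsq (dvec false fh t th) *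
           \big[Rplus/0]_(l < n) off_mode (- INR m) m tau (X1 l) t th ^ 2).
  by apply: smooth_on_mult => //; apply: smooth_on_big => // l; exact: (smooth_on_sq oD (smooth_on_off_mode _ _ _ oD (S1 l))).
have SG2 : smooth_on D (fun t th => normsq (dvec false fh t th) *
           \big[Rplus/0]_(l < n) off_mode (INR m) m tau (X2 l) t th ^ 2).
  by apply: smooth_on_mult => //; apply: smooth_on_big => // l; exact: (smooth_on_sq oD (smooth_on_off_mode _ _ _ oD (S2 l))).
have sumsq (x y : vec n) (k : R) : (forall l, y l = k * x l) ->
    normsq x * k ^ 2 = \big[Rplus/0]_(l < n) y l ^ 2.
  by move=> E; rewrite /normsq /dot Rmult_comm -sum_scal; apply: eq_bigr => l _; rewrite E; ring.
split.
- rewrite -(cyl_scal _ oD Sc SG).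
  apply: (@intQ_shift D L i s j _ _ oD L0 Sc (smooth_on_scal _ oD SG) _ Ei) => t th Dt.
  have [N0 _] := Cf t th Dt; have [_ ->] := exp_conf N0.
  rewrite -(sumsq (vsub (f (s + t) th) (projG m L i f (s + t) th)) _ (lam / eps)).
    by rewrite EN; field; repeat split=> //; lra.
  move=> l; rewrite /vsub (projG_mode t th m0 oD (SF l) Dtau Em).
  rewrite (@off_mode_scal D (- INR m) m tau (fun t th => f (s + t) th l) (X1 l) (lam / eps)) //.
    lra.
  by move=> u v _; rewrite /X1 Eb /fh /affine_map; field.
- apply: (@intQ_shift D L i s j _ _ oD L0 Sc _ _ Ei).
    by apply: smooth_on_mult => //; exact: smooth_on_dot.
  move=> t th Dt; have [N0 _] := Cf t th Dt; have [-> _] := exp_conf N0.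
  have -> : normsq (mean_curv f (s + t) th) = lam ^ 2 * normsq (mean_curv fh t th).
    by rewrite -normsq_scal; apply: dot_ext => l; exact: EH.
  by rewrite EN; ring.
- rewrite -(cyl_scal _ oD Sc SG2).
  apply: (@intQ_shift D L i s j _ _ oD L0 Sc (smooth_on_scal _ oD SG2) _ Ei) => t th Dt.
  have [N0 _] := Cf t th Dt; have [-> _] := exp_conf N0.
  rewrite -(sumsq (vsub (mean_curv f (s + t) th) (projF m L i (mean_curv f) (s + t) th)) _ (/ lam / eps ^ 2)).
    by rewrite EN; field; repeat split=> //; lra.
  move=> l; rewrite /vsub (projF_mode t th m0 oD (SHs l) Dtau Em).
  rewrite (@off_mode_scal D (INR m) m tau (fun t th => mean_curv f (s + t) th l) (X2 l) (/ lam / eps ^ 2)) //.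
    lra.
  by move=> u v Du; rewrite /X2 EH //; field; split=> //; lra.
Qed.

(** The limit [h] of [H / eps] satisfies [|h|^2 e^(-2mt) <= |v_1|^2 + |v_2|^2 = 1]; hence the energy
    density is in the end at most [2 eps^2], on a cell of area [2 pi L]. *)
Lemma cell_willmore_le n (m : nat) L (fh : nat -> R -> R -> vec n) (ep : nat -> R) (v1 v2 : vec n) (j : Z) :
  0 < L -> normsq v1 + normsq v2 = 1 -> eventually (fun k => ep k <> 0) ->
  (forall j, ev_smooth (fun k t th => fh k t th j)) ->
  (forall j, converges (fun k t th => mean_curv (fh k) t th j / ep k) (mode (INR m) m (v1 j) (v2 j))) ->
  converges (fun k t th => normsq (dvec false (fh k) t th)) (fun t _ => exp (-2 * INR m * t)) ->
  eventually (fun k => 0 <= int_cell L j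
      (fun t th => normsq (mean_curv (fh k) t th) * normsq (dvec false (fh k) t th)) <= ep k ^ 2 * (4 * PI * L)).
Proof.
move=> L0 Hv ep0 Ef CH CN; set c := INR m.
pose A := Rabs (IZR j) * L + L + 1.
have A0 : 0 < A by have := Rabs_pos (IZR j) => h; have : 0 <= Rabs (IZR j) * L by [apply: Rmult_le_pos; lra]; rewrite /A; lra.
have oD := @open_strip A.
have Sc : seg_in (strip A) (IZR j * L) ((IZR j + 1) * L) by apply: seg_in_cell => //; rewrite /A; lra.
have Chh := converges_mult (converges_dot (F := fun k t th l => mean_curv (fh k) t th l / ep k)
   (F' := fun k t th l => mean_curv (fh k) t th l / ep k) CH CH) CN.
have hh t th : dot (fun l => mode c m (v1 l) (v2 l) t th) (fun l => mode c m (v1 l) (v2 l) t th) * exp (-2 * c * t) <= 1.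
  have Eh l : mode c m (v1 l) (v2 l) t th = exp (c * t) * (cos (c * th) * v1 l + sin (c * th) * v2 l).
    by rewrite /mode -/c; ring.
  rewrite -/(normsq _) (_ : normsq (fun l => mode c m (v1 l) (v2 l) t th) = exp (c * t) ^ 2 * normsq (fun l => cos (c * th) * v1 l + sin (c * th) * v2 l)); last first.
    by rewrite -normsq_scal; apply: dot_ext => l; exact: Eh.
  have -> : exp (-2 * c * t) = exp (- c * t) ^ 2.
    by have -> : -2 * c * t = - c * t + - c * t by [ring]; rewrite exp_plus; ring.
  have -> : forall x, exp (c * t) ^ 2 * x * exp (- c * t) ^ 2 = (exp (- c * t) * exp (c * t)) ^ 2 * x by move=> x; ring.
  rewrite exp_mulN pow1 Rmult_1_l -Hv /normsq /dot -sum_plus.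
  apply: sum_le => l.
  have := sin2_cos2 (c * th); rewrite /Rsqr => sc.
  have := pow2_ge_0 (sin (c * th) * v1 l - cos (c * th) * v2 l) => h.
  have -> : v1 l * v1 l + v2 l * v2 l = (sin (c * th) * sin (c * th) + cos (c * th) * cos (c * th)) * (v1 l * v1 l + v2 l * v2 l) by rewrite sc; ring.
  by nra.
have E1 := converges_unif_conv Chh A0 Rlt_0_1.
have SHe : eventually (fun k => forall j, smooth_on (strip A) (fun t th => mean_curv (fh k) t th j / ep k)).
  by apply: eventually_ord => i; exact: (proj1 (CH i) A A0).
have Sf : eventually (fun k => smooth_map (strip A) (fh k)) by apply: eventually_ord => i; exact: Ef.
apply: filter_imp (filter_and _ _ (filter_and _ _ Sf SHe) (filter_and _ _ ep0 E1)) => k [[Sk SHk'] [ne Ek]].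
have SHk : smooth_map (strip A) (mean_curv (fh k)).
  by move=> i; apply: (smooth_on_ext oD _ (smooth_on_scal (ep k) oD (SHk' i))) => t th _; field.
have SN : smooth_on (strip A) (fun t th => normsq (dvec false (fh k) t th)).
  by apply: smooth_on_dot => //; exact: smooth_map_dvec.
have SW : smooth_on (strip A) (fun t th => normsq (mean_curv (fh k) t th) * normsq (dvec false (fh k) t th)).
  by apply: smooth_on_mult => //; exact: smooth_on_dot.
have e2 : 0 < ep k ^ 2 by have := pow2_gt_0 _ ne.
split; last first.
  have -> : ep k ^ 2 * (4 * PI * L) = int_cell L j (fun _ _ => ep k ^ 2 * 2).
    by rewrite cyl_const; ring.
  apply: (cyl_le oD Sc SW (smooth_on_const _ _)) => t th Ht.
  have {}Ek : Rabs (dot (fun l => mean_curv (fh k) t th l / ep k) (fun l => mean_curv (fh k) t th l / ep k)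
      * normsq (dvec false (fh k) t th)
      - dot (fun l => mode c m (v1 l) (v2 l) t th) (fun l => mode c m (v1 l) (v2 l) t th) * exp (-2 * c * t)) < 1.
    exact: Ek t th (Rlt_le _ _ (proj2 Sc t Ht)).
  have -> : normsq (mean_curv (fh k) t th) = ep k ^ 2 * dot (fun l => mean_curv (fh k) t th l / ep k) (fun l => mean_curv (fh k) t th l / ep k).
    by rewrite -/(normsq _) -normsq_scal; apply: dot_ext => l; field.
  rewrite Rmult_assoc; apply: Rmult_le_compat_l; first lra.
  by have := hh t th; move: Ek => /Rabs_def2; lra.
by apply: (cyl_ge0 oD Sc SW) => t th _; apply: Rmult_le_pos; exact: normsq_ge0.
Qed.

Theorem theorem1p10 :
  forall (m : nat) (q : R), (1 <= m)%N -> 0 < q < 2 ->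
  exists L0 : R, 0 < L0 /\
  forall (L : R), L0 <= L ->
  forall (n : nat) (M : nat -> nat) (f : nat -> R -> R -> vec n)
         (a b a' b' : nat -> nat),
  let T := fun k => INR (M k) * L in
  (forall k, conformal_willmore_immersion (T k) (f k)) ->
  conf_factor_assumption m T f ->
  small_energy_assumption T f ->
  mean_assumption T f ->
  neck_data m L M f a b ->
  refined_neck_data m L M f a b a' b' ->
  forall (i : nat -> nat),
  is_lim_seq (fun k => INR (i k) - INR (a' k)) p_infty ->
  is_lim_seq (fun k => INR (b' k) - INR (i k)) p_infty ->
  let fhat := fun k => rescaled L (f k) (i k) in
  let Hhat := fun k => mean_curv (fhat k) in
  let eps := fun k => eps_Q1 L (fhat k) in
  forall (sigma : nat -> nat) (e : nat -> vec n) (v1 v2 : vec n),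
  (forall k, (sigma k < sigma k.+1)%N) ->
  orthonormal_basis e ->
  in_span e 3 n v1 -> in_span e 3 n v2 ->
  normsq v1 + normsq v2 = 1 ->
  Cinf_loc_lim (fun k => fhat (sigma k))
    (fun t th j => / INR m * exp (- INR m * t) *
       (cos (INR m * th) * e 1%N j + sin (INR m * th) * e 2%N j)) ->
  Cinf_loc_lim (fun k t th j => Hhat (sigma k) t th j / eps (sigma k))
    (fun t th j => exp (INR m * t) *
       (v1 j * cos (INR m * th) + v2 j * sin (INR m * th))) ->
  (exists c : nat -> vec n,
     Cinf_loc_lim
       (fun k t th j =>
          (fhat (sigma k) t th j - projG m L 1 (fhat (sigma k)) t th j)
          / eps (sigma k) + c k j)
       (fun t th j =>
          (- / (2 * INR m) * (t - L / 2) - / (4 * INR m ^ 2))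
          * exp (- INR m * t)
          * (v1 j * cos (INR m * th) + v2 j * sin (INR m * th)))) /\
  (exists w : R -> R -> vec n,
     Cinf_loc_lim
       (fun k t th j =>
          (Hhat (sigma k) t th j - projF m L 1 (Hhat (sigma k)) t th j)
          / eps (sigma k) ^ 2) w /\
     forall t th, in_span e 1 2 (w t th)).
Proof.
move=> m q m0 _; exists 1; split; first lra.
move=> L HL n M f a b a' b' T CWI _ _ _ ND RND i Hi1 Hi2 fhat Hhat eps sigma e v1 v2 Hsig ON S1 S2 Hv CF0 CH0.
have L0 : 0 < L by lra.
have m1 : 0 < INR m by apply: lt_0_INR; apply/ltP.
set c := INR m; have c0 : 0 < c by [].
have PI0 := PI_RGT_0.
have n3 := span_dim S1 S2 Hv.
have l1 : (1 <= 1 <= n)%N by rewrite /= (leq_trans _ n3).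
have l2 : (1 <= 2 <= n)%N by rewrite /= (leq_trans _ n3).
have e11 : dot (e 1%N) (e 1%N) = 1 by rewrite ON.
have e22 : dot (e 2%N) (e 2%N) = 1 by rewrite ON.
have e12 : dot (e 1%N) (e 2%N) = 0 by rewrite ON.
have v1e1 : dot v1 (e 1%N) = 0 by apply: span_dot ON S1 l1 _.
have v1e2 : dot v1 (e 2%N) = 0 by apply: span_dot ON S1 l2 _.
have v2e1 : dot v2 (e 1%N) = 0 by apply: span_dot ON S2 l1 _.
have v2e2 : dot v2 (e 2%N) = 0 by apply: span_dot ON S2 l2 _.
pose g k := f (sigma k).
pose s k := (INR (i (sigma k)) - 1) * L.
pose lam k := exp (- conf_factor (g k) (s k) 0).
pose mean k : vec n := fun j => / (2 * PI) * RInt (fun z => g k (s k) z j) 0 (2 * PI).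
pose fh k := affine_map (lam k) (s k) (mean k) (g k).
pose ep k := eps (sigma k).
have lam0 k : 0 < lam k by exact: exp_pos.
have Cf j : converges (fun k t th => fh k t th j) (fun t th => model m e t th j).
  exact: (Cinf_loc_lim_converges (tame_model m e j) CF0).
have CH j : converges (fun k t th => mean_curv (fh k) t th j / ep k) (mode c m (v1 j) (v2 j)).
  exact: (Cinf_loc_lim_converges (j := j) (tame_mode _ _ _ _) CH0).
have ep0 := divisor_neq0 m0 Hv CH.
(* The refined bounds need [a' < i < b'], and conformality and periodicity need times in
   [0, T]; both hold on every fixed window because [i - a'] and [b' - i] tend to infinity. *)
have range A : eventually (fun k => INR (a' (sigma k)) + A < INR (i (sigma k)) /\
     INR (i (sigma k)) + A < INR (b' (sigma k))).
  have h1 := ev_subseq Hsig (proj2 (is_lim_seq_spec _ p_infty) Hi1 A).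
  have h2 := ev_subseq Hsig (proj2 (is_lim_seq_spec _ p_infty) Hi2 A).
  by apply: filter_imp (filter_and _ _ h1 h2) => k [k1 k2]; lra.
have range2 A : 0 < A -> eventually (fun k => forall t, strip A t -> 0 < s k + t < T (sigma k)).
  move=> A0; apply: filter_imp (range (A / L + 1)) => k [h1 h2] t /Rabs_def2 Ht.
  have [ND1 _] := ND; have [_ [_ bM]] := ND1 (sigma k).
  have [RND1 _] := RND; have [_ [_ b'b]] := RND1 (sigma k).
  have a'0 := pos_INR (a' (sigma k)).
  have bM' : INR (b' (sigma k)) < INR (M (sigma k)) by apply: lt_INR; apply/ltP; exact: ltn_trans b'b bM.
  have AL : A / L * L = A by field; lra.
  have g1 : (A / L) * L < (INR (i (sigma k)) - 1) * L by apply: Rmult_lt_compat_r; lra.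
  have g2 : (INR (i (sigma k)) + (A / L + 1)) * L < INR (M (sigma k)) * L by apply: Rmult_lt_compat_r; lra.
  rewrite /s /T; lra.
have Cc0 A : 0 < A -> eventually (fun k => forall t th, strip A t -> conformal_immersion_at (g k) (s k + t) th).
  move=> A0; apply: filter_imp (range2 A A0) => k R2 t th Ht.
  by have [_ [C _]] := CWI (sigma k); apply: C; have := R2 t Ht; lra.
have Cc A : 0 < A -> eventually (fun k => forall t th, strip A t -> conformal_immersion_at (fh k) t th).
  by move=> A0; apply: filter_imp (Cc0 A A0) => k H t th Ht; apply: conformal_affine_map => //; exact: H.
have Cw A : 0 < A -> eventually (fun k => forall t th, strip A t -> willmore_at (fh k) t th).
  move=> A0; apply: filter_imp (range2 A A0) => k R2 t th Ht.
  have [_ [C W]] := CWI (sigma k).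
  apply: (@willmore_affine_map n (lam k) (s k) (mean k) (g k) (T (sigma k))) => //; last exact: R2.
  by move=> u z Hu; split; [apply: C|apply: W]; lra.
have Pf j : ev_periodic (fun k t th => fh k t th j).
  move=> A A0; apply: filter_imp (range2 A A0) => k R2 t th Ht.
  have [[dl [dl0 [_ P]]] _] := CWI (sigma k).
  by rewrite /fh /affine_map /g P //; have := R2 t Ht; rewrite /T; lra.
have Sf A : 0 < A -> eventually (fun k => smooth_map (strip A) (fh k)).
  by move=> A0; apply: eventually_ord => j; have [E _] := Cf j; exact: E.
have SH A : 0 < A -> eventually (fun k => smooth_map (strip A) (mean_curv (fh k))).
  move=> A0.
  have E : eventually (fun k => forall j, smooth_on (strip A) (fun t th => mean_curv (fh k) t th j / ep k)).
    by apply: eventually_ord => j; have [E _] := CH j; exact: E.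
  apply: filter_imp (filter_and _ _ E ep0) => k [H ne] j.
  apply: (smooth_on_ext (@open_strip A) _ (smooth_on_scal (ep k) (@open_strip A) (H j))) => t th _.
  by field.
(* Adding the mean back, divided by [eps]: the constant of the first claim. *)
pose bb k : vec n := fun j => lam k * mean k j / ep k.
pose X1 j k t th := / ep k * fh k t th j + bb k j.
pose X2 j k t th := mean_curv (fh k) t th j / ep k ^ 2.
have CN : converges (fun k t th => normsq (dvec false (fh k) t th)) (fun t _ => exp (-2 * c * t)).
  exact: speed_limit m0 e11 e22 e12 Cf.
have [_ [_ [C HC]]] := RND.
have bnd0 : forall j : Z, eventually (fun k =>
   [/\ ep k <> 0,
     int_cell L j (fun t th => / normsq (dvec false (fh k) t th) *
           \big[Rplus/0]_(l < n) off_mode (- c) m (mid L j) (X1 l k) t th ^ 2) <= Rabs C * (4 * PI * L) &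
     int_cell L j (fun t th => normsq (dvec false (fh k) t th) *
           \big[Rplus/0]_(l < n) off_mode c m (mid L j) (X2 l k) t th ^ 2) <= Rabs C * (4 * PI * L) ^ 2]).
  move=> j.
  pose A := Rabs (IZR j) * L + L + 1.
  have A0 : 0 < A by have := Rabs_pos (IZR j) => h; have : 0 <= Rabs (IZR j) * L by [apply: Rmult_le_pos; lra]; rewrite /A; lra.
  have oD := @open_strip A.
  have Sc : seg_in (strip A) (IZR j * L) ((IZR j + 1) * L) by apply: seg_in_cell => //; rewrite /A; lra.
  have EW := cell_willmore_le j L0 Hv ep0 (fun i => proj1 (Cf i)) CH CN.
  apply: filter_imp (filter_and _ _ (filter_and _ _ (filter_and _ _ (Sf A A0) (SH A A0)) (filter_and _ _ ep0 EW))
    (filter_and _ _ (Cc0 A A0) (range (Rabs (IZR j) + 1)))).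
  move=> k [[[Sk SHk] [ne [W0 Wle]]] [Ck [r1 r2]]].
  pose ik := Z.to_nat (Z.of_nat (i (sigma k)) + j).
  have jb : - Rabs (IZR j) <= IZR j <= Rabs (IZR j) by apply/Rabs_le_between; exact: Rle_refl.
  have a'0 := pos_INR (a' (sigma k)).
  have Eik : INR ik = INR (i (sigma k)) + IZR j.
    rewrite INR_IZR_INZ /ik Z2Nat.id ?plus_IZR -?INR_IZR_INZ //.
    by apply: le_IZR; rewrite plus_IZR -INR_IZR_INZ; lra.
  have i1 : (a' (sigma k) < ik)%N by apply/ltP; apply: INR_lt; rewrite Eik; lra.
  have i2 : (ik < b' (sigma k))%N by apply/ltP; apply: INR_lt; rewrite Eik; lra.
  have Eis : (INR ik - 1) * L = s k + IZR j * L by rewrite Eik /s; ring.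
  have [HC1 HC2] := HC (sigma k) ik i1 i2.
  have [N1 N2 N3] := @neck_scaling n m L (strip A) (g k) ik (s k) j (lam k) (ep k) (mean k) (bb k)
     m0 L0 oD Sc Eis (lam0 k) ne Sk SHk Ck (fun _ => erefl).
  rewrite N1 N2 in HC1; rewrite N3 N2 in HC2.
  have e2 : 0 < ep k ^ 2 by have := pow2_gt_0 _ ne.
  split=> //.
  - apply: (Rmult_le_reg_l (ep k ^ 2)) => //; apply: Rle_trans HC1 _.
    have -> : ep k ^ 2 * (Rabs C * (4 * PI * L)) = Rabs C * (ep k ^ 2 * (4 * PI * L)) by ring.
    apply: (Rle_trans _ (Rabs C * int_cell L j
          (fun t th => normsq (mean_curv (fh k) t th) * normsq (dvec false (fh k) t th)))).
      by apply: Rmult_le_compat_r => //; exact: Rle_abs.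
    by apply: Rmult_le_compat_l => //; exact: Rabs_pos.
  - apply: (Rmult_le_reg_l (ep k ^ 4)); first by have -> : ep k ^ 4 = ep k ^ 2 * ep k ^ 2 by [ring]; exact: Rmult_lt_0_compat.
    apply: Rle_trans HC2 _.
    have -> : ep k ^ 4 * (Rabs C * (4 * PI * L) ^ 2) = Rabs C * (ep k ^ 2 * (4 * PI * L)) ^ 2 by ring.
    apply: (Rle_trans _ (Rabs C * (int_cell L j
          (fun t th => normsq (mean_curv (fh k) t th) * normsq (dvec false (fh k) t th))) ^ 2)).
      by apply: Rmult_le_compat_r; [exact: pow2_ge_0|exact: Rle_abs].
    by apply: Rmult_le_compat_l; [exact: Rabs_pos|apply: pow_incr].
have B1 : exists C, forall j : Z, eventually (fun k => int_cell L j
     (fun t th => / normsq (dvec false (fh k) t th) *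
         \big[Rplus/0]_(l < n) off_mode (- INR m) m (mid L j) (X1 l k) t th ^ 2) <= C).
  by exists (Rabs C * (4 * PI * L)) => j; apply: filter_imp (bnd0 j) => k [].
have B2 : exists C, forall j : Z, eventually (fun k => int_cell L j
     (fun t th => normsq (dvec false (fh k) t th) *
         \big[Rplus/0]_(l < n) off_mode (INR m) m (mid L j) (X2 l k) t th ^ 2) <= C).
  by exists (Rabs C * (4 * PI * L) ^ 2) => j; apply: filter_imp (bnd0 j) => k [].
have Part1 := expand_immersion m0 L0 CN Cf CH Cc Pf B1.
have HZ j : exists c1 c2 d : nat -> R, eventually (fun k => forall t th,
      fh k t th j = ep k * off_mode (- c) m (L / 2) (X1 j k) t th + mode (- c) m (c1 k) (c2 k) t th + d k).
  exists (fun k => ep k * mode_coef (- c) m (X1 j k) true (L / 2)), (fun k => ep k * mode_coef (- c) m (X1 j k) false (L / 2)), (fun k => - (ep k * bb k j)).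
  apply: filter_imp ep0 => k ne t th.
  rewrite /off_mode /mode.
  have -> : forall x y z, ep k * (x - exp (- c * t) * (y * cos (INR m * th) + z * sin (INR m * th)))
     + exp (- c * t) * (ep k * y * cos (INR m * th) + ep k * z * sin (INR m * th)) + - (ep k * bb k j) = ep k * x - ep k * bb k j by move=> *; ring.
  by rewrite /X1; field.
have Part2 := expand_mean_curv m0 L0 v1e1 v1e2 v2e1 v2e2 Hv ep0 Cf CH CN Cc Cw Pf Part1 HZ B2.
have LL : 0 < L / 2 + 1 by lra.
have Dm : strip (L / 2 + 1) (L / 2) by rewrite /strip Rabs_pos_eq; lra.
have oDm := @open_strip (L / 2 + 1).
have hper c1 c2 (d : nat) th : c1 * cos (INR d * (th + 2 * PI)) + c2 * sin (INR d * (th + 2 * PI))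
    = c1 * cos (INR d * th) + c2 * sin (INR d * th).
  by have := trig_periodic true d th; have := trig_periodic false d th; rewrite /trig => -> ->.
have rper mu tau p1 q1 r1 s1 t th : response mu m tau p1 q1 r1 s1 t (th + 2 * PI) = response mu m tau p1 q1 r1 s1 t th.
  rewrite /response hper; have -> : 3 * INR m = INR (3 * m) by rewrite mult_INR /=; ring.
  by rewrite hper.
split.
- exists bb; apply: converges_Cinf_loc_lim => [t th j|j].
    by rewrite hper.
  apply: converges_ext (Part1 j); last by move=> t th; rewrite /response -/c; field; lra.
  move=> A A0; apply: filter_imp (filter_and _ _ ep0 (Sf _ LL)) => k [ne S] t th _.
  rewrite (projG_hom0 t th m0 oDm (S j) Dm) /off_mode.
  have Ep l : mode_coef (- INR m) m (X1 j k) l (L / 2) = / ep k * mode_coef (- INR m) m (fun t th => fh k t th j) l (L / 2).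
    by apply: (@mode_coef_affine (strip (L / 2 + 1))) => //; lra.
  have -> : fhat (sigma k) t th j = fh k t th j by [].
  by rewrite !Ep /X1 /mode -/(ep k) /Rdiv; ring.
- pose al := normsq v1; pose be := dot v1 v2; pose ga := normsq v2.
  (* The response is linear in its coefficients, which are linear in the components of [e_1], [e_2]. *)
  pose w1 := response c m (L / 2) (/ 2 * (/ 2 + (al - ga) / 2)) (/ 2 * be) (- / (8 * c) * (al - ga)) (- / (8 * c) * (2 * be)).
  pose w2 := response c m (L / 2) (/ 2 * be) (/ 2 * (/ 2 - (al - ga) / 2)) (- / (8 * c) * - (2 * be)) (- / (8 * c) * (al - ga)).
  exists (fun t th j => w1 t th * e 1%N j + w2 t th * e 2%N j); split; last first.
    move=> t th; exists (fun l => if l == 1%N then w1 t th else w2 t th) => j.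
    by rewrite big_ltn // big_ltn // big_geq //= Rplus_0_r.
  apply: converges_Cinf_loc_lim => [t th j|j].
    by rewrite /w1 /w2 !rper.
  apply: converges_ext (Part2 j); last by move=> t th; rewrite /w1 /w2 /response -/al -/be -/ga -/c; ring.
  move=> A A0; apply: filter_imp (filter_and _ _ ep0 (SH _ LL)) => k [ne S] t th _.
  rewrite (projF_hom0 t th m0 oDm (S j) Dm).
  have Ep u z : strip (L / 2 + 1) u -> X2 j k u z = / ep k ^ 2 * mean_curv (fh k) u z j.
    by move=> _; rewrite /X2 /Rdiv; ring.
  have Epc l : mode_coef c m (X2 j k) l (L / 2) = / ep k ^ 2 * mode_coef c m (fun t th => mean_curv (fh k) t th j) l (L / 2).
    rewrite -[RHS](@mode_coef_affine (strip (L / 2 + 1)) c m _ _ 0) //; last exact: Rgt_not_eq.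
    by apply: (@mode_coef_ext (strip (L / 2 + 1))) => // u z Du; rewrite Ep //; ring.
  have -> : Hhat (sigma k) t th j = mean_curv (fh k) t th j by [].
  by rewrite /off_mode -/c !Epc /X2 /mode -/(ep k) /Rdiv; ring.
Qed.
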